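(* Fix $T>0$ and let $Q$ be a bounded equicontinuous subset of $H^{-1}(\mathbb R)$. Let $\{q_n(0)\}_{n\in\mathbb N}$ be a sequence of Schwartz functions in $Q$ and let $q_n$ be the solution to the Korteweg--de Vries equation $\frac{d}{dt}q=-q'''+6qq'$ on $\mathbb R$ with initial data $q_n(0)$. Suppose that $$q_n(0)\rightharpoonup q(0)\quad\text{weakly in } H^{-1}(\mathbb R)\text{ as }n\to\infty.$$ Then, if $q$ is the solution to the Korteweg--de Vries equation with initial data $q(0)$, passing to a subsequence, $$q_n(T)\rightharpoonup q(T)\quad\text{weakly in } H^{-1}(\mathbb R)\text{ as }n\to\infty.$$
   Context: All functions are real-valued. A subset $Q\subset H^{-1}(\mathbb R)$ is equicontinuous if $q(\cdot+h)\to q$ in $H^{-1}(\mathbb R)$ as $h\to0$, uniformly for $q\in Q$. The solution map of KdV extends uniquely from Schwartz initial data to a jointly continuous map $\Phi:\mathbb R\times H^{-1}(\mathbb R)\to H^{-1}(\mathbb R)$ (Killip--Visan), and ''the solution with initial data $q(0)$'' means $q(t)=\Phi(t,q(0))$. *)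

(* Defs.v *)
From HB Require Import structures.
From mathcomp Require Import all_boot all_order all_algebra.
From mathcomp Require Import all_classical all_reals all_analysis.
From mathcomp Require Import measurable_realfun.
From mathcomp Require Import ring lra.

Set Implicit Arguments.
Unset Strict Implicit.
Unset Printing Implicit Defensive.

Import Order.TTheory GRing.Theory Num.Theory.
Import numFieldNormedType.Exports.

Local Open Scope classical_set_scope.
Local Open Scope ring_scope.

Local Notation "f ^` ()" := (derive1 f) : ring_scope.
Local Notation "f ^` ( n )" := (derive1n n f) : ring_scope.

Section Schwartz.
Context {R : realType}.
Implicit Types (f g : R -> R) (k m : nat) (c x : R).

Definition smooth f := forall m x, derivable f^`(m) x 1.

(* Extended-real valued, so that it is meaningful before boundedness is known. *)
Definition schwartz_seminorm k m f : \bar R :=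
  ereal_sup [set (`|x ^+ k * f^`(m) x|)%:E | x in [set: R]].

Definition schwartz_pred : {pred R -> R} := fun f =>
  `[< smooth f /\ forall k m, (schwartz_seminorm k m f < +oo)%E >].

Lemma schwartz_seminorm_ltyP k m f :
  (schwartz_seminorm k m f < +oo)%E <->
  exists C, forall x, `|x ^+ k * f^`(m) x| <= C.
Proof.
split=> [|[C fC]].
  have h x : ((`|x ^+ k * f^`(m) x|)%:E <= schwartz_seminorm k m f)%E.
    by apply: ereal_sup_ubound; exists x.
  case E : (schwartz_seminorm k m f) h => [r||] h //= _.
    by exists r => x; rewrite -lee_fin.
  by have := h 0; rewrite leeNy_eq.
apply: (@le_lt_trans _ _ C%:E); last exact: ltry.
by apply: ge_ereal_sup => _ [x _ <-]; rewrite lee_fin.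
Qed.

Lemma schwartz_predP f : reflect
  (smooth f /\ forall k m, exists C, forall x, `|x ^+ k * f^`(m) x| <= C)
  (f \in schwartz_pred).
Proof.
apply: (iffP (asboolP _)) => -[sf H]; split=> // k m.
- exact/schwartz_seminorm_ltyP.
- exact/schwartz_seminorm_ltyP.
Qed.

Lemma derive1n_lin c f g m : smooth f -> smooth g ->
  (c *: f + g)^`(m) = c *: f^`(m) + g^`(m).
Proof.
move=> sf sg; elim: m => [//|m IH].
rewrite !derive1nS IH; apply/funext => x.
have dcf : derivable (c *: f^`(m)) x 1 by exact: derivableZ (sf m x).
by rewrite derive1E (deriveD dcf (sg m x)) (deriveZ _ (sf m x)) !fctE !derive1E.
Qed.

Lemma schwartz_submod_closed : submod_closed schwartz_pred.
Proof.
split.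
  have d0 m : (0 : R -> R)^`(m) = 0.
    elim: m => [//|m IH]; rewrite derive1nS IH.
    by apply/funext => x; rewrite derive1E derive_cst.
  apply/schwartz_predP; split=> [m x|k m]; first by rewrite d0; exact: derivable_cst.
  by exists 0 => x; rewrite d0 /= mulr0 normr0.
move=> c f g /schwartz_predP[sf bf] /schwartz_predP[sg bg].
apply/schwartz_predP; split=> [m x|k m].
  by rewrite derive1n_lin//; apply: derivableD => //; exact: derivableZ.
have [Cf hf] := bf k m; have [Cg hg] := bg k m.
exists (`|c| * Cf + Cg) => x; rewrite derive1n_lin//=.
rewrite (_ : x ^+ k * _ = c * (x ^+ k * f^`(m) x) + x ^+ k * g^`(m) x); last first.
  by rewrite -[(_ + _) x]/(c * f^`(m) x + g^`(m) x); ring.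
by rewrite (le_trans (ler_normD _ _))// normrM lerD// ler_wpM2l.
Qed.

HB.instance Definition _ := GRing.isSubmodClosed.Build R (R -> R) schwartz_pred
  schwartz_submod_closed.

Lemma derive1n_shift c f m : (f \o shift c)^`(m) = f^`(m) \o shift c.
Proof.
elim: m => [//|m IH]; rewrite !derive1nS IH.
apply/funext => x; rewrite /= /derive1.
suff -> : (fun h => h^-1 *: ((f^`(m) \o shift c) (h + x) -
    (f^`(m) \o shift c) x)) =
  (fun h => h^-1 *: (f^`(m) (h + (x + c)) - f^`(m) (x + c))) by [].
by apply/funext => h /=; rewrite addrA.
Qed.

Lemma derivable_comp_shift c f x :
  derivable f (x + c) 1 -> derivable (f \o shift c) x 1.
Proof.
rewrite /derivable.
suff -> : (fun h => h^-1 *: ((f \o shift c) (h *: (1 : R) + x) -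
    (f \o shift c) x)) =
  (fun h => h^-1 *: (f (h *: (1 : R) + (x + c)) - f (x + c))) by [].
by apply/funext => h /=; rewrite addrA.
Qed.

Lemma schwartz_shift_subproof c f :
  f \in schwartz_pred -> f \o shift c \in schwartz_pred.
Proof.
move=> /schwartz_predP[sf bf]; apply/schwartz_predP; split=> [m x|k m].
  by rewrite derive1n_shift; exact: derivable_comp_shift.
have [A hA] := bf k m; have [B hB] := bf 0%N m.
exists (2 ^+ k * (A + `|c| ^+ k * B)) => x.
rewrite derive1n_shift /=.
have xk : `|x| ^+ k <= 2 ^+ k * (`|x + c| ^+ k + `|c| ^+ k).
  have h : `|x| <= `|x + c| + `|c|.
    by rewrite -{1}(addrK c x) (le_trans (ler_normB _ _)).
  have [cx|cx] := leP `|x + c| `|c|.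
    apply: (@le_trans _ _ ((2 * `|c|) ^+ k)).
      by rewrite lerXn2r ?nnegrE ?mulr_ge0//; lra.
    by rewrite exprMn ler_pM2l ?exprn_gt0// lerDr exprn_ge0.
  apply: (@le_trans _ _ ((2 * `|x + c|) ^+ k)).
    by rewrite lerXn2r ?nnegrE ?mulr_ge0//; lra.
  by rewrite exprMn ler_pM2l ?exprn_gt0// lerDl exprn_ge0.
rewrite normrM normrX (le_trans (ler_wpM2r _ xk))//.
rewrite -mulrA ler_pM2l ?exprn_gt0// mulrDl lerD//.
  by rewrite -normrX -normrM.
by rewrite ler_wpM2l ?exprn_ge0//; have := hB (x + c); rewrite expr0 mul1r.
Qed.

End Schwartz.

Record schwartz (R : realType) := Schwartz {
  schwartz_fun :> R -> R ;
  schwartz_funP : schwartz_fun \in schwartz_pred }.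

HB.instance Definition _ (R : realType) := [isSub for @schwartz_fun R].
HB.instance Definition _ (R : realType) := [Choice of schwartz R by <:].
HB.instance Definition _ (R : realType) :=
  [SubChoice_isSubLmodule of schwartz R by <:].

Section SchwartzIntegral.
Context {R : realType}.
Implicit Types (f g phi : schwartz R) (c x : R) (m n : nat).
Local Notation mu := (@lebesgue_measure R).

Lemma schwartz_smooth f : smooth f.
Proof. by have /schwartz_predP[] := schwartz_funP f. Qed.

Lemma schwartz_continuous f m : continuous f^`(m).
Proof.
move=> x; apply/differentiable_continuous/derivable1_diffP.
exact: schwartz_smooth.
Qed.

Lemma schwartz_decay f m : exists2 C, 0 <= C &
  forall x, `|f^`(m) x| <= C * (oneDsqr x)^-1.
Proof.
have /schwartz_predP[_ bf] := schwartz_funP f.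
have [A hA] := bf 0%N m; have [B hB] := bf 2%N m.
have h x : `|f^`(m) x| <= (A + B) * (oneDsqr x)^-1.
  have d0 : 0 < oneDsqr x by rewrite (lt_le_trans ltr01)// oneDsqr_ge1.
  rewrite ler_pdivlMr// mulrDr mulr1 lerD//.
    by have := hA x; rewrite expr0 mul1r.
  have := hB x; rewrite normrM ger0_norm ?sqr_ge0//.
  by rewrite mulrC.
exists (A + B) => //.
have := h 0; rewrite /oneDsqr expr0n addr0 invr1 mulr1; exact: le_trans.
Qed.

Lemma integrable_oneDsqrV :
  mu.-integrable [set: R] (fun x => ((oneDsqr x)^-1)%:E).
Proof.
have ge0 x : 0 <= (oneDsqr x)^-1 :> R.
  by rewrite invr_ge0 (le_trans ler01)// oneDsqr_ge1.
have mf : measurable_fun setT (fun x : R => (oneDsqr x)^-1).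
  exact: continuous_measurable_fun continuous_oneDsqrV.
apply/integrableP; split; first exact/measurable_EFinP.
under eq_integral do rewrite gee0_abs ?lee_fin//.
rewrite (@ge0_symfun_integralT _ (fun x : R => (oneDsqr x)^-1))//.
- rewrite -set_itvcy integral0y_oneDsqr.
  by rewrite -EFinM ltry.
- exact: continuous_oneDsqrV.
- by move=> x /=; rewrite /oneDsqr sqrrN.
Qed.

Lemma schwartz_integrableM f g m n :
  mu.-integrable [set: R] (fun x => (f^`(m) x * g^`(n) x)%:E).
Proof.
have [A A0 hA] := schwartz_decay f m; have [B B0 hB] := schwartz_decay g n.
have mfg : measurable_fun setT (fun x => f^`(m) x * g^`(n) x).
  by apply: measurable_funM; apply: continuous_measurable_fun;
    exact: schwartz_continuous.
apply: (@le_integrable _ _ _ mu setT measurableT _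
  (fun x => (A * B)%:E * ((oneDsqr x)^-1)%:E)%E).
- exact/measurable_EFinP.
- move=> x _ /=; rewrite lee_fin.
  have d1 := oneDsqrV_le1 x.
  have d0 : 0 <= (oneDsqr x)^-1 by rewrite invr_ge0 (le_trans ler01)// oneDsqr_ge1.
  rewrite normrM [leRHS]ger0_norm ?mulr_ge0// -mulrA.
  rewrite (le_trans (ler_pM _ _ (hA x) (hB x)))//.
  rewrite -mulrA ler_wpM2l// mulrCA ler_wpM2l// ler_piMl//.
- exact/integrableZl/integrable_oneDsqrV.
Qed.

End SchwartzIntegral.

Section SobolevNorm.
Context {R : realType}.
Implicit Types (f g phi : schwartz R) (c x : R).
Local Notation mu := (@lebesgue_measure R).

Definition schwartz_shift c f : schwartz R :=
  Schwartz (schwartz_shift_subproof c (schwartz_funP f)).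

Definition H1norm phi : R :=
  Num.sqrt (\int[mu]_x (phi x ^+ 2 + phi^`() x ^+ 2)).

Lemma schwartz_integrableX f m :
  mu.-integrable [set: R] (fun x => (f^`(m) x ^+ 2)%:E).
Proof. exact: (schwartz_integrableM f f m m). Qed.

Lemma H1norm_integrable phi :
  mu.-integrable [set: R] (fun x => (phi x ^+ 2 + phi^`() x ^+ 2)%:E).
Proof.
exact: (integrableD measurableT (schwartz_integrableX phi 0)
  (schwartz_integrableX phi 1)).
Qed.

Lemma H1norm_sqr phi :
  H1norm phi ^+ 2 = \int[mu]_x (phi x ^+ 2 + phi^`() x ^+ 2).
Proof.
by rewrite sqr_sqrtr// Rintegral_ge0// => x _; rewrite addr_ge0// sqr_ge0.
Qed.

Lemma H1norm_ge0 phi : 0 <= H1norm phi.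
Proof. exact: sqrtr_ge0. Qed.

Lemma H1normZ c phi : H1norm (c *: phi) = `|c| * H1norm phi.
Proof.
rewrite -sqrtr_sqr -sqrtrM ?sqr_ge0//; congr Num.sqrt.
rewrite -RintegralZl//; last exact: H1norm_integrable.
apply: eq_Rintegral => x _.
have dphi : derivable (phi : R -> R) x 1 := @schwartz_smooth R phi 0 x.
have -> : (c *: phi)^`() x = c * phi^`() x.
  rewrite derive1E (_ : (c *: phi : schwartz R) = c *: (phi : R -> R) :> (R -> R))//.
  by rewrite (deriveZ c dphi) derive1E.
have -> : (c *: phi) x = c * phi x by [].
by ring.
Qed.

Lemma H1norm_shift c phi : H1norm (schwartz_shift c phi) = H1norm phi.
Proof.
have dS : (shift c : R -> R)^`() = cst 1.
  by apply/funext => x; rewrite derive1E; exact: (congr1 (@^~ x) (derive_shift 1 c)).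
have cphi2 m : continuous (fun x => phi^`(m) x ^+ 2).
  by move=> x; apply: cvgM; exact: schwartz_continuous.
suff E : (\int[mu]_x (phi x ^+ 2 + phi^`() x ^+ 2)%:E =
    \int[mu]_x (schwartz_shift c phi x ^+ 2 +
                (schwartz_shift c phi)^`() x ^+ 2)%:E)%E.
  by rewrite /H1norm /Rintegral E.
rewrite (@increasing_ge0_integration_by_substitutionT _ (shift c)
  (fun x => phi x ^+ 2 + phi^`() x ^+ 2)).
- apply: eq_integral => x _; rewrite dS.
  have -> : (schwartz_shift c phi)^`() x = phi^`() (x + c).
    exact: (congr1 (@^~ x) (derive1n_shift c phi 1)).
  by rewrite !fctE /= mulr1.
- by move=> x y xy; rewrite /= ltrD2r.
- by rewrite dS => x; exact: cvg_cst.
- by rewrite dS; exact: is_cvg_cst.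
- by rewrite dS; exact: is_cvg_cst.
- by move=> x; have := is_derive_shift x 1 c => h; exact: (@ex_derive _ _ _ _ _ _ _ h).
- exact: cvg_addrr_Ny.
- exact: cvg_addrr.
- by move=> x; apply: cvgD; [exact: (cphi2 0)|exact: (cphi2 1)].
- by move=> x; rewrite addr_ge0// sqr_ge0.
Qed.

Lemma schwartz_pairing_le f phi :
  `|\int[mu]_x (f x * phi x)| <= H1norm f * H1norm phi.
Proof.
set P := \int[mu]_x _; set A := H1norm f; set N := H1norm phi.
have A0 : 0 <= A by exact: H1norm_ge0.
have N0 : 0 <= N by exact: H1norm_ge0.
have key t : 2 * t * P <= A ^+ 2 + t ^+ 2 * N ^+ 2.
  have fphi := schwartz_integrableM f phi 0 0.
  have If := H1norm_integrable f; have Iphi := H1norm_integrable phi.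
  have -> : 2 * t * P = \int[mu]_x (2 * t * (f x * phi x)).
    by rewrite (RintegralZl _ measurableT fphi).
  have -> : A ^+ 2 + t ^+ 2 * N ^+ 2 =
      \int[mu]_x (f x ^+ 2 + f^`() x ^+ 2 +
                  t ^+ 2 * (phi x ^+ 2 + phi^`() x ^+ 2)).
    rewrite (RintegralD measurableT If (integrableZl measurableT (t ^+ 2) Iphi)).
    by rewrite (RintegralZl _ measurableT Iphi) -!H1norm_sqr.
  apply: le_Rintegral => //.
  - exact: (integrableZl measurableT (2 * t) fphi).
  - exact: (integrableD measurableT If (integrableZl measurableT (t ^+ 2) Iphi)).
  move=> x _; set a := f x; set b := phi x; set a' := f^`() x; set b' := phi^`() x.
  have := sqr_ge0 (a - t * b); have := sqr_ge0 a'; have := sqr_ge0 (t * b').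
  by lra.
clearbody P A N.
have PAN : P ^+ 2 <= (A * N) ^+ 2.
  have [N00|N00] := eqVneq N 0.
    suff -> : P = 0 by rewrite expr0n sqr_ge0.
    apply/eqP/negP => /negP P0.
    have := key ((A ^+ 2 + 1) / 2 / P).
    rewrite N00 expr0n mulr0 addr0.
    by rewrite (_ : _ * P = A ^+ 2 + 1) ?gerDl ?ler10//; field.
  have E1 : 2 * (P / N ^+ 2) * P = 2 * (P ^+ 2 / N ^+ 2) by field.
  have E2 : (P / N ^+ 2) ^+ 2 * N ^+ 2 = P ^+ 2 / N ^+ 2 by field.
  have := key (P / N ^+ 2); rewrite E1 E2 => h.
  rewrite exprMn -ler_pdivrMr ?exprn_gt0 ?lt_def ?N00//.
  by lra.
have AN0 : 0 <= A * N by exact: mulr_ge0.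
have P2 : `|P| ^+ 2 <= (A * N) ^+ 2 by rewrite real_normK ?num_real.
by move: P2; rewrite ler_sqr ?nnegrE ?normr_ge0.
Qed.

(* H^{-1}(R) is the dual of the real space H^1(R).  Schwartz functions are dense
   in H^1(R), so its elements are the tempered distributions that are bounded
   for the H^1 norm; they are encoded by their values on Schwartz functions. *)
Definition Hm1_pred : {pred schwartz R -> R^o} := fun u =>
  `[< linear u /\ exists C, forall phi, `|u phi| <= C * H1norm phi >].

Lemma Hm1_predP (u : schwartz R -> R^o) :
  reflect (linear u /\ exists C, forall phi, `|u phi| <= C * H1norm phi)
    (u \in Hm1_pred).
Proof. exact: asboolP. Qed.

Lemma Hm1_submod_closed : submod_closed Hm1_pred.
Proof.
split.
  have z h : (0 : schwartz R -> R^o) h = 0 by [].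
  apply/Hm1_predP; split=> [a f g|]; first by rewrite !z scaler0 addr0.
  by exists 0 => phi; rewrite mul0r normr0.
move=> c u v /Hm1_predP[lu [Cu bu]] /Hm1_predP[lv [Cv bv]].
apply/Hm1_predP; split=> [a f g|].
  have E h : (c *: u + v) h = c * u h + v h by [].
  rewrite !E lu lv.
  by rewrite /GRing.scale /=; ring.
exists (`|c| * Cu + Cv) => phi.
rewrite -[(c *: u + v) phi]/(c * u phi + v phi).
by rewrite (le_trans (ler_normD _ _))// normrM mulrDl lerD// -mulrA ler_wpM2l.
Qed.

HB.instance Definition _ :=
  GRing.isSubmodClosed.Build R (schwartz R -> R^o) Hm1_pred Hm1_submod_closed.

End SobolevNorm.

Record Hm1 (R : realType) := MkHm1 {
  Hm1_fun :> schwartz R -> R^o ;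
  Hm1_funP : Hm1_fun \in Hm1_pred }.

HB.instance Definition _ (R : realType) := [isSub for @Hm1_fun R].
HB.instance Definition _ (R : realType) := [Choice of Hm1 R by <:].
HB.instance Definition _ (R : realType) :=
  [SubChoice_isSubLmodule of Hm1 R by <:].

Section Hm1Norm.
Context {R : realType}.
Implicit Types (f phi : schwartz R) (u v : Hm1 R) (c : R).
Local Notation mu := (@lebesgue_measure R).

Lemma Hm1_linear u : linear (u : schwartz R -> R^o).
Proof. by have /Hm1_predP[] := Hm1_funP u. Qed.

Lemma Hm1Z u c phi : u (c *: phi) = c * u phi.
Proof.
have u0 : u 0 = 0.
  have := Hm1_linear u (-1) 0 0.
  by rewrite scaler0 addr0 scaleN1r addNr.
by have := Hm1_linear u c phi 0; rewrite !addr0 u0 addr0.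
Qed.

Definition Hm1norm u : R :=
  sup [set `|u phi| | phi in [set phi | H1norm phi <= 1]].

Lemma Hm1norm_has_sup u :
  has_sup [set `|u phi| | phi in [set phi | H1norm phi <= 1]].
Proof.
have /Hm1_predP[_ [C bu]] := Hm1_funP u; split.
  exists `|u (0 *: 0)|; exists (0 *: 0) => //=.
  by rewrite H1normZ normr0 mul0r.
exists `|C| => _ [phi /= phi1 <-]; rewrite (le_trans (bu phi))//.
apply: (@le_trans _ _ (`|C| * H1norm phi)).
  by rewrite ler_wpM2r ?H1norm_ge0 ?ler_norm.
by rewrite ler_piMr.
Qed.

Lemma Hm1norm_ub u phi : H1norm phi <= 1 -> `|u phi| <= Hm1norm u.
Proof.
by move=> phi1; apply: (ub_le_sup (Hm1norm_has_sup u).2); exists phi.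
Qed.

Lemma Hm1norm_le u M :
  (forall phi, H1norm phi <= 1 -> `|u phi| <= M) -> Hm1norm u <= M.
Proof.
move=> h; apply: (sup_le_ub (Hm1norm_has_sup u).1) => _ [phi ? <-]; exact: h.
Qed.

Lemma Hm1normP u phi : `|u phi| <= Hm1norm u * H1norm phi.
Proof.
have [phi0|phi0] := eqVneq (H1norm phi) 0.
  have /Hm1_predP[_ [C bu]] := Hm1_funP u.
  by rewrite (le_trans (bu phi))// phi0 !mulr0.
have p0 : 0 < H1norm phi by rewrite lt_def phi0 H1norm_ge0.
have nV : `|(H1norm phi)^-1| = (H1norm phi)^-1.
  by rewrite ger0_norm// invr_ge0 ltW.
have phi1 : H1norm ((H1norm phi)^-1 *: phi) <= 1.
  by rewrite H1normZ nV mulVf ?lexx.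
have := Hm1norm_ub u phi1; rewrite Hm1Z normrM nV.
by rewrite mulrC ler_pdivrMr.
Qed.

Lemma Hm1normD u v : Hm1norm (u + v) <= Hm1norm u + Hm1norm v.
Proof.
apply: Hm1norm_le => phi phi1.
by rewrite (le_trans (ler_normD _ _))// lerD// Hm1norm_ub.
Qed.

Lemma Hm1norm_scale_le c u : Hm1norm (c *: u) <= `|c| * Hm1norm u.
Proof.
apply: Hm1norm_le => phi phi1.
rewrite -[(c *: u) phi]/(c * u phi) normrM.
by rewrite ler_wpM2l// Hm1norm_ub.
Qed.

Lemma Hm1norm_scale c u : Hm1norm (c *: u) = `|c| * Hm1norm u.
Proof.
apply/eqP; rewrite eq_le Hm1norm_scale_le/=.
have [->|c0] := eqVneq c 0.
  rewrite normr0 mul0r (le_trans (normr_ge0 ((0 *: u : Hm1 R) (0 *: 0))))//.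
  by apply: Hm1norm_ub; rewrite H1normZ normr0 mul0r.
rewrite -ler_pdivlMl ?normr_gt0// -normfV.
by rewrite (le_trans _ (Hm1norm_scale_le _ _))// scalerA mulVf// scale1r.
Qed.

Lemma Hm1norm_eq0 u : Hm1norm u = 0 -> u = 0.
Proof.
move=> u0; apply/val_inj/funext => phi; apply/eqP.
by rewrite -normr_le0 (le_trans (Hm1normP u phi))// u0 mul0r.
Qed.

HB.instance Definition _ :=
  Lmodule_isNormed.Build R (Hm1 R) Hm1normD Hm1norm_scale Hm1norm_eq0.

Lemma schwartz_pairing_subproof f :
  (fun phi => \int[mu]_x (f x * phi x) : R^o) \in Hm1_pred.
Proof.
apply/Hm1_predP; split=> [c phi psi|]; last first.
  by exists (H1norm f) => phi; exact: schwartz_pairing_le.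
have Iphi := schwartz_integrableM f phi 0 0.
have Ipsi := schwartz_integrableM f psi 0 0.
rewrite -[RHS]/(c * \int[mu]_x (f x * phi x) + \int[mu]_x (f x * psi x)).
rewrite -(RintegralZl c measurableT Iphi).
rewrite -(RintegralD measurableT (integrableZl measurableT c Iphi) Ipsi).
apply: eq_Rintegral => x _.
by rewrite -[(_ + _ : schwartz R) x]/(c * phi x + psi x) mulrDr mulrCA.
Qed.

(* A Schwartz function f is the distribution phi |-> \int f phi. *)
Definition Hm1_of_schwartz f : Hm1 R := MkHm1 (schwartz_pairing_subproof f).

Lemma translate_subproof c u :
  (fun phi => u (schwartz_shift (- c) phi)) \in Hm1_pred.
Proof.
apply/Hm1_predP; split=> [a phi psi|].
  by rewrite -Hm1_linear; congr (u _); exact: val_inj.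
exists (Hm1norm u) => phi; rewrite -(H1norm_shift (- c) phi).
exact: (Hm1normP u (schwartz_shift (- c) phi)).
Qed.

(* The distribution q(. + c): since \int q(x + c) phi(x) dx equals
   \int q(y) phi(y - c) dy, the test function is shifted by - c. *)
Definition translate c u : Hm1 R := MkHm1 (translate_subproof c u).

Definition translation_equicontinuous (Q : set (Hm1 R)) :=
  forall e : R, 0 < e ->
    \forall h \near (0 : R), forall q, Q q -> `|translate h q - q| < e.

Definition weak_cvg (u : nat -> Hm1 R) (l : Hm1 R) :=
  forall L : {linear Hm1 R -> R^o}, continuous L -> L (u n) @[n --> \oo] --> L l.

Definition kdv_rhs (f : R -> R) : R -> R :=
  fun x => - f^`(3) x + 6 * f x * f^`() x.

(* q is differentiable in time for the topology of the Schwartz space, with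
   derivative - q''' + 6 q q'.  Requiring the time derivative only pointwise in
   x would be too weak a notion for uniqueness. *)
Definition kdv_schwartz_solution (q : R -> schwartz R) :=
  forall t k m,
    schwartz_seminorm k m
      (fun x => h^-1 * (q (t + h) x - q t x) - kdv_rhs (q t) x)
    @[h --> 0^'] --> 0%E.

(* Phi is the jointly continuous extension to H^{-1}(R) of the solution map
   on Schwartz data; as Schwartz functions are dense in H^{-1}(R), these
   properties determine Phi. *)
Definition kdv_flow (Phi : R -> Hm1 R -> Hm1 R) :=
  continuous (fun z : R * Hm1 R => Phi z.1 z.2) /\
  forall f : schwartz R, exists q : R -> schwartz R,
    [/\ kdv_schwartz_solution q, q 0 = f &
        forall t, Phi t (Hm1_of_schwartz f) = Hm1_of_schwartz (q t)].

End Hm1Norm.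

(* Main.v *)
(* Killip and Visan's method of commuting flows, with the commuting flows
   replaced by iterated Backlund transformations.

   Let u_k be the decaying solution of u' + 2 k u + u^2 = q, which exists for k
   large, uniformly on bounded equicontinuous sets of q.  Then
   B_K q := q - 2 u_K' is a Backlund transformation: it maps solutions of KdV to
   solutions, and it preserves the integral of u_k^2 for every k < K, which is
   comparable to the square of an H^{-1} norm of q and is also conserved by KdV.
   The diagonal Green function g_k of -d^2 + q + k^2 determines q weakly, up to
   an error controlled by the integral of u_k^2.  On g_k the map B_K acts, up to
   o(K^{-3}) when tested against Schwartz functions, as the translation by 1/K
   followed by the KdV flow for the time 1/(12 K^3).  All these estimates are
   uniform on bounded equicontinuous sets.  So 12 K^3 T steps of B_K,
   translated back, approximate the KdV flow at time T uniformly.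

   Unlike the KdV flow, a fixed number of Backlund transformations is weakly
   continuous by elementary means, because u_k depends on q through a first
   order equation with exponentially localised solutions.  Applied to the given
   data and to Schwartz functions converging strongly to q(0), this shows that
   the two sequences of solutions at time T have the same weak limit; the
   second one converges to q(T) by continuity of the flow. *)

Require Import Defs.
From HB Require Import structures.
From mathcomp Require Import all_boot all_order all_algebra.
From mathcomp Require Import all_classical all_reals all_analysis.
From mathcomp Require Import measurable_realfun.
From mathcomp Require Import ring lra.

Set Implicit Arguments.
Unset Strict Implicit.
Unset Printing Implicit Defensive.

Import Order.TTheory GRing.Theory Num.Theory.
Import numFieldNormedType.Exports.

Local Open Scope classical_set_scope.
Local Open Scope ring_scope.

Local Notation "f ^` ()" := (derive1 f) : ring_scope.
Local Notation "f ^` ( n )" := (derive1n n f) : ring_scope.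

(** * Derivatives *)

(** To first order in $q$, $u_K = (\partial + 2K)^{-1} q$ and $B_K$ is the Fourier multiplier $(2K -
    i\xi)/(2K + i\xi)$, of phase $-2\arctan(\xi/2K) = -\xi/K + \xi^3/(12K^3) + O(K^{-5})$: hence the
    translation by $1/K$ and the time step $1/(12K^3)$. The comparison cannot be made on $q$ itself,
    because KdV contains $q^2$, which is not controlled in $H^{-1}$. Tested against a Schwartz
    function, the evolution of $g_k$ contains only the product $q g_k$. Inserting $q = U' + 2KU +
    U^2$ with $U = u_K$, the one large term $2K U g_k$ cancels between the flow and the Backlund
    step up to a small remainder, and the other terms carry the small $L^2$ norm of $U$. The order
    of limits matters: $k$ is fixed by the accuracy with which $g_k$ sees $q$, then $K$ and the
    number of steps are fixed, and only then $n\to\infty$. The constants of weak stability may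
    therefore depend on $K$ in any way. All the objects solve first order equations with damping
    $2k$ and coefficients bounded in $L^2$, so that energy estimates with exponential integrating
    factors take the place of spectral theory. *)

Definition dv {R : realType} (f f' : R -> R) :=
  forall x : R, is_derive x (1 : R) f (f' x).

Section Derivatives.
Context {R : realType}.
Implicit Types (f g F : R -> R) (a b c x y : R).

Lemma dv_eq f f1 f2 : dv f f1 -> f1 =1 f2 -> dv f f2.
Proof. by move=> d e x; rewrite -e; exact: d. Qed.

Lemma dv_fun_eq f g f' : dv f f' -> f =1 g -> dv g f'.
Proof. by move=> d /funext <-. Qed.

Lemma dv_derive1 f f' x : dv f f' -> f^`()%classic x = f' x.
Proof. by move=> d; rewrite derive1E; have := d x => d'; rewrite derive_val. Qed.

Lemma dv_derivable f f' x : dv f f' -> derivable f x 1.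
Proof. by move=> d; have := d x => d'; exact: (@ex_derive _ _ _ _ _ _ _ d'). Qed.

Lemma derivable_dv f : (forall x, derivable f x 1) -> dv f f^`()%classic.
Proof. by move=> d x; rewrite derive1E; exact/derivableP. Qed.

Lemma dv_continuous f f' : dv f f' -> continuous f.
Proof.
move=> d x; apply/differentiable_continuous/derivable1_diffP.
exact: dv_derivable d.
Qed.

Lemma dv_cst c : dv (fun=> c) (fun=> 0).
Proof. by move=> x; exact: is_derive_cst. Qed.

Lemma dv_id : dv (fun x => x) (fun=> 1).
Proof. by move=> x; exact: is_derive_id. Qed.

Lemma dvD f g f' g' : dv f f' -> dv g g' ->
  dv (fun x => f x + g x) (fun x => f' x + g' x).
Proof. by move=> df dg x; exact: (@is_deriveD _ _ _ f g x 1 _ _ (df x) (dg x)). Qed.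

Lemma dvN f f' : dv f f' -> dv (fun x => - f x) (fun x => - f' x).
Proof. by move=> df x; exact: (@is_deriveN _ _ _ f x 1 _ (df x)). Qed.

Lemma dvM f g f' g' : dv f f' -> dv g g' ->
  dv (fun x => f x * g x) (fun x => f' x * g x + f x * g' x).
Proof.
move=> df dg x.
apply: (is_derive_eq (@is_deriveM _ _ f g x 1 _ _ (df x) (dg x))).
by rewrite /GRing.scale /=; ring.
Qed.

Lemma dvX f f' n : dv f f' ->
  dv (fun x => f x ^+ n) (fun x => n%:R * f x ^+ n.-1 * f' x).
Proof.
move=> df x; have := @is_deriveX _ _ f n x 1 _ (df x).
by rewrite exprfctE.
Qed.

Lemma dv_comp f g f' g' : dv f f' -> dv g g' ->
  dv (fun x => f (g x)) (fun x => f' (g x) * g' x).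
Proof. by move=> df dg x; exact: (is_derive1_comp (df (g x)) (dg x)). Qed.

Lemma dv_expR f f' : dv f f' ->
  dv (fun x => expR (f x)) (fun x => expR (f x) * f' x).
Proof. by apply: dv_comp => x; exact: is_derive_expR. Qed.

Lemma dvV f f' : dv f f' -> (forall x, f x != 0) ->
  dv (fun x => (f x)^-1) (fun x => - f' x / f x ^+ 2).
Proof.
move=> df f0 x.
have d1 : derivable (fun x => (f x)^-1) x 1.
  by apply: derivableV => //; exact: dv_derivable df.
apply: (DeriveDef d1); rewrite (deriveV (f0 x) (dv_derivable df)).
have := df x => dfx; rewrite derive_val /GRing.scale /= -exprVn.
by rewrite !mulNr mulrC.
Qed.

Lemma dv_ln f f' : dv f f' -> (forall x, 0 < f x) ->
  dv (fun x => ln (f x)) (fun x => f' x / f x).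
Proof.
move=> df f0 x.
have h := is_derive1_ln (f0 x).
apply: (is_derive_eq (is_derive1_comp h (df x))).
by rewrite mulrC.
Qed.

Lemma dv_shift f f' c : dv f f' -> dv (fun x => f (x + c)) (fun x => f' (x + c)).
Proof.
move=> df; apply: dv_eq.
  apply: (dv_comp df (g := fun x => x + c)).
  by apply: dvD; [exact: dv_id|exact: dv_cst].
by move=> x /=; rewrite addr0 mulr1.
Qed.

Lemma dv_opp f f' : dv f f' -> dv (fun x => f (- x)) (fun x => - f' (- x)).
Proof.
move=> df; apply: dv_eq.
  apply: (dv_comp df (g := fun x => - x)).
  by apply: dvN; exact: dv_id.
by move=> x /=; rewrite mulrN1.
Qed.

Lemma dv_MVT f f' a b : dv f f' -> a < b ->
  exists2 c, a < c < b & f b - f a = f' c * (b - a).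
Proof.
move=> df ab; have [|c] := MVT ab (fun x _ => df x).
  by apply: continuous_subspaceT; exact: dv_continuous df.
by rewrite in_itv /= => cab e; exists c.
Qed.

Lemma dv_le f f' a b : dv f f' -> (forall x, a < x < b -> 0 <= f' x) -> a <= b ->
  f a <= f b.
Proof.
move=> df f0; rewrite le_eqVlt => /predU1P[->//|ab].
have [c cab e] := dv_MVT df ab.
by rewrite -subr_ge0 e mulr_ge0 ?f0// subr_ge0 ltW.
Qed.

Lemma dv_lip f f' a b M : dv f f' -> (forall x, `|f' x| <= M) ->
  `|f b - f a| <= M * `|b - a|.
Proof.
move=> df fM; have [ab|ba|->] := ltgtP a b.
- have [c _ ->] := dv_MVT df ab.
  by rewrite normrM ler_wpM2r.
- have [c _ e] := dv_MVT df ba.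
  by rewrite distrC e distrC normrM ler_wpM2r.
- by rewrite !subrr normr0 mulr0.
Qed.

Lemma dv_zero_cst f a b : dv f (fun=> 0) -> f a = f b.
Proof.
move=> df; have := @dv_lip f _ a b 0 df.
by rewrite normr0 mul0r normr_le0 subr_eq0 => /(_ (fun=> lexx _))/eqP ->.
Qed.

Lemma antiderivative f : continuous f -> exists F, dv F f.
Proof.
move=> cf.
have dint (g : R -> R) x : continuous g -> 0 < x ->
   is_derive x (1 : R) (fun z => \int[@lebesgue_measure R]_(t in `[0, z]) g t) (g x).
  move=> cg x0; have xu : x < x + 1 by lra.
  have gi : (@lebesgue_measure R).-integrable `[0, x + 1] (EFin \o g).
    apply: continuous_compact_integrable; first exact: segment_compact.
    exact: continuous_subspaceT.
  have [d] := @continuous_FTC1_closed R g 0 x (x + 1) xu gi x0 (cg x).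
  by rewrite derive1E => e; exact: DeriveDef d e.
(* On a half-line starting at -n-1 the integral from -n-1 is an antiderivative;
   glueing is done by normalising at 0. *)
have dn (n : nat) x : - n.+1%:R < x ->
   is_derive x (1 : R) (fun z => \int[@lebesgue_measure R]_(t in `[0, z + n.+1%:R])
       f (t - n.+1%:R) - \int[@lebesgue_measure R]_(t in `[0, n.+1%:R]) f (t - n.+1%:R)) (f x).
  move=> nx.
  have c2 : continuous (fun t : R => f (t - n.+1%:R)).
    move=> t; apply: (@continuous_comp _ _ _ (fun t : R => t - n.+1%:R) f t).
      exact: (dv_continuous (dvD dv_id (dv_cst _))).
    exact: cf.
  have h := @dint _ (x + n.+1%:R) c2.
  have {}h : is_derive (x + n.+1%:R) (1 : R)
    (fun z => \int[@lebesgue_measure R]_(t in `[0, z]) f (t - n.+1%:R)) (f x).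
    by have := h; rewrite addrK; apply; lra.
  have ds : is_derive x (1 : R) (fun z : R => z + n.+1%:R) 1.
    have := @dvD id (fun=> n.+1%:R) _ _ dv_id (dv_cst _) x.
    by rewrite addr0.
  have hc := @is_derive1_comp _ _ (fun z : R => z + n.+1%:R) x _ _ h ds.
  apply: (is_derive_eq (is_deriveB hc (is_derive_cst _ x (1:R)))).
  by rewrite mulr1 subr0.
pose G n z := \int[@lebesgue_measure R]_(t in `[0, z + n.+1%:R])
       f (t - n.+1%:R) - \int[@lebesgue_measure R]_(t in `[0, n.+1%:R]) f (t - n.+1%:R).
have G0 n : G n 0 = 0 by rewrite /G add0r subrr.
have GG n m z : (n <= m)%N -> - n.+1%:R < z -> G n z = G m z.
  move=> nm nz.
  have nm' : - m.+1%:R <= - n.+1%:R :> R by rewrite lerN2 ler_nat.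
  have d0 x : - n.+1%:R < x -> is_derive x (1 : R) (G n \- G m) 0.
    move=> nx; apply: (is_derive_eq (is_deriveB (dn n x nx) (dn m x _))).
      by rewrite (le_lt_trans nm').
    by rewrite subrr.
  have cw a b : - n.+1%:R < a -> {within `[a, b], continuous (G n \- G m)}.
    move=> na; apply: derivable_within_continuous => x; rewrite in_itv /= => /andP[ax _].
    have h := d0 x (lt_le_trans na ax).
    exact: (@ex_derive _ _ _ _ _ _ _ h).
  have [z0|z0|->] := ltgtP z 0; last by rewrite !G0.
  - have dz x : x \in `]z, 0[%R -> is_derive x (1 : R) (G n \- G m) 0.
      by rewrite in_itv /= => /andP[zx _]; exact: (d0 x (lt_trans nz zx)).
    have [c _] := @MVT R _ (fun=> 0) z 0 z0 dz (cw z 0 nz).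
    rewrite mul0r /= !G0 subrr sub0r => /eqP; rewrite oppr_eq0 subr_eq0.
    by move/eqP.
  - have n0 : - n.+1%:R < 0 :> R by rewrite oppr_lt0.
    have dz x : x \in `]0, z[%R -> is_derive x (1 : R) (G n \- G m) 0.
      by rewrite in_itv /= => /andP[zx _]; exact: (d0 x (lt_trans n0 zx)).
    have [c _] := @MVT R _ (fun=> 0) 0 z z0 dz (cw 0 z n0).
    rewrite mul0r /= !G0 subrr subr0 => /eqP; rewrite subr_eq0.
    by move/eqP.
pose N (z : R) : nat := Num.truncn `|z|.
have NP (z : R) : - (N z).+1%:R < z.
  have := truncnS_gt `|z|; rewrite -/(N z) => h.
  by rewrite ltrNl (le_lt_trans _ h)// -normrN ler_norm.
exists (fun z => G (N z) z) => x.
have h := dn (N x) x (NP x).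
apply: near_eq_is_derive h.
near=> z.
have nz : - (N x).+1%:R < z.
  by near: z; exact: (lt_nbhsr (NP x)).
have [nm|mn] := leqP (N x) (N z).
- exact: GG.
- by apply/esym/GG; [exact: ltnW|exact: NP].
Unshelve. all: by end_near. Qed.

End Derivatives.

(** * Integrals of functions of quadratic decay *)

Section Integral.
Context {R : realType}.
Implicit Types (f g F : R -> R) (a b c x y : R).
Local Notation mu := (@lebesgue_measure R).

Definition wt x : R := (1 + x ^+ 2)^-1.
Definition bddc f := continuous f /\ exists C : R, forall x, `|f x| <= C.
(** The integrability condition used throughout. It is stable under sums and under products with
    bounded continuous functions, makes integrals finite, and makes boundary terms vanish at
    infinity, so that integrations by parts need no other side condition. *)
Definition nice f := continuous f /\ exists C : R, forall x, `|f x| <= C * wt x.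
Definition I f : R := \int[mu]_x f x.

Lemma oneDsq_gt0 x : 0 < 1 + x ^+ 2 :> R.
Proof. by rewrite ltr_wpDr ?sqr_ge0. Qed.

Lemma wt_gt0 x : 0 < wt x.
Proof. by rewrite invr_gt0 oneDsq_gt0. Qed.

Lemma wt_ge0 x : 0 <= wt x.
Proof. exact/ltW/wt_gt0. Qed.

Lemma wt_le1 x : wt x <= 1.
Proof. by rewrite invf_le1 ?oneDsq_gt0// lerDl sqr_ge0. Qed.

Lemma dv_wt : dv wt (fun x => - (2 * x) * wt x ^+ 2).
Proof.
have d : dv (fun x : R => 1 + x ^+ 2) (fun x => 2 * x).
  apply: dv_eq; first exact: (dvD (dv_cst 1) (dvX 2 dv_id)).
  by move=> x /=; rewrite add0r mulr1.
apply: dv_eq; first by apply: (dvV d) => x; rewrite gt_eqF// oneDsq_gt0.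
by move=> x; rewrite /wt exprVn.
Qed.

Lemma wt_continuous : continuous wt.
Proof. exact: dv_continuous dv_wt. Qed.

Lemma dv_atan : dv atan wt.
Proof. by move=> x; exact: is_derive1_atan. Qed.

(** The logarithmic derivative of [wt] is [- (2 * x * wt x)], so the weight varies slowly and a
    damping rate of order one absorbs its derivative in weighted estimates. *)
Lemma wt_slow x : `|2 * x * wt x| <= 1.
Proof.
rewrite normrM [`|wt x|]ger0_norm ?wt_ge0// /wt ler_pdivrMr ?oneDsq_gt0// mul1r.
rewrite ler_norml; have := sqr_ge0 (x - 1); have := sqr_ge0 (x + 1).
by move=> h1 h2; apply/andP; split; nra.
Qed.

Lemma cont_cst c : continuous (fun _ : R => c).
Proof. by move=> x; exact: cvg_cst. Qed.

Lemma contD f g : continuous f -> continuous g -> continuous (fun x => f x + g x).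
Proof. by move=> cf cg x; apply: cvgD; [exact: cf|exact: cg]. Qed.

Lemma contN f : continuous f -> continuous (fun x => - f x).
Proof. by move=> cf x; apply: cvgN; exact: cf. Qed.

Lemma contM f g : continuous f -> continuous g -> continuous (fun x => f x * g x).
Proof. by move=> cf cg x; apply: cvgM; [exact: cf|exact: cg]. Qed.

Lemma contX f n : continuous f -> continuous (fun x => f x ^+ n).
Proof.
move=> cf; elim: n => [|n IH].
  by rewrite (_ : (fun x => _) = fun=> 1)//; exact: cont_cst.
rewrite (_ : (fun x => _) = fun x => f x * f x ^+ n); first exact: contM.
by apply/funext => x; rewrite exprS.
Qed.

Lemma cont_norm f : continuous f -> continuous (fun x => `|f x|).
Proof. by move=> cf x; apply: cvg_norm; exact: cf. Qed.

Lemma bddc_cst c : bddc (fun=> c).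
Proof. by split; [exact: cont_cst|exists `|c|]. Qed.

Lemma bddcD f g : bddc f -> bddc g -> bddc (fun x => f x + g x).
Proof.
move=> [cf [C hC]] [cg [D hD]]; split; first exact: contD.
by exists (C + D) => x; rewrite (le_trans (ler_normD _ _))// lerD.
Qed.

Lemma bddcN f : bddc f -> bddc (fun x => - f x).
Proof.
move=> [cf [C hC]]; split; first exact: contN.
by exists C => x; rewrite normrN.
Qed.

Lemma bddcM f g : bddc f -> bddc g -> bddc (fun x => f x * g x).
Proof.
move=> [cf [C hC]] [cg [D hD]]; split; first exact: contM.
by exists (C * D) => x; rewrite normrM ler_pM.
Qed.

Lemma bddcX f n : bddc f -> bddc (fun x => f x ^+ n).
Proof.
move=> [cf [C hC]]; split; first exact: contX.
by exists (C ^+ n) => x; rewrite normrX lerXn2r// nnegrE (le_trans _ (hC 0)).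
Qed.

Lemma bddc_norm f : bddc f -> bddc (fun x => `|f x|).
Proof.
move=> [cf [C hC]]; split; first exact: cont_norm.
by exists C => x; rewrite normr_id.
Qed.

Lemma nice_bddc f : nice f -> bddc f.
Proof.
move=> [cf [C hC]]; split => //; exists C => x; rewrite (le_trans (hC x))//.
rewrite ler_piMr ?wt_le1//.
by have := le_trans (normr_ge0 _) (hC x); rewrite pmulr_lge0 ?wt_gt0.
Qed.

Lemma nice_cont f : nice f -> continuous f. Proof. by case. Qed.
Lemma nice0 : nice (fun=> 0).
Proof. by split; [exact: cont_cst|exists 0 => x; rewrite normr0 mul0r]. Qed.

Lemma nice_wt : nice wt.
Proof.
split; first exact: wt_continuous.
by exists 1 => x; rewrite mul1r ger0_norm ?wt_ge0.
Qed.

Lemma niceD f g : nice f -> nice g -> nice (fun x => f x + g x).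
Proof.
move=> [cf [C hC]] [cg [D hD]]; split; first exact: contD.
by exists (C + D) => x; rewrite (le_trans (ler_normD _ _))// mulrDl lerD.
Qed.

Lemma niceN f : nice f -> nice (fun x => - f x).
Proof.
move=> [cf [C hC]]; split; first exact: contN.
by exists C => x; rewrite normrN.
Qed.

Lemma niceMl f g : bddc f -> nice g -> nice (fun x => f x * g x).
Proof.
move=> [cf [C hC]] [cg [D hD]]; split; first exact: contM.
by exists (C * D) => x; rewrite normrM -mulrA ler_pM.
Qed.

Lemma niceMr f g : nice f -> bddc g -> nice (fun x => f x * g x).
Proof.
move=> [cf [C hC]] [cg [D hD]]; split; first exact: contM.
by exists (C * D) => x; rewrite normrM mulrAC ler_pM.
Qed.

Lemma niceX f n : nice f -> nice (fun x => f x ^+ n.+1).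
Proof.
move=> nf; rewrite (_ : (fun x => _) = fun x => f x * f x ^+ n).
  by apply: niceMr => //; exact/bddcX/nice_bddc.
by apply/funext => x; rewrite exprS.
Qed.

Lemma nice_norm f : nice f -> nice (fun x => `|f x|).
Proof.
move=> [cf [C hC]]; split; first exact: cont_norm.
by exists C => x; rewrite normr_id.
Qed.

Lemma nice_dom f g C : continuous f -> nice g -> (forall x, `|f x| <= C * `|g x|) -> nice f.
Proof.
move=> cf [cg [D hD]] h; split => //.
exists (`|C| * D) => x; rewrite (le_trans (h x))// (@le_trans _ _ (`|C| * `|g x|))//.
  by rewrite ler_wpM2r// ler_norm.
by rewrite -mulrA ler_wpM2l.
Qed.

Lemma nice_integrable f : nice f -> mu.-integrable [set: R] (EFin \o f).
Proof.
move=> [cf [C hC]].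
have C0 : 0 <= C by have := le_trans (normr_ge0 _) (hC 0); rewrite pmulr_lge0 ?wt_gt0.
apply: (@le_integrable _ _ _ mu setT measurableT _ (fun x => C%:E * (wt x)%:E)%E).
- by apply/measurable_EFinP; exact: continuous_measurable_fun.
- move=> x _ /=; rewrite lee_fin; apply: (le_trans (hC x)).
  by rewrite ger0_norm// mulr_ge0// wt_ge0.
- exact/integrableZl/integrable_oneDsqrV.
Qed.

Lemma ID f g : nice f -> nice g -> I (fun x => f x + g x) = I f + I g.
Proof. by move=> nf ng; rewrite /I RintegralD//; exact: nice_integrable. Qed.

Lemma IZ c f : nice f -> I (fun x => c * f x) = c * I f.
Proof. by move=> nf; rewrite /I RintegralZl//; exact: nice_integrable. Qed.

Lemma eq_I f g : f =1 g -> I f = I g.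
Proof. by move=> /funext ->. Qed.

Lemma IN f : nice f -> I (fun x => - f x) = - I f.
Proof.
move=> nf; rewrite -mulN1r -IZ//; apply: eq_I => x; by rewrite mulN1r.
Qed.

Lemma IB f g : nice f -> nice g -> I (fun x => f x - g x) = I f - I g.
Proof. by move=> nf ng; rewrite (ID nf (niceN ng)) IN. Qed.

Lemma I_ge0 f : (forall x, 0 <= f x) -> 0 <= I f.
Proof. by move=> f0; apply: Rintegral_ge0. Qed.

Lemma I_le f g : nice f -> nice g -> (forall x, f x <= g x) -> I f <= I g.
Proof.
by move=> nf ng fg; apply: le_Rintegral => //; exact: nice_integrable.
Qed.

Lemma I_abs f : nice f -> `|I f| <= I (fun x => `|f x|).
Proof.
move=> nf; have na := nice_norm nf; rewrite ler_norml -IN//.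
apply/andP; split; apply: I_le => //; first exact: niceN.
  by move=> x; rewrite lerNl -normrN ler_norm.
by move=> x; exact: ler_norm.
Qed.

Lemma I_abs_le f g : nice f -> nice g -> (forall x, `|f x| <= g x) -> `|I f| <= I g.
Proof.
move=> nf ng h; rewrite (le_trans (I_abs nf))// I_le//; exact: nice_norm.
Qed.

(** Fundamental theorem of calculus on [[-n, n]], then dominated convergence with [|f|] as bound. No
    limit of [F] at infinity is assumed, so any antiderivative may be used. *)
Lemma I_lim f F : dv F f -> nice f ->
  (fun n : nat => F n%:R - F (- n%:R)) @ \oo --> I f.
Proof.
move=> dF nf.
have [cf [C hC]] := nf.
have If := nice_integrable nf.
have mf : measurable_fun setT f by exact: continuous_measurable_fun.
pose fn (n : nat) : R -> \bar R := (EFin \o f) \_ (`[- n%:R, n%:R] : set R).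
have mfn n : measurable_fun setT (fn n).
  apply/measurable_restrict => //.
  by apply: measurable_funS (measurableT) _ _ => //; exact/measurable_EFinP.
have cvf x : fn ^~ x @ \oo --> (f x)%:E.
  apply: cvg_near_cst.
  have := @nbhs_infty_ger R `|x|; apply: filterS => n xn.
  rewrite /fn patchE mem_set//=.
  by rewrite in_itv /= -ler_norml.
have domn x n : (`|fn n x| <= (`|f x|)%:E)%E.
  rewrite /fn patchE; case: ifPn => _ /=; first by rewrite lexx.
  by rewrite normr0 lee_fin.
have [||||_ _ hc] := @dominated_convergence _ _ _ mu setT measurableT fn
   (EFin \o f) (fun x => (`|f x|)%:E) mfn _ _ _ _.
- exact/measurable_EFinP.
- by apply/aeW => x _; exact: cvf.
- by have := nice_integrable (nice_norm nf).
- by apply/aeW => x n _; exact: domn.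
have E (n : nat) : (\int[mu]_x fn n x = (F n%:R - F (- n%:R))%:E)%E.
  rewrite /fn -integral_mkcond /=.
  (* The degenerate interval is treated apart; the fundamental theorem is applied to intervals of
     positive length. *)
  have [->|n0] := eqVneq n 0%N.
    rewrite oppr0 subrr.
    rewrite (@set_interval.set_itv1 _ R 0) integral_set1//.
  have nn : - n%:R < n%:R :> R.
    by rewrite (@lt_trans _ _ 0)// ?oppr_lt0 ltr0n lt0n.
  rewrite (@continuous_FTC2 R f F (- n%:R) n%:R nn) ?EFinB//.
  - exact: continuous_subspaceT.
  - split.
    + by move=> x _; exact: dv_derivable dF.
    + by apply: cvg_at_right_filter; exact: (dv_continuous dF).
    + by apply: cvg_at_left_filter; exact: (dv_continuous dF).
  - by move=> x _; exact: dv_derive1 dF.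
have IE : (\int[mu]_x (EFin \o f) x)%E = (I f)%:E.
  by rewrite /I /Rintegral fineK//; exact: integrable_fin_num.
move: hc; rewrite IE => hc.
have : (fun n => (F n%:R - F (- n%:R))%:E) @ \oo --> (I f)%:E.
  by move: hc; under eq_fun do rewrite E.
by move/fine_cvg; exact.
Qed.

Lemma I_ge_osc f F x y : dv F f -> nice f -> (forall z, 0 <= f z) ->
  F x - F y <= I f.
Proof.
move=> dF nf f0; have h := I_lim dF nf.
have mono a b : a <= b -> F a <= F b by move=> ab; apply: (dv_le dF).
apply: (cvgr_to_ge h); near=> n.
have xn : `|x| <= n%:R by near: n; exact: nbhs_infty_ger.
have yn : `|y| <= n%:R by near: n; exact: nbhs_infty_ger.
apply: lerB; apply: mono; first by rewrite (le_trans (ler_norm _)).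
by move: yn; rewrite ler_norml => /andP[].
Unshelve. all: by end_near. Qed.

Lemma I_le_osc f F M : dv F f -> nice f -> (forall x y, y <= x -> F x - F y <= M) ->
  I f <= M.
Proof.
move=> dF nf hM; apply: (cvgr_to_le (I_lim dF nf)); apply: nearW => n.
by apply: hM; rewrite (@le_trans _ _ 0)// oppr_le0.
Qed.

Lemma wt_nat_le C e : 0 < e -> \forall n \near \oo, C * wt (n%:R : R) <= e.
Proof.
move=> e0; have := @nbhs_infty_ger R (`|C| / e + 1); apply: filterS => n hn.
have n0 : 0 < n%:R :> R.
  by apply: lt_le_trans hn; rewrite ltr_wpDl// divr_ge0// ltW.
apply: (@le_trans _ _ (`|C| * wt n%:R)).
  by rewrite ler_wpM2r ?wt_ge0// ler_norm.
rewrite /wt ler_pdivrMr ?oneDsq_gt0//.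
have h : `|C| <= e * (n%:R - 1) by rewrite mulrC -ler_pdivrMr//; lra.
apply: (le_trans h); rewrite ler_pM2l//.
have := sqr_ge0 (n%:R - 1 : R); nra.
Qed.

Lemma I_cvg_eq f F a b : dv F f -> nice f ->
  (fun n : nat => F n%:R) @ \oo --> a -> (fun n : nat => F (- n%:R)) @ \oo --> b ->
  I f = a - b.
Proof.
move=> dF nf ha hb; have h := I_lim dF nf.
exact: (cvg_unique _ h (cvgB ha hb)).
Qed.

Lemma nice_cvg0 F : nice F ->
  (fun n : nat => F n%:R) @ \oo --> 0 /\ (fun n : nat => F (- n%:R)) @ \oo --> 0.
Proof.
move=> [_ [C hC]]; split; apply/cvgr0Pnorm_le => e e0;
  have := wt_nat_le C e0; apply: filterS => n hn; apply: (le_trans (hC _)) => //.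
by rewrite /wt sqrrN.
Qed.

Lemma I_dv f F : dv F f -> nice f -> nice F -> I f = 0.
Proof.
move=> dF nf nF; have [h1 h2] := nice_cvg0 nF.
by rewrite (I_cvg_eq dF nf h1 h2) subrr.
Qed.

(** The common form of the integrations by parts below: a primitive [F] of the difference is
    exhibited, and what remains is a pointwise identity once the differential equations are
    substituted. *)
Lemma I_dv_eq f g F : nice F -> nice f -> nice g ->
  dv F (fun x => f x - g x) -> I f = I g.
Proof.
move=> nF nf ng dF; apply/eqP; rewrite -subr_eq0 -IB//; apply/eqP.
by apply: (I_dv dF) => //; apply: niceD => //; exact: niceN.
Qed.

(** [pi] bounds the oscillation of [atan], hence the bound does not depend on the centre [y]: test
    functions may be translated arbitrarily far at no cost. *)
Lemma I_wt_shift f C y : continuous f ->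
  (forall x, `|f x| <= C * wt (x - y)) -> nice f /\ I (fun x => `|f x|) <= C * pi.
Proof.
move=> cf hC.
have C0 : 0 <= C by have := le_trans (normr_ge0 _) (hC 0); rewrite pmulr_lge0 ?wt_gt0.
have nw : nice (fun x => wt (x - y)).
  split; first by apply: (dv_continuous (dv_shift (- y) dv_wt)).
  (* From [1 + x^2 <= 2 (1 + y^2) (1 + (x - y)^2)]. This constant depends on [y], but it serves only
     for niceness and not for the final bound. *)
  exists (2 * (1 + y ^+ 2)) => x.
  rewrite ger0_norm ?wt_ge0// /wt ler_pdivlMr ?oneDsq_gt0// mulrC ler_pdivrMr ?oneDsq_gt0//.
  have := sqr_ge0 (x - 2 * y); have := sqr_ge0 (y * (x - y)).
  by move=> h1 h2; lra.
have nf : nice f.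
  apply: (@nice_dom _ (fun x => wt (x - y)) C) => // x.
  by rewrite (le_trans (hC x))// ler_wpM2l// ler_norm.
split => //.
apply: (@le_trans _ _ (I (fun x => C * wt (x - y)))).
  apply: I_le => //; first exact: nice_norm.
  by apply: niceMl => //; exact: bddc_cst.
rewrite IZ// ler_wpM2l//.
apply: (I_le_osc (dv_shift (- y) dv_atan)) => // a b _.
have := atan_ltpi2 (a - y); have := atan_gtNpi2 (b - y); lra.
Qed.

(** Subtracting the infimum places the antiderivative between 0 and the total mass. Its exponential
    is then an integrating factor bounded above and below. *)
Lemma nice_antiderivative f : nice f -> (forall x, 0 <= f x) ->
  exists r, [/\ dv r f, forall x, 0 <= r x & forall x, r x <= I f].
Proof.
move=> nf f0; have [F dF] := antiderivative (nice_cont nf).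
have h x y := I_ge_osc x y dF nf f0.
pose S := [set F x | x in [set: R]].
have S0 : S !=set0 by exists (F 0); exists 0.
have lS : has_lbound S.
  by exists (F 0 - I f) => _ [x _ <-]; rewrite lerBlDl -lerBlDr h.
exists (fun x => F x - inf S); split.
- apply: dv_eq; first exact: (dvD dF (dv_cst (- inf S))).
  by move=> x /=; rewrite addr0.
- by move=> x; rewrite subr_ge0; apply: ge_inf => //; exists x.
- move=> x; rewrite lerBlDl -lerBlDr; apply: lb_le_inf => // _ [y _ <-].
  by rewrite lerBlDr -lerBlDl h.
Qed.

End Integral.

(* Redefined below, once Schwartz functions are available. *)
Ltac nice_schwartz := fail.
Ltac dv_schwartz := fail.

Ltac dv_tac :=
  match goal with
  | h : dv ?f _ |- dv ?f _ => exact: h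
  | h : dv ?f _ |- dv (fun x => ?f x) _ => exact: h
  | h : forall t, dv (?f t) _ |- dv (?f _) _ => exact: h
  | h : forall t, dv (?f t) _ |- dv (fun x => ?f _ x) _ => exact: h
  | |- dv (fun x => @?f x + @?g x) _ => eapply (@dvD _ f g); [dv_tac | dv_tac]
  | |- dv (fun x => - @?f x) _ => eapply (@dvN _ f); dv_tac
  | |- dv (fun x => @?f x * @?g x) _ => eapply (@dvM _ f g); [dv_tac | dv_tac]
  | |- dv (fun x => @?f x ^+ ?n) _ => eapply (@dvX _ f _ n); dv_tac
  | |- dv (fun x => expR (@?f x)) _ => eapply (@dv_expR _ f); dv_tac
  | |- dv (fun _ => ?c) _ => exact: (@dv_cst _ c)
  | |- dv (fun x => x) _ => exact: dv_id
  | |- dv wt _ => exact: dv_wt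
  | |- dv (fun x => wt x) _ => exact: dv_wt
  | |- dv _ _ => dv_schwartz
  end.

(** The derivative is built from the syntax of the function as an existential variable; the goal
    that remains is the pointwise identity with the announced derivative. *)
Ltac dv_compute := eapply dv_eq; [dv_tac | move=> ? /=].

Ltac bddc_tac :=
  match goal with
  | h : bddc ?f |- bddc ?f => exact: h
  | h : nice ?f |- bddc ?f => exact: (nice_bddc h)
  | h : bddc ?f |- bddc (fun x => ?f x) => exact: h
  | h : nice ?f |- bddc (fun x => ?f x) => exact: (nice_bddc h)
  | |- bddc (fun x => @?f x + @?g x) => apply: (@bddcD _ f g); bddc_tac
  | |- bddc (fun x => - @?f x) => apply: (@bddcN _ f); bddc_tac
  | |- bddc (fun x => @?f x * @?g x) => apply: (@bddcM _ f g); bddc_tac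
  | |- bddc (fun x => @?f x ^+ _) => apply: (@bddcX _ f); bddc_tac
  | |- bddc (fun x => `|@?f x|) => apply: (@bddc_norm _ f); bddc_tac
  | |- bddc (fun x => ?c) => exact: (@bddc_cst _ c)
  | |- bddc wt => exact: (nice_bddc nice_wt)
  | |- bddc (fun x => wt x) => exact: (nice_bddc nice_wt)
  | |- bddc _ => by apply: nice_bddc; nice_schwartz
  end.

Ltac nice_tac :=
  match goal with
  | h : nice ?f |- nice ?f => exact: h
  | h : nice ?f |- nice (fun x => ?f x) => exact: h
  | |- nice (fun x => @?f x + @?g x) => apply: (@niceD _ f g); nice_tac
  | |- nice (fun x => - @?f x) => apply: (@niceN _ f); nice_tac
  | |- nice (fun x => @?f x * @?g x) =>
     first [apply: (@niceMr _ f g); [nice_tac|bddc_tac] | apply: (@niceMl _ f g); [bddc_tac|nice_tac]]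
  | |- nice (fun x => @?f x ^+ _) => apply: (@niceX _ f); nice_tac
  | |- nice (fun x => `|@?f x|) => apply: (@nice_norm _ f); nice_tac
  | |- nice (fun x => 0) => exact: nice0
  | |- nice wt => exact: nice_wt
  | |- nice (fun x => wt x) => exact: nice_wt
  | |- nice _ => nice_schwartz
  end.

Ltac nonneg_tac := repeat first [ done | assumption | (apply: ltW; assumption) | exact: sqr_ge0
  | exact: expR_ge0 | exact: normr_ge0 | exact: wt_ge0 | apply: mulr_ge0
  | rewrite invr_ge0 | apply: addr_ge0 | apply: exprn_ge0 ].

(** * Energy estimates for first order linear equations *)

Section Energy.
Context {R : realType}.
Implicit Types (f g W : R -> R) (c k x : R).

Lemma expRN_vanish c x0 (B e : R) : 0 < c -> 0 < e ->
  \forall n \near \oo, expR (- (c * (x0 + (n%:R : R)))) * B <= e.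
Proof.
move=> c0 e0; have := @nbhs_infty_ger R (`|B| / e / c - x0); apply: filterS => n hn.
have h0 : `|B| / e <= c * (x0 + n%:R).
  by rewrite [c * _]mulrC -ler_pdivrMr//; lra.
apply: (@le_trans _ _ (expR (- (c * (x0 + n%:R))) * `|B|)).
  by rewrite ler_wpM2l ?expR_ge0// ler_norm.
rewrite expRN mulrC ler_pdivrMr ?expR_gt0//.
have h1 := expR_ge1Dx (c * (x0 + n%:R)).
by rewrite mulrC -ler_pdivrMr//; lra.
Qed.

Section Key.
Variables (X X' r rho : R -> R) (c M : R).
Hypotheses (dX : dv X X') (drho : dv rho r) (rho0 : forall x, 0 <= rho x)
  (rhoM : forall x, rho x <= M) (X0 : forall x, 0 <= X x) (c0 : 0 < c).

(** Gronwall with an integrable growth rate: the factor removes [r] and leaves the pure damping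
    [- c], and [0 <= rho <= M] bounds the price of returning to [X] by [expR M]. *)
Let Z x := X x * expR (- rho x).

Let dZ : dv Z (fun x => (X' x - r x * X x) * expR (- rho x)).
Proof. by rewrite /Z; dv_compute; ring. Qed.

Let Z0 x : 0 <= Z x. Proof. by rewrite mulr_ge0// expR_ge0. Qed.

Let ZX x : Z x <= X x.
Proof. by rewrite ler_piMr// expR_le1 oppr_le0. Qed.

Let XZ x : X x <= expR M * Z x.
Proof.
rewrite mulrCA -expRD ler_peMr//.
by rewrite -expR0 ler_expR subr_ge0.
Qed.

Lemma energy_sup (A0 : R) : 0 <= A0 -> (exists B : R, forall x, X x <= B) ->
  (forall x, X' x <= (- c + r x) * X x + A0) ->
  forall x, X x <= expR M * (A0 / c).
Proof.
move=> A00 [B XB] hX x.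
apply: (le_trans (XZ x)); rewrite ler_wpM2l ?expR_ge0//.
(* [Y] is nondecreasing, and since [X] is bounded its negative part vanishes at minus infinity;
   sending the left endpoint there gives [Z <= A0 / c]. *)
pose Y z := expR (c * z) * (A0 / c - Z z).
have dY : dv Y (fun z => expR (c * z) * (A0 - c * Z z - (X' z - r z * X z) * expR (- rho z))).
  rewrite /Y; dv_compute; field; exact: lt0r_neq0.
have Yle (y z : R) : y <= z -> Y y <= Y z.
  apply: (dv_le dY) => t _; rewrite mulr_ge0 ?expR_ge0//.
  have h1 : X' t - r t * X t <= - c * X t + A0 by have := hX t; lra.
  have h2 : expR (- rho t) <= 1 by rewrite expR_le1 oppr_le0.
  have h3 := expR_ge0 (- rho t).
  have h4 : (X' t - r t * X t) * expR (- rho t) <= (- c * X t + A0) * expR (- rho t).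
    by rewrite ler_wpM2r.
  have h5 : A0 * expR (- rho t) <= A0 by rewrite ler_piMr.
  by rewrite /Z; lra.
apply/ler_addgt0Pr => e e0.
have [n [hn nx]] : exists n : nat, expR (- (c * (x + n%:R))) * B <= e /\ - n%:R <= x.
  have h1 := expRN_vanish x B c0 e0; have h2 := @nbhs_infty_ger R (- x).
  have : \forall n \near \oo, expR (- (c * (x + n%:R))) * B <= e /\ - n%:R <= x.
    near=> n; split; first by near: n.
    by rewrite lerNl; near: n.
  by case=> N _ /(_ N (leqnn N)) h; exists N.
have := Yle _ _ nx; rewrite /Y -(ler_pM2l (expR_gt0 (- (c * x)))) !mulrA -!expRD.
rewrite addNr expR0 mul1r.
have -> : - (c * x) + c * - n%:R = - (c * (x + n%:R)) by ring.
have h0 : 0 <= expR (- (c * (x + n%:R))) * (A0 / c).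
  by rewrite mulr_ge0 ?expR_ge0// divr_ge0// ltW.
have h1 : expR (- (c * (x + n%:R))) * Z (- n%:R) <= e.
  apply: le_trans hn; rewrite ler_wpM2l ?expR_ge0//.
  exact: (le_trans (ZX _) (XB _)).
by rewrite mulrBr; lra.
Unshelve. all: by end_near. Qed.

Section Integrated.
Variable A : R -> R.
Hypotheses (nX : nice X) (nA : nice A) (A0 : forall x, 0 <= A x)
  (hX : forall x, X' x <= (- c + r x) * X x + A x).

Let Z'le x : (X' x - r x * X x) * expR (- rho x) <= - c * Z x + A x.
Proof.
have h1 : X' x - r x * X x <= - c * X x + A x by have := hX x; lra.
have h2 : expR (- rho x) <= 1 by rewrite expR_le1 oppr_le0.
have h3 := expR_ge0 (- rho x).
have h4 : (X' x - r x * X x) * expR (- rho x) <= (- c * X x + A x) * expR (- rho x).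
  by rewrite ler_wpM2r.
have h5 : A x * expR (- rho x) <= A x by rewrite ler_piMr.
by rewrite /Z; lra.
Qed.

Let nZ : nice Z.
Proof.
have be : bddc (fun x => expR (- rho x)).
  split; first by apply: (@dv_continuous _ _ (fun x => expR (- rho x) * - r x)); dv_tac.
  by exists 1 => x; rewrite ger0_norm ?expR_ge0// expR_le1 oppr_le0.
by rewrite /Z; nice_tac.
Qed.

Let Zvanish e : 0 < e -> \forall n \near \oo, Z (- (n%:R : R)) <= e.
Proof.
move=> e0; have [_ /cvgr0Pnorm_le/(_ e e0)] := nice_cvg0 nZ.
by apply: filterS => n; apply: le_trans; exact: ler_norm.
Qed.

Lemma energy_int : c * I X <= expR M * I A.
Proof.
have [V dV] := antiderivative (nice_cont nZ).
have [alpha dalpha] := antiderivative (nice_cont nA).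
suff h : c * I Z <= I A.
  apply: (@le_trans _ _ (c * (expR M * I Z))).
    rewrite ler_pM2l// -IZ//; apply: I_le => //.
    by have nz := nZ; nice_tac.
  by rewrite mulrCA ler_pM2l ?expR_gt0.
rewrite -IZ//.
have dcV : dv (fun x => c * V x) (fun x => c * Z x) by dv_compute; ring.
have ncZ : nice (fun x => c * Z x) by have nz := nZ; nice_tac.
apply/ler_addgt0Pr => e e0; apply: (cvgr_to_le (I_lim dcV ncZ)).
have := Zvanish e0; apply: filterS => n hn.
(* This function is nondecreasing, so over [[-n, n]] the increment of [c * V] is at most the mass of
   [A] plus [Z (- n)], which tends to 0. *)
have dG : dv (fun x => alpha x - c * V x - Z x)
  (fun x => A x - c * Z x - (X' x - r x * X x) * expR (- rho x)) by dv_compute; ring.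
have := @dv_le _ _ _ (- n%:R) n%:R dG _ _.
have h1 := I_ge_osc n%:R (- n%:R) dalpha nA A0.
have h2 : - n%:R <= n%:R :> R by rewrite (@le_trans _ _ 0)// oppr_le0.
have h3 := Z0 n%:R.
move=> /(_ _ h2) h4; have {}h4 := h4 (fun x _ => _).
suff : alpha (- n%:R) - c * V (- n%:R) - Z (- n%:R) <= alpha n%:R - c * V n%:R - Z n%:R.
  by lra.
by apply: (dv_le dG) => // x _; have := Z'le x; lra.
Qed.

Lemma energy_int_sup x : X x <= expR M * I A.
Proof.
apply: (le_trans (XZ x)); rewrite ler_wpM2l ?expR_ge0//.
have [alpha dalpha] := antiderivative (nice_cont nA).
apply/ler_addgt0Pr => e e0.
have [n [hn nx]] : exists n : nat, Z (- n%:R) <= e /\ - n%:R <= x.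
  have h1 := Zvanish e0; have h2 := @nbhs_infty_ger R (- x).
  have : \forall n \near \oo, Z (- (n%:R : R)) <= e /\ - n%:R <= x.
    near=> n; split; first by near: n.
    by rewrite lerNl; near: n.
  by case=> N _ /(_ N (leqnn N)) h; exists N.
have dG : dv (fun x => alpha x - Z x)
  (fun x => A x - (X' x - r x * X x) * expR (- rho x)) by dv_compute; ring.
have h1 := I_ge_osc x (- n%:R) dalpha nA A0.
suff : alpha (- n%:R) - Z (- n%:R) <= alpha x - Z x by lra.
apply: (dv_le dG) => // t _; have := Z'le t.
by have := mulr_ge0 (ltW c0) (Z0 t); lra.
Unshelve. all: by end_near. Qed.

End Integrated.
End Key.

Section WeightedSup.
Variables (k M : R) (b rho : R -> R).
Hypotheses (k0 : 0 < k) (drho : dv rho (fun x => b x ^+ 2))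
  (rho0 : forall x, 0 <= rho x) (rhoM : forall x, rho x <= M).

(** Energy estimate for the square of [v = y / W]. Out of the damping [4 k], the source takes
    [k / 2], the coefficient [b] takes [k] by completing a square, and [W' / W] takes [k]; more than
    [k] is left. The price of [b], known only in L^2, is the growth rate [b ^+ 2 / k], of integral
    at most [M / k]. *)
Lemma linear_sup (y f W W' : R -> R) (F : R) :
  dv y (fun x => f x - (2 * k + b x) * y x) ->
  dv W W' -> (forall x, 0 < W x) -> (forall x, `|W' x| <= k / 2 * W x) ->
  (forall x, `|f x| <= F * W x) -> (exists B : R, forall x, `|y x| <= B * W x) ->
  forall x, `|y x| <= 2 * expR (M / k) * (F / k) * W x.
Proof.
move=> dy dW W0 W'le fF [B yB] x.
have F0 : 0 <= F by have := le_trans (normr_ge0 _) (fF 0); rewrite pmulr_lge0.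
have B0 : 0 <= B by have := le_trans (normr_ge0 _) (yB 0); rewrite pmulr_lge0.
have Wn0 z : W z != 0 by exact: lt0r_neq0.
have M0 : 0 <= M by exact: le_trans (rho0 0) (rhoM 0).
pose v z := y z / W z.
have dWV : dv (fun z => (W z)^-1) (fun z => - W' z / W z ^+ 2) by apply: dvV.
have dv' : dv v (fun z => f z / W z - (2 * k + b z) * v z - v z * (W' z / W z)).
  by rewrite /v; dv_compute; field.
have dX : dv (fun z => v z ^+ 2)
   (fun z => 2 * v z * (f z / W z - (2 * k + b z) * v z - v z * (W' z / W z))).
  by dv_compute; ring.
have dr : dv (fun z => rho z / k) (fun z => b z ^+ 2 / k) by dv_compute; ring.
have hX : forall z, v z ^+ 2 <= expR (M / k) * (2 * F ^+ 2 / k / k).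
  apply: (energy_sup dX dr).
  - by move=> z; rewrite divr_ge0// ltW.
  - by move=> z; rewrite ler_pM2r ?invr_gt0.
  - by move=> z; exact: sqr_ge0.
  - exact: k0.
  - by rewrite !mulr_ge0 ?sqr_ge0// ?invr_ge0// ltW.
  - exists (B ^+ 2) => z; rewrite -real_normK ?num_real// lerXn2r ?nnegrE//.
    by rewrite /v normrM normfV [`|W z|]gtr0_norm// ler_pdivrMr.
  move=> z.
  set p := f z / W z; set w := W' z / W z; set t := v z; set bz := b z.
  have hp : p ^+ 2 <= F ^+ 2.
    rewrite -real_normK ?num_real// lerXn2r ?nnegrE//.
    by rewrite /p normrM normfV [`|W z|]gtr0_norm// ler_pdivrMr.
  have hw : - w <= k / 2.
    have : `|w| <= k / 2 by rewrite /w normrM normfV [`|W z|]gtr0_norm// ler_pdivrMr.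
    by rewrite ler_norml => /andP[]; lra.
  have h1 : 2 * t * p <= k / 2 * t ^+ 2 + 2 * F ^+ 2 / k.
    have : 0 <= (k / 2 * t - p) ^+ 2 * (2 / k) by nonneg_tac.
    have -> : (k / 2 * t - p) ^+ 2 * (2 / k) = k / 2 * t ^+ 2 - 2 * t * p + p ^+ 2 * (2 / k).
      by field; exact: lt0r_neq0.
    have : p ^+ 2 * (2 / k) <= F ^+ 2 * (2 / k) by rewrite ler_wpM2r// divr_ge0// ltW.
    have -> : 2 * F ^+ 2 / k = F ^+ 2 * (2 / k) by ring.
    by lra.
  have h2 : - (2 * bz * t ^+ 2) <= k * t ^+ 2 + bz ^+ 2 / k * t ^+ 2.
    have : 0 <= (k + bz) ^+ 2 / k * t ^+ 2 by nonneg_tac.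
    have -> : (k + bz) ^+ 2 / k * t ^+ 2 = (k + 2 * bz) * t ^+ 2 + bz ^+ 2 / k * t ^+ 2.
      by field; exact: lt0r_neq0.
    by lra.
  have h3 : - (2 * w * t ^+ 2) <= k * t ^+ 2.
    have := ler_wpM2r (sqr_ge0 t) hw; lra.
  have h4 : 0 <= k * t ^+ 2 by rewrite mulr_ge0 ?sqr_ge0// ltW.
  by lra.
have {}hX := hX x.
have e1 : 1 <= expR (M / k) by rewrite -expR0 ler_expR divr_ge0// ltW.
have h : v x ^+ 2 <= (2 * expR (M / k) * (F / k)) ^+ 2.
  apply: (le_trans hX).
  have -> : (2 * expR (M / k) * (F / k)) ^+ 2 = 4 * (expR (M / k) * (expR (M / k) * (F / k) ^+ 2)).
    ring.
  have -> : expR (M / k) * (2 * F ^+ 2 / k / k) = 2 * (expR (M / k) * (F / k) ^+ 2).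
    by field; exact: lt0r_neq0.
  have h : 0 <= expR (M / k) * (F / k) ^+ 2 by rewrite mulr_ge0 ?sqr_ge0 ?expR_ge0.
  have := ler_peMl h e1; lra.
rewrite -ler_pdivrMr// -[W x]gtr0_norm// -normfV -normrM.
rewrite -[leRHS]ger0_norm; last by nonneg_tac.
by rewrite -ler_sqr ?nnegrE// !real_normK ?num_real.
Qed.

Lemma linear_unique (y y1 f : R -> R) :
  dv y (fun x => f x - (2 * k + b x) * y x) ->
  dv y1 (fun x => f x - (2 * k + b x) * y1 x) ->
  (exists B : R, forall x, `|y x| <= B) -> (exists B : R, forall x, `|y1 x| <= B) -> y =1 y1.
Proof.
move=> dy dy1 [B hB] [B1 hB1] x; apply/eqP; rewrite -subr_eq0 -normr_le0.
have dz : dv (fun x => y x - y1 x) (fun x => 0 - (2 * k + b x) * (y x - y1 x)).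
  by dv_compute; ring.
suff : `|y x - y1 x| <= 2 * expR (M / k) * (0 / k) * 1 by rewrite mul0r mulr0 mul0r.
apply: (linear_sup dz (dv_cst 1)) => //.
- by move=> z; rewrite normr0 mulr1; nonneg_tac.
- by move=> z; rewrite normr0 mul0r.
- by exists (B + B1) => z; rewrite mulr1 (le_trans (ler_normB _ _))// lerD.
Qed.

(** Barrier argument: [Y] is a bounded supersolution and [- Y] a subsolution. The solutions are
    [expR (- A)] times [G - C] for a constant [C]. As [G + expR A * Y] increases and
    [G - expR A * Y] decreases, every value of the second lies below every value of the first, and a
    constant [C] between them gives a solution trapped between the barriers. *)
Lemma linear_bounded_solution f (F : R) : continuous b -> continuous f ->
  (forall x, `|f x| <= F) ->
  exists y, dv y (fun x => f x - (2 * k + b x) * y x) /\ exists B : R, forall x, `|y x| <= B.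
Proof.
move=> cb cf fF.
have F0 : 0 <= F by exact: le_trans (normr_ge0 _) (fF 0).
have [A dA] : exists A, dv A (fun x => 2 * k + b x).
  by apply: antiderivative; apply: contD => //; exact: cont_cst.
have [G dG] : exists G, dv G (fun x => expR (A x) * f x).
  apply: antiderivative; apply: contM => //.
  apply: (@dv_continuous _ _ (fun x => expR (A x) * (2 * k + b x))); dv_tac.
pose Y x := F / k * expR (rho x / (2 * k)).
have dE : dv (fun x => expR (A x) * Y x)
   (fun x => expR (A x) * ((2 * k + b x + b x ^+ 2 / (2 * k)) * Y x)).
  by rewrite /Y; dv_compute; ring.
have kY x : F <= (2 * k + b x + b x ^+ 2 / (2 * k)) * Y x.
  have hY : F / k <= Y x.
    have h : 1 <= expR (rho x / (2 * k)) by rewrite -expR0 ler_expR; nonneg_tac.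
    by rewrite /Y ler_peMr//; nonneg_tac.
  have h : k <= 2 * k + b x + b x ^+ 2 / (2 * k).
    have : 0 <= (k + b x) ^+ 2 / (2 * k) by nonneg_tac.
    have -> : (k + b x) ^+ 2 / (2 * k) = k / 2 + b x + b x ^+ 2 / (2 * k).
      by field; exact: lt0r_neq0.
    by have := k0; lra.
  have := ler_pM (ltW k0) (divr_ge0 F0 (ltW k0)) h hY.
  by rewrite mulrCA divff ?mulr1// lt0r_neq0.
have up (x y : R) : x <= y -> G x + expR (A x) * Y x <= G y + expR (A y) * Y y.
  apply: (dv_le (dvD dG dE)) => z _ /=; rewrite -mulrDr mulr_ge0 ?expR_ge0//.
  by have := kY z; have := fF z; rewrite ler_norml => /andP[]; lra.
have dn (x y : R) : x <= y -> G y - expR (A y) * Y y <= G x - expR (A x) * Y x.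
  move=> xy; rewrite -lerN2 !opprB.
  apply: (dv_le (dvD dE (dvN dG)) _ xy) => z _ /=.
  rewrite -mulrBr mulr_ge0 ?expR_ge0//.
  by have := kY z; have := fF z; rewrite ler_norml => /andP[]; lra.
have Y0 x : 0 <= expR (A x) * Y x by nonneg_tac.
have cross (x y : R) : G x - expR (A x) * Y x <= G y + expR (A y) * Y y.
  have [xy|yx] := leP x y.
    by have := up _ _ xy; have := Y0 x; lra.
  by have := dn _ _ (ltW yx); have := Y0 y; lra.
pose S := [set G x + expR (A x) * Y x | x in [set: R]].
have S0 : S !=set0 by exists (G 0 + expR (A 0) * Y 0); exists 0.
have lS : has_lbound S by exists (G 0 - expR (A 0) * Y 0) => _ [x _ <-].
have l1 x : inf S <= G x + expR (A x) * Y x by apply: ge_inf => //; exists x.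
have l2 x : G x - expR (A x) * Y x <= inf S.
  by apply: lb_le_inf => // _ [y _ <-].
exists (fun x => expR (- A x) * (G x - inf S)); split.
  eapply dv_eq; [dv_tac|move=> x /=].
  have -> : expR (- A x) * (expR (A x) * f x + - 0) = f x.
    by rewrite oppr0 addr0 mulrA -expRD addNr expR0 mul1r.
  by ring.
exists (F / k * expR (M / (2 * k))) => x.
rewrite normrM ger0_norm ?expR_ge0//.
have h : `|G x - inf S| <= expR (A x) * Y x.
  by rewrite ler_norml; have := l1 x; have := l2 x; lra.
have := ler_wpM2l (expR_ge0 (- A x)) h; rewrite mulrA -expRD addNr expR0 mul1r => h2.
apply: (le_trans h2); rewrite /Y ler_wpM2l//; first by nonneg_tac.
by rewrite ler_expR ler_pM2r ?rhoM// invr_gt0 mulr_gt0.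
Qed.

End WeightedSup.

Section WeightedL2.
Variables (k c : R) (b b2 e a W W' : R -> R).
Hypotheses (k0 : 0 < k) (nb : nice b) (nb2 : nice b2) (ne : nice e) (na : nice a)
  (bW : bddc W) (dW : dv W W') (W0 : forall x, 0 <= W x)
  (W'le : forall x, `|W' x| <= k * W x)
  (de : dv e (fun x => (c + b2 x) * a x - (2 * k + b x) * e x)).

Let M := I (fun x => b x ^+ 2 / k + b2 x ^+ 2).

Let pre : exists2 rho, dv rho (fun x => b x ^+ 2 / k + b2 x ^+ 2) &
  (forall x, 0 <= rho x) /\ (forall x, rho x <= M).
Proof.
have [|x|r [h1 h2 h3]] := @nice_antiderivative _ (fun x => b x ^+ 2 / k + b2 x ^+ 2).
- by nice_tac.
- by nonneg_tac.
- by exists r.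
Qed.

Let dX : dv (fun x => W x * e x ^+ 2)
  (fun x => W' x * e x ^+ 2 + 2 * W x * e x * ((c + b2 x) * a x - (2 * k + b x) * e x)).
Proof. by dv_compute; ring. Qed.

Let hX x : W' x * e x ^+ 2 + 2 * W x * e x * ((c + b2 x) * a x - (2 * k + b x) * e x) <=
  (- k + (b x ^+ 2 / k + b2 x ^+ 2)) * (W x * e x ^+ 2) + (c ^+ 2 / k + 1) * (W x * a x ^+ 2).
Proof.
have h1 : W' x * e x ^+ 2 <= k * W x * e x ^+ 2.
  by rewrite ler_wpM2r ?sqr_ge0// (le_trans (ler_norm _)).
have h2 : 2 * e x * (c + b2 x) * a x - 2 * (2 * k + b x) * e x ^+ 2 <=
   (- (2 * k) + (b x ^+ 2 / k + b2 x ^+ 2)) * e x ^+ 2 + (c ^+ 2 / k + 1) * a x ^+ 2.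
  have := sqr_ge0 (b2 x * e x - a x).
  have : 0 <= (k * e x - c * a x) ^+ 2 / k by nonneg_tac.
  have -> : (k * e x - c * a x) ^+ 2 / k = k * e x ^+ 2 - 2 * c * a x * e x + c ^+ 2 / k * a x ^+ 2.
    by field; exact: lt0r_neq0.
  have : 0 <= (k + b x) ^+ 2 / k * e x ^+ 2 by nonneg_tac.
  have -> : (k + b x) ^+ 2 / k * e x ^+ 2 = k * e x ^+ 2 + 2 * b x * e x ^+ 2 + b x ^+ 2 / k * e x ^+ 2.
    by field; exact: lt0r_neq0.
  by lra.
by have := ler_wpM2l (W0 x) h2; lra.
Qed.

(** The energy is [W * e ^+ 2]. Completing squares moves [b] and [b2], controlled only in L^2, into
    the growth rate, which produces [expR M]; the derivative of the weight is paid by the damping.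
    It is applied with [W = 1] in the Riccati iteration and with [W = wt] in localised
    comparisons. *)
Lemma linear_L2 : k * I (fun x => W x * e x ^+ 2) <=
  expR M * (c ^+ 2 / k + 1) * I (fun x => W x * a x ^+ 2).
Proof.
have [rho drho [r0 rM]] := pre.
have c0 : 0 <= c ^+ 2 / k + 1 by nonneg_tac.
rewrite -[leRHS]mulrA -(IZ (c ^+ 2 / k + 1)); last by nice_tac.
apply: (energy_int dX drho r0 rM) => //.
- by move=> x; rewrite mulr_ge0 ?sqr_ge0 ?W0.
- by nice_tac.
- by nice_tac.
- by move=> x; have w0 := W0 x; nonneg_tac.
Qed.

Lemma linear_L2_sup x : W x * e x ^+ 2 <=
  expR M * (c ^+ 2 / k + 1) * I (fun x => W x * a x ^+ 2).
Proof.
have [rho drho [r0 rM]] := pre.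
have c0 : 0 <= c ^+ 2 / k + 1 by nonneg_tac.
rewrite -[leRHS]mulrA -(IZ (c ^+ 2 / k + 1)); last by nice_tac.
apply: (energy_int_sup dX drho r0 rM _ k0) => //.
- by move=> z; rewrite mulr_ge0 ?sqr_ge0 ?W0.
- by nice_tac.
- by nice_tac.
- by move=> z; have w0 := W0 z; nonneg_tac.
Qed.

End WeightedL2.
End Energy.

(** * Schwartz functions *)

Section SchwartzClass.
Context {R : realType}.
Implicit Types (f g : R -> R) (c k x : R).

Definition rapid f := forall n, exists C : R, forall x, `|x ^+ n * f x| <= C.

(** Schwartz regularity graded by the number of derivatives, with the derivatives as witnesses.
    Closure properties, and the gain of a derivative from a differential equation, are then
    inductions on [m]. *)
Fixpoint smr (m : nat) f : Prop :=
  continuous f /\ rapid f /\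
  if m is m'.+1 then exists f', dv f f' /\ smr m' f' else True.

Definition sch f := forall m, smr m f.

Lemma rapidD f g : rapid f -> rapid g -> rapid (fun x => f x + g x).
Proof.
move=> rf rg n; have [C hC] := rf n; have [D hD] := rg n.
by exists (C + D) => x; rewrite mulrDr (le_trans (ler_normD _ _))// lerD.
Qed.

Lemma rapidN f : rapid f -> rapid (fun x => - f x).
Proof. by move=> rf n; have [C hC] := rf n; exists C => x; rewrite mulrN normrN. Qed.

Lemma rapidMb f g (C : R) : (forall x, `|g x| <= C) -> rapid f -> rapid (fun x => g x * f x).
Proof.
move=> gC rf n; have [D hD] := rf n; exists (C * D) => x.
by rewrite mulrCA normrM ler_pM.
Qed.

Lemma rapid_bounded f : rapid f -> exists C : R, forall x, `|f x| <= C.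
Proof. by move=> /(_ 0%N)[C hC]; exists C => x; have := hC x; rewrite mul1r. Qed.

Lemma rapidX f : rapid f -> rapid (fun x => x * f x).
Proof.
by move=> rf n; have [C hC] := rf n.+1; exists C => x; rewrite mulrA -exprSr.
Qed.

Lemma rapid_nice f : continuous f -> rapid f -> nice f.
Proof.
move=> cf rf; split => //.
have [A hA] := rf 0%N; have [B hB] := rf 2%N.
exists (A + B) => x; rewrite /wt ler_pdivlMr ?oneDsq_gt0// mulrDr mulr1 lerD//.
  by have := hA x; rewrite mul1r.
by have := hB x; rewrite normrM ger0_norm ?sqr_ge0// mulrC.
Qed.

Lemma smr_cont m f : smr m f -> continuous f.
Proof. by case: m => [|m] []. Qed.

Lemma smr_rapid m f : smr m f -> rapid f.
Proof. by case: m => [|m] [_ []]. Qed.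

Lemma smrW m f : smr m.+1 f -> smr m f.
Proof.
elim: m f => [|m IH] f [cf [rf [f' [df sf']]]]; split => //; split => //.
by exists f'; split => //; exact: IH.
Qed.

Lemma smrD m f g : smr m f -> smr m g -> smr m (fun x => f x + g x).
Proof.
elim: m f g => [|m IH] f g [cf [rf hf]] [cg [rg hg]];
  (split; [exact: contD|split; [exact: rapidD|]]) => //.
have [f' [df sf]] := hf; have [g' [dg sg]] := hg.
by exists (fun x => f' x + g' x); split; [exact: dvD|exact: IH].
Qed.

Lemma smrN m f : smr m f -> smr m (fun x => - f x).
Proof.
elim: m f => [|m IH] f [cf [rf hf]];
  (split; [exact: contN|split; [exact: rapidN|]]) => //.
have [f' [df sf]] := hf.
by exists (fun x => - f' x); split; [exact: dvN|exact: IH].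
Qed.

Lemma smrM m f g : smr m f -> smr m g -> smr m (fun x => f x * g x).
Proof.
elim: m f g => [|m IH] f g sf sg;
  have cf := smr_cont sf; have cg := smr_cont sg;
  have rf := smr_rapid sf; have rg := smr_rapid sg;
  have [C hC] := rapid_bounded rf;
  (split; [exact: contM|split; [exact: (rapidMb hC)|]]) => //.
have [_ [_ [f' [df sf']]]] := sf; have [_ [_ [g' [dg sg']]]] := sg.
exists (fun x => f' x * g x + f x * g' x); split; first exact: dvM.
by apply: smrD; apply: IH => //; exact: smrW.
Qed.

Lemma smrZ m c f : smr m f -> smr m (fun x => c * f x).
Proof.
elim: m f => [|m IH] f [cf [rf hf]];
  (split; [exact: (contM (@cont_cst _ c))|split;
    [exact: (@rapidMb _ (fun=> c) `|c|)|]]) => //.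
have [f' [df sf]] := hf.
exists (fun x => c * f' x); split; last exact: IH.
by dv_compute; ring.
Qed.

Lemma smr_opp m f : smr m f -> smr m (fun x => f (- x)).
Proof.
elim: m f => [|m IH] f [cf [rf hf]].
all: split; first by move=> x; apply: (@continuous_comp _ _ _ (fun x => - x) f x);
  [exact: (dv_continuous (dvN dv_id))|exact: cf].
all: split; first by move=> n; have [C hC] := rf n; exists C => x;
  rewrite normrM normrX -[`|x|]normrN -normrX -normrM; exact: hC.
by [].
have [f' [df sf]] := hf; exists (fun x => - f' (- x)); split.
  exact: dv_opp.
by apply: smrN; exact: IH.
Qed.

Lemma schD f g : sch f -> sch g -> sch (fun x => f x + g x).
Proof. by move=> sf sg m; exact: smrD. Qed.
Lemma schN f : sch f -> sch (fun x => - f x).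
Proof. by move=> sf m; exact: smrN. Qed.
Lemma schM f g : sch f -> sch g -> sch (fun x => f x * g x).
Proof. by move=> sf sg m; exact: smrM. Qed.
Lemma schZ c f : sch f -> sch (fun x => c * f x).
Proof. by move=> sf m; exact: smrZ. Qed.
Lemma schZr c f : sch f -> sch (fun x => f x * c).
Proof.
move=> sf; rewrite (_ : (fun x => _) = (fun x => c * f x)); first exact: schZ.
by apply/funext => x; rewrite mulrC.
Qed.
Lemma sch_opp f : sch f -> sch (fun x => f (- x)).
Proof. by move=> sf m; exact: smr_opp. Qed.

Lemma schX n f : sch f -> sch (fun x => f x ^+ n.+1).
Proof.
move=> sf; elim: n => [//|n IH].
rewrite (_ : (fun x => _) = (fun x => f x * f x ^+ n.+1)); first exact: schM.
by apply/funext => x; rewrite exprS.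
Qed.

Lemma sch0 : sch (fun=> 0).
Proof.
elim=> [|m IH].
  split; first exact: cont_cst.
  by split => // n; exists 0 => x; rewrite mulr0 normr0.
split; first exact: cont_cst.
split; first by move=> n; exists 0 => x; rewrite mulr0 normr0.
by exists (fun=> 0); split => //; exact: dv_cst.
Qed.

Lemma sch_cont f : sch f -> continuous f.
Proof. by move=> /(_ 0%N)/smr_cont. Qed.
Lemma sch_rapid f : sch f -> rapid f.
Proof. by move=> /(_ 0%N)/smr_rapid. Qed.
Lemma sch_nice f : sch f -> nice f.
Proof. by move=> sf; apply: rapid_nice; [exact: sch_cont|exact: sch_rapid]. Qed.
Lemma sch_dv f : sch f -> dv f f^`().
Proof.
move=> /(_ 1%N)[_ [_ [f' [df _]]]].
by rewrite (_ : f^`() = f')//; apply/funext => x; exact: dv_derive1 df.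
Qed.
Lemma sch_d f : sch f -> sch f^`().
Proof.
move=> sf m; have [_ [_ [f' [df sf']]]] := sf m.+1.
by rewrite (_ : f^`() = f')//; apply/funext => x; exact: dv_derive1 df.
Qed.

Lemma schP f : sch f <-> f \in schwartz_pred.
Proof.
split=> [sf|/schwartz_predP[smf bf] m].
  have sm m : sch f^`(m) by elim: m => // m IH; rewrite derive1nS; exact: sch_d.
  apply/schwartz_predP; split=> [m x|k m].
    exact: (dv_derivable (sch_dv (sm m))).
  exact: (sch_rapid (sm m)).
suff h : forall n, smr m f^`(n) by exact: (h 0%N).
have cn n : continuous f^`(n).
  exact: (dv_continuous (derivable_dv (smf n))).
have rn n : rapid f^`(n) by move=> j; exact: bf.
elim: m => [|m IH] n; first by split => //; split.
split => //; split => //.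
exists f^`(n.+1); split => //.
by rewrite derive1nS; exact: (derivable_dv (smf n)).
Qed.

(** A differential equation expresses [f'] through [f], so order [m] for [f] gives order [m] for
    [f'], hence order [m.+1] for [f]. Only continuity and rapid decay must be known beforehand. *)
Lemma sch_bootstrap f f' : continuous f -> rapid f -> dv f f' ->
  (forall m, smr m f -> smr m f') -> sch f.
Proof.
move=> cf rf df hf; elim=> [|m IH]; first by split => //; split.
by split => //; split => //; exists f'; split => //; exact: hf.
Qed.

End SchwartzClass.

Ltac sch_tac :=
  match goal with
  | h : sch ?f |- sch ?f => exact: h
  | h : sch ?f |- sch (fun x => ?f x) => exact: h
  | h : forall t, sch (?f t) |- sch (?f _) => exact: h
  | h : forall t, sch (?f t) |- sch (fun x => ?f _ x) => exact: h
  | |- sch (derive1 ?f) => apply: sch_d; sch_tac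
  | |- sch (fun x => derive1 ?f x) => apply: (@sch_d _ f); sch_tac
  | |- sch (fun x => @?f x + @?g x) => apply: (@schD _ f g); sch_tac
  | |- sch (fun x => - @?f x) => apply: (@schN _ f); sch_tac
  | |- sch (fun x => ?c * @?g x) => apply: (@schZ _ c g); sch_tac
  | |- sch (fun x => @?f x * ?c) => apply: (@schZr _ c f); sch_tac
  | |- sch (fun x => @?f x * @?g x) => apply: (@schM _ f g); sch_tac
  | |- sch (fun x => @?f x ^+ _) => apply: (@schX _ _ f); sch_tac
  | |- sch (fun=> 0) => exact: sch0
  end.

Ltac nice_schwartz ::= by apply: sch_nice; sch_tac.
Ltac dv_schwartz ::= eapply sch_dv; sch_tac.

(** * First order linear equations in the Schwartz class *)

Section LinearSchwartz.
Context {R : realType}.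
Implicit Types (f g : R -> R) (c k x : R).

Lemma rapid_wt_bound (s : R) j f : rapid f ->
  exists F, forall x, `|f x| <= F * wt (s * x) ^+ j.
Proof.
move=> rf; elim: j f rf => [|j IH] f rf.
  by have [C hC] := rapid_bounded rf; exists C => x; rewrite expr0 mulr1.
have rg : rapid (fun x => f x + s ^+ 2 * (x * (x * f x))).
  apply: rapidD => //; apply: (@rapidMb _ _ (fun=> s ^+ 2) `|s ^+ 2|) => //.
  exact/rapidX/rapidX.
have [F hF] := IH _ rg.
exists F => x; have := hF x.
have -> : f x + s ^+ 2 * (x * (x * f x)) = (1 + (s * x) ^+ 2) * f x by ring.
rewrite normrM gtr0_norm ?oneDsq_gt0// => h.
by rewrite exprSr mulrA {2}/wt ler_pdivlMr ?oneDsq_gt0// mulrC.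
Qed.

(** Weighted sup estimate with the weight [wt (s * x) ^+ j.+1 + eta]. The constant [eta > 0] makes a
    merely bounded [y] admissible; the constant of the resulting bound does not depend on [eta],
    which then tends to 0. *)
Lemma rapid_decay k (M : R) (b rho y f : R -> R) : 0 < k ->
  dv rho (fun x => b x ^+ 2) -> (forall x, 0 <= rho x) -> (forall x, rho x <= M) ->
  dv y (fun x => f x - (2 * k + b x) * y x) ->
  (exists B : R, forall x, `|y x| <= B) -> rapid f -> rapid y.
Proof.
move=> k0 drho r0 rM dy [B yB] rf [|j].
  by exists B => x; rewrite mul1r.
(* The logarithmic derivative of [wt (s * x) ^+ j.+1] is at most [j.+1 * s] in absolute value; this
   [s] makes it the [k / 2] that [linear_sup] allows. *)
pose s : R := k / (2 * j.+1%:R).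
have s0 : 0 < s by rewrite divr_gt0// mulr_gt0.
have ks : k / 2 = j.+1%:R * s.
  have j0 : j.+1%:R != 0 :> R by rewrite pnatr_eq0.
  by rewrite /s; move: (j.+1%:R) j0 => m m0; field.
have [F hF] := rapid_wt_bound s j.+1 rf.
have F0 : 0 <= F.
  by have := le_trans (normr_ge0 _) (hF 0); rewrite pmulr_lge0// exprn_gt0// wt_gt0.
have B0 : 0 <= B by exact: le_trans (normr_ge0 _) (yB 0).
have dw : dv (fun x => wt (s * x)) (fun x => - (2 * (s * x)) * wt (s * x) ^+ 2 * s).
  apply: dv_eq; first by apply: (@dv_comp _ wt (fun x => s * x)); [exact: dv_wt|dv_tac].
  by move=> x /=; ring.
pose w x := wt (s * x) ^+ j.+1.
have w0 x : 0 <= w x by rewrite exprn_ge0// wt_ge0.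
have dW (eta : R) : dv (fun x => w x + eta)
    (fun x => j.+1%:R * wt (s * x) ^+ j * (- (2 * (s * x)) * wt (s * x) ^+ 2 * s)).
  by rewrite /w; dv_compute; ring.
pose K : R := 2 * expR (M / k) * (F / k).
have K0 : 0 <= K by rewrite /K; nonneg_tac.
have W'le x : `|j.+1%:R * wt (s * x) ^+ j * (- (2 * (s * x)) * wt (s * x) ^+ 2 * s)|
    <= k / 2 * w x.
  have -> : j.+1%:R * wt (s * x) ^+ j * (- (2 * (s * x)) * wt (s * x) ^+ 2 * s) =
     (k / 2) * w x * - (2 * (s * x) * wt (s * x)).
    by rewrite ks /w (exprSr _ j); ring.
  rewrite normrM normrN ger0_norm; last by have := w0 x => ?; nonneg_tac.
  by rewrite ler_piMr ?wt_slow//; have := w0 x => ?; nonneg_tac.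
have hy (eta : R) x : 0 < eta -> `|y x| <= K * (w x + eta).
  move=> e0; apply: (linear_sup k0 drho r0 rM dy (dW eta)).
  - by move=> z; rewrite ltr_wpDl.
  - move=> z; apply: (le_trans (W'le z)); rewrite ler_wpM2l//; first by nonneg_tac.
    by rewrite lerDl ltW.
  - move=> z; apply: (le_trans (hF z)); rewrite ler_wpM2l// lerDl ltW//.
  - exists (B / eta) => z; apply: (le_trans (yB z)).
    rewrite mulrDr divfK ?lt0r_neq0// lerDr; have := w0 z => ?; nonneg_tac.
have hy0 x : `|y x| <= K * w x.
  apply/ler_addgt0Pr => e e0.
  have e1 : 0 < e / (K + 1) by rewrite divr_gt0// ltr_wpDl.
  apply: (le_trans (hy _ x e1)); rewrite mulrDr lerD2l.
  rewrite mulrA ler_pdivrMr ?ltr_wpDl// mulrC mulrDr mulr1 lerDl; exact: ltW.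
exists (K * (1 / (2 * s)) ^+ j.+1) => x.
rewrite normrM mulrC (le_trans (ler_wpM2r _ (hy0 x)))// -mulrA ler_wpM2l//.
rewrite normrX /w -exprMn lerXn2r ?nnegrE//; first by rewrite mulr_ge0// wt_ge0.
  by nonneg_tac.
rewrite ler_pdivlMr ?mulr_gt0//.
have := wt_slow (s * x); rewrite normrM [`|2 * _|]normrM [`|s * x|]normrM.
rewrite [`|2|]ger0_norm// [`|s|]gtr0_norm// [`|wt _|]ger0_norm ?wt_ge0//.
by apply: le_trans; rewrite le_eqVlt; apply/orP; left; apply/eqP; ring.
Qed.

Lemma linear_schwartz k b f : 0 < k -> sch b -> sch f ->
  exists y, sch y /\ dv y (fun x => f x - (2 * k + b x) * y x).
Proof.
move=> k0 sb sf.
have [|x|rho [drho r0 rM]] := @nice_antiderivative _ (fun x => b x ^+ 2).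
- by nice_tac.
- exact: sqr_ge0.
have [F hF] := rapid_bounded (sch_rapid sf).
have [y [dy yB]] := linear_bounded_solution k0 drho r0 rM (sch_cont sb) (sch_cont sf) hF.
exists y; split => //.
apply: (sch_bootstrap (dv_continuous dy) _ dy) => [|m sy].
  exact: (rapid_decay k0 drho r0 rM dy yB (sch_rapid sf)).
apply: smrD => //; apply: smrN.
rewrite (_ : (fun x => _) = (fun x => 2 * k * y x + b x * y x)); last first.
  by apply/funext => x; ring.
by apply: smrD; [exact: smrZ|exact: smrM].
Qed.

(** Reflection of the line turns the adjoint equation into the previous one. Its solutions serve as
    dual test functions and as Green functions. *)
Lemma linear_schwartz_back k b f : 0 < k -> sch b -> sch f ->
  exists y, sch y /\ dv y (fun x => (2 * k + b x) * y x - f x).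
Proof.
move=> k0 sb sf.
have [y [sy dy]] := linear_schwartz k0 (sch_opp sb) (sch_opp sf).
exists (fun x => y (- x)); split; first exact: sch_opp.
by apply: (dv_eq (dv_opp dy)) => x; rewrite opprK; ring.
Qed.

Lemma linear_unique_back k b (y y1 f : R -> R) : 0 < k -> sch b ->
  dv y (fun x => (2 * k + b x) * y x - f x) ->
  dv y1 (fun x => (2 * k + b x) * y1 x - f x) ->
  (exists B : R, forall x, `|y x| <= B) -> (exists B : R, forall x, `|y1 x| <= B) -> y =1 y1.
Proof.
move=> k0 sb dy dy1 [B hB] [B1 hB1] x.
have sb' := sch_opp sb.
have [|z|rho [drho r0 rM]] := @nice_antiderivative _ (fun x => b (- x) ^+ 2).
- by nice_tac.
- exact: sqr_ge0.
have h := @linear_unique _ k _ _ _ k0 drho r0 rM (fun x => y (- x)) (fun x => y1 (- x))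
  (fun x => f (- x)).
rewrite -[x]opprK; apply: h.
- by apply: (dv_eq (dv_opp dy)) => z; ring.
- by apply: (dv_eq (dv_opp dy1)) => z; ring.
- by exists B.
- by exists B1.
Qed.

End LinearSchwartz.

(** * The Riccati equation *)

Section Riccati.
Context {R : realType}.
Implicit Types (f g q u v phi : R -> R) (c k x e d : R).

Lemma cauchy_schwarz f g : nice f -> nice g ->
  I (fun x => f x * g x) ^+ 2 <= I (fun x => f x ^+ 2) * I (fun x => g x ^+ 2).
Proof.
move=> nf ng.
set a := I (fun x => f x ^+ 2); set b := I (fun x => f x * g x); set c := I (fun x => g x ^+ 2).
have c0 : 0 <= c by apply: I_ge0 => x; exact: sqr_ge0.
have a0 : 0 <= a by apply: I_ge0 => x; exact: sqr_ge0.
have h t : 0 <= a - 2 * t * b + t ^+ 2 * c.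
  have -> : a - 2 * t * b + t ^+ 2 * c = I (fun x => (f x - t * g x) ^+ 2).
    have -> : I (fun x => (f x - t * g x) ^+ 2) =
      I (fun x => f x ^+ 2 - 2 * t * (f x * g x) + t ^+ 2 * g x ^+ 2).
      by apply: eq_I => x; ring.
    rewrite ID; [|by nice_tac|by nice_tac]; rewrite IB; [|by nice_tac|by nice_tac].
    by rewrite !IZ//; nice_tac.
  by apply: I_ge0 => x; exact: sqr_ge0.
have [c00|c00] := eqVneq c 0.
  have [b0|b0] := eqVneq b 0; first by rewrite b0 expr0n mulr_ge0.
  have := h ((a + 1) / (2 * b)); rewrite c00 mulr0 addr0.
  have -> : 2 * ((a + 1) / (2 * b)) * b = a + 1 by field.
  by lra.
have := h (b / c).
have -> : a - 2 * (b / c) * b + (b / c) ^+ 2 * c = (a * c - b ^+ 2) / c by field.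
by rewrite pmulr_lge0 ?subr_ge0// invr_gt0 lt_def c00.
Qed.

Lemma sup_H1 phi phi' x : nice phi -> nice phi' -> dv phi phi' ->
  phi x ^+ 2 <= I (fun y => phi' y ^+ 2 + phi y ^+ 2).
Proof.
move=> nphi nphi' dphi.
have n2 : nice (fun y => phi' y ^+ 2 + phi y ^+ 2) by nice_tac.
have [A dA] := antiderivative (nice_cont n2).
have p0 y : 0 <= phi' y ^+ 2 + phi y ^+ 2 by rewrite addr_ge0 ?sqr_ge0.
have dB : dv (fun y => A y - phi y ^+ 2) (fun y => phi' y ^+ 2 + phi y ^+ 2 - 2 * phi y * phi' y).
  by dv_compute; ring.
apply/ler_addgt0Pr => e e0.
have np : nice (fun y => phi y ^+ 2) by nice_tac.
have [_ /cvgr0Pnorm_le/(_ e e0) hn] := nice_cvg0 np.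
have [n [hn1 hn2]] : exists n : nat, `|phi (- n%:R) ^+ 2| <= e /\ - n%:R <= x.
  have h2 := @nbhs_infty_ger R (- x).
  have : \forall n \near \oo, `|phi (- (n%:R : R)) ^+ 2| <= e /\ - n%:R <= x.
    near=> n; split; first by near: n.
    by rewrite lerNl; near: n.
  by case=> N _ /(_ N (leqnn N)) h; exists N.
have h1 := I_ge_osc x (- n%:R) dA n2 p0.
have := dv_le dB _ hn2 => h3.
have h4 : A (- n%:R) - phi (- n%:R) ^+ 2 <= A x - phi x ^+ 2.
  by apply: h3 => y _; have := sqr_ge0 (phi' y - phi y); lra.
by have := ler_norm (phi (- n%:R) ^+ 2); lra.
Unshelve. all: by end_near. Qed.

(** The intervals of radius [2 c 2^{-n}] about [a n] are nested, and the supremum of their left ends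
    lies in all of them. *)
Lemma geometric_limit (a : nat -> R) c :
  (forall n, `|a n.+1 - a n| <= c * (2^-1) ^+ n) ->
  exists l, forall n, `|a n - l| <= 2 * c * (2^-1) ^+ n.
Proof.
move=> h.
have c0 : 0 <= c by have := le_trans (normr_ge0 _) (h 0%N); rewrite expr0 mulr1.
pose s n : R := 2 * c * (2^-1) ^+ n.
have sS n : s n.+1 = s n / 2 by rewrite /s exprSr mulrA.
have ss n : s n / 2 = c * (2^-1) ^+ n by rewrite /s; field.
have s0 n : 0 <= s n by rewrite /s; nonneg_tac.
have lo n : a n - s n <= a n.+1 - s n.+1.
  by have := h n; rewrite ler_norml -ss sS => /andP[]; lra.
have up n : a n.+1 + s n.+1 <= a n + s n.
  by have := h n; rewrite ler_norml -ss sS => /andP[]; lra.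
have lom n m : a n - s n <= a (n + m)%N - s (n + m)%N.
  by elim: m => [|m IH]; rewrite ?addn0// addnS (le_trans IH).
have upm n m : a (n + m)%N + s (n + m)%N <= a n + s n.
  by elim: m => [|m IH]; rewrite ?addn0// addnS (le_trans _ IH).
have cross n m : a n - s n <= a m + s m.
  have := lom n m; have := upm m n; rewrite [(m + n)%N]addnC.
  by have := s0 (n + m)%N; lra.
pose S := [set a n - s n | n in [set: nat]].
have S0 : S !=set0 by exists (a 0%N - s 0%N); exists 0%N.
have uS : has_ubound S by exists (a 0%N + s 0%N) => _ [n _ <-].
exists (sup S) => n; rewrite -/(s n) ler_norml.
have h1 : a n - s n <= sup S by apply: (ub_le_sup uS); exists n.
have h2 : sup S <= a n + s n by apply: (sup_le_ub S0) => _ [m _ <-].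
by apply/andP; split; lra.
Qed.

(* The square of the norm of [q] in $H^{-1}$, taken with the weight
   $(\xi^2 + 4 k^2)^{-1}$, is at most [e]. *)
Definition Hsm k e q := forall phi, sch phi ->
  I (fun x => q x * phi x) ^+ 2 <=
  e * I (fun x => phi^`() x ^+ 2 + 4 * k ^+ 2 * phi x ^+ 2).

(* Equivalent to $-\partial^2 + q + k^2 = (\partial + u + k)(-\partial + u + k)$. *)
Definition Ric k q u := sch u /\ dv u (fun x => q x - 2 * k * u x - u x ^+ 2).

(** Duality: for the test function $z = (-\partial + 2k)^{-1} y$, both $\int q z$ and the squared
    norm of $z$ equal $\int y^2$, and the inequality of [Hsm] simplifies by this factor. *)
Lemma resolvent_L2 k e q (y : R -> R) : 0 < k -> 0 <= e -> sch q -> sch y ->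
  dv y (fun x => q x - 2 * k * y x) -> Hsm k e q -> I (fun x => y x ^+ 2) <= e.
Proof.
move=> k0 e0 sq sy dy hq.
have [z [sz dz]] := linear_schwartz_back k0 sch0 sy.
have h1 : I (fun x => y x ^+ 2) = I (fun x => q x * z x).
  apply: (I_dv_eq (F := fun x => - (y x * z x))); try nice_tac.
  by dv_compute; ring.
have h2 : I (fun x => z^`() x ^+ 2 + 4 * k ^+ 2 * z x ^+ 2) = I (fun x => y x ^+ 2).
  have -> : I (fun x => z^`() x ^+ 2 + 4 * k ^+ 2 * z x ^+ 2) =
     I (fun x => ((2 * k + 0) * z x - y x) ^+ 2 + 4 * k ^+ 2 * z x ^+ 2).
    by apply: eq_I => x; rewrite (dv_derive1 x dz).
  apply: (I_dv_eq (F := fun x => 2 * k * z x ^+ 2)); try nice_tac.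
  by dv_compute; ring.
have := hq z sz; rewrite h2 -h1.
set i := I _ => h.
have i0 : 0 <= i by apply: I_ge0 => x; exact: sqr_ge0.
have [->//|i1] := eqVneq i 0.
by move: h; rewrite expr2 ler_pM2r// lt_def i1.
Qed.

Lemma Hsm_le k k1 e q : 0 <= e -> 0 <= k -> k <= k1 -> Hsm k e q -> Hsm k1 e q.
Proof.
move=> e0 k0 kk1 h phi sphi; apply: (le_trans (h phi sphi)); rewrite ler_wpM2l//.
have s1 := sch_d sphi.
apply: I_le; try nice_tac; move=> x; rewrite lerD2l ler_wpM2r ?sqr_ge0//.
by rewrite ler_pM2l// lerXn2r// nnegrE (le_trans k0).
Qed.

Lemma HsmW k e e1 q : e <= e1 -> Hsm k e q -> Hsm k e1 q.
Proof.
move=> ee1 h phi sphi; apply: (le_trans (h phi sphi)).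
by rewrite ler_wpM2r//; apply: I_ge0 => x; nonneg_tac.
Qed.

(** With $q = u' + 2ku + u^2$, the linear part is handled by Cauchy-Schwarz, the weight being
    exactly $\int (2k\phi - \phi')^2$. The quadratic part costs [d] times the sup of [phi], and
    [d ^+ 2 <= d] since [d <= 1]. The factor 4 comes from $(A + B)^2 \le 2A^2 + 2B^2$. *)
Lemma Ric_Hsm k q u d : 1 <= k -> sch q -> Ric k q u -> I (fun x => u x ^+ 2) <= d ->
  d <= 1 -> Hsm k (4 * d) q.
Proof.
move=> k1 sq [su du] ud d1 phi sphi.
have s1 := sch_d sphi.
have d0 : 0 <= d by apply: le_trans ud; apply: I_ge0 => x; exact: sqr_ge0.
set H := I (fun x => phi^`() x ^+ 2 + 4 * k ^+ 2 * phi x ^+ 2).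
have h1 : I (fun x => q x * phi x) =
   I (fun x => u x * (2 * k * phi x - phi^`() x) + u x ^+ 2 * phi x).
  apply: (I_dv_eq (F := fun x => u x * phi x)); try nice_tac.
  by dv_compute; ring.
rewrite h1 ID; [|by nice_tac|by nice_tac].
set A := I _; set B := I _.
have hA : A ^+ 2 <= d * H.
  apply: (le_trans (cauchy_schwarz _ _)); [by nice_tac|by nice_tac|].
  have -> : I (fun x => (2 * k * phi x - phi^`() x) ^+ 2) = H.
    apply: (I_dv_eq (F := fun x => - (2 * k) * phi x ^+ 2)); try nice_tac.
    by dv_compute; ring.
  rewrite ler_wpM2r//; apply: I_ge0 => x; nonneg_tac.
have hs x : phi x ^+ 2 <= H.
  apply: (le_trans (sup_H1 x (sch_nice sphi) (sch_nice s1) (sch_dv sphi))).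
  apply: I_le; try nice_tac; move=> z; rewrite lerD2l ler_peMl ?sqr_ge0//.
  have : 1 <= k ^+ 2 by rewrite expr_ge1// (le_trans _ k1).
  by lra.
have H0 : 0 <= H by apply: I_ge0 => x; nonneg_tac.
have hB : B ^+ 2 <= d * H.
  have hb : `|B| <= d * Num.sqrt H.
    apply: (@le_trans _ _ (I (fun x => Num.sqrt H * u x ^+ 2))).
      apply: I_abs_le; try nice_tac; move=> x; rewrite normrM [`|u x ^+ 2|]ger0_norm ?sqr_ge0// mulrC.
      by rewrite ler_wpM2r ?sqr_ge0// -sqrtr_sqr ler_wsqrtr.
    by rewrite IZ; [|by nice_tac]; rewrite mulrC ler_wpM2r ?sqrtr_ge0.
  rewrite -real_normK ?num_real//; apply: (@le_trans _ _ ((d * Num.sqrt H) ^+ 2)).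
    by rewrite lerXn2r ?nnegrE// mulr_ge0 ?sqrtr_ge0.
  rewrite exprMn sqr_sqrtr// ler_wpM2r//.
  by rewrite expr2 ler_piMr.
have := sqr_ge0 (A - B); have -> : 4 * d * H = 2 * (d * H) + 2 * (d * H) by ring.
by lra.
Qed.

Lemma Ric_unique k q u v : 0 < k -> Ric k q u -> Ric k q v -> u =1 v.
Proof.
move=> k0 [su du] [sv dv'].
have [|x|rho [drho r0 rM]] := @nice_antiderivative _ (fun x => (u x + v x) ^+ 2).
- by nice_tac.
- exact: sqr_ge0.
(* Both [u] and [v] solve one and the same linear equation, with coefficient [u + v] and source
   [q + u v]. *)
apply: (linear_unique (f := fun x => q x + u x * v x) k0 drho r0 rM).
- by apply: (dv_eq du) => x; ring.
- by apply: (dv_eq dv') => x; ring.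
- exact: rapid_bounded (sch_rapid su).
- exact: rapid_bounded (sch_rapid sv).
Qed.

Lemma expR_le2 x : x <= 2^-1 -> expR x <= 2.
Proof.
move=> hx; have := expR_ge1Dx (- x); rewrite expRN => h.
have h1 : 2^-1 <= (expR x)^-1 by lra.
by rewrite -[2]invrK -[expR x]invrK lef_pV2 ?posrE ?invr_gt0 ?expR_gt0.
Qed.

Lemma const_weight (k : R) : 0 < k -> [/\ bddc (fun=> 1 : R), dv (fun=> 1) (fun=> 0 : R),
  (forall x : R, 0 <= 1 :> R) & (forall x : R, `|0 : R| <= k * 1)].
Proof.
by move=> k0; split => //; [exact: bddc_cst|exact: dv_cst|move=> _; rewrite normr0 mulr1 ltW].
Qed.

(** The contraction estimate of the Picard iteration. The factor is [2 / k <= 1 / 8], where 2 bounds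
    the exponential of $\int b_2^2 \le 1/2$. The sup bound turns contraction in L^2 into uniform
    convergence. *)
Lemma riccati_step k (b2 a y : R -> R) : 16 <= k -> sch b2 -> sch a -> sch y ->
  dv y (fun x => b2 x * a x - 2 * k * y x) -> I (fun x => b2 x ^+ 2) <= 2^-1 ->
  I (fun x => y x ^+ 2) <= I (fun x => a x ^+ 2) / 8 /\
  forall x, y x ^+ 2 <= 2 * I (fun x => a x ^+ 2).
Proof.
move=> k16 sb sa sy dy hb.
have k0 : 0 < k by lra.
have [b1 d1 p1 l1] := const_weight k0.
have nb := sch_nice sb; have na := sch_nice sa; have ny := sch_nice sy.
have dy' : dv y (fun x => (0 + b2 x) * a x - (2 * k + (fun=> 0) x) * y x).
  by apply: (dv_eq dy) => x; ring.
have h1 := linear_L2 k0 nice0 nb ny na b1 d1 p1 l1 dy'.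
have h2 := linear_L2_sup k0 nice0 nb ny na b1 d1 p1 l1 dy'.
have eM : expR (I (fun x => (fun=> 0 : R) x ^+ 2 / k + b2 x ^+ 2)) <= 2.
  apply: expR_le2; apply: le_trans hb.
  by rewrite le_eqVlt; apply/orP; left; apply/eqP/eq_I => x /=; rewrite expr0n mul0r add0r.
have ia0 : 0 <= I (fun x => a x ^+ 2) by apply: I_ge0 => x; exact: sqr_ge0.
have e1 (g : R -> R) : I (fun x => 1 * g x ^+ 2) = I (fun x => g x ^+ 2).
  by apply: eq_I => x; rewrite mul1r.
have hh : expR (I (fun x => (fun=> 0 : R) x ^+ 2 / k + b2 x ^+ 2)) * (0 ^+ 2 / k + 1) *
  I (fun x => 1 * a x ^+ 2) <= 2 * I (fun x => a x ^+ 2).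
  have -> : 0 ^+ 2 / k + 1 = 1 by rewrite expr0n mul0r add0r.
  by rewrite e1 mulr1 ler_wpM2r.
split; last by move=> x; have := h2 x; rewrite mul1r => h; exact: le_trans hh.
have h3 := le_trans h1 hh; rewrite e1 in h3.
have iy0 : 0 <= I (fun x => y x ^+ 2) by apply: I_ge0 => x; exact: sqr_ge0.
by clear p1 l1; have := ler_wpM2r iy0 k16; lra.
Qed.

Lemma I_sqrD f g : nice f -> nice g -> I (fun x => (f x + g x) ^+ 2) <=
  2 * I (fun x => f x ^+ 2) + 2 * I (fun x => g x ^+ 2).
Proof.
move=> nf ng; rewrite -!IZ; [|by nice_tac|by nice_tac]; rewrite -ID; [|by nice_tac|by nice_tac].
by apply: I_le; try nice_tac; move=> x; have := sqr_ge0 (f x - g x); lra.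
Qed.

Section RiccatiExistence.
Variables (k e : R) (q : R -> R).
Hypotheses (k16 : 16 <= k) (e0 : 0 <= e) (e64 : e <= 64^-1) (sq : sch q) (hq : Hsm k e q).

Let k0 : 0 < k. Proof. have := k16; lra. Qed.

Let ex_u : exists u : nat -> R -> R, [/\ u 0%N = (fun=> 0), forall n, sch (u n) &
  forall n, dv (u n.+1) (fun x => q x - u n x ^+ 2 - 2 * k * u n.+1 x)].
Proof.
have [L hL] : exists L : (R -> R) -> (R -> R), forall f, sch f ->
    sch (L f) /\ dv (L f) (fun x => f x - 2 * k * L f x).
  suff h f : exists y, sch f -> sch y /\ dv y (fun x => f x - 2 * k * y x).
    by have [L hL] := choice h; exists L.
  have [sf|nsf] := pselect (sch f); last by exists f.
  have [y [sy dy]] := linear_schwartz k0 sch0 sf; exists y => _; split => //.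
  by apply: (dv_eq dy) => x; rewrite addr0.
pose u n := iter n (fun u => L (fun x => q x - u x ^+ 2)) (fun=> 0).
have su n : sch (u n).
  elim: n => [|n IH] /=; first exact: sch0.
  by apply: (hL _ _).1; sch_tac.
exists u; split => // n.
have sqn : sch (fun x => q x - u n x ^+ 2) by have s := su n; sch_tac.
exact: (hL _ sqn).2.
Qed.

(** Picard iteration $u_{n+1}' + 2k u_{n+1} = q - u_n^2$ from 0. The part linear in $q$ has square
    integral at most [e] by duality and the quadratic correction at most [4 e / 8], so the bound
    [4 e] persists and the differences contract. The limit is obtained only uniformly; its
    differential equation and its decay are recovered afterwards. *)
Lemma riccati_exists : exists2 u, Ric k q u & I (fun x => u x ^+ 2) <= 4 * e.
Proof.
have [u [u0 su du]] := ex_u; have k0' := k0; have k16' := k16; have e0' := e0; have e64' := e64.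
have nq := sch_nice sq.
have Iu n : I (fun x => u n x ^+ 2) <= 4 * e.
  elim: n => [|n IH].
    rewrite u0 (_ : I _ = 0) ?mulr_ge0//.
    apply: (I_dv (F := fun=> 0)); [|by nice_tac|by nice_tac].
    by dv_compute; rewrite expr0n.
  have [y [sy dy0]] := linear_schwartz k0' sch0 sq.
  have {dy0}dy : dv y (fun x => q x - 2 * k * y x) by apply: (dv_eq dy0) => x; rewrite addr0.
  have hy := resolvent_L2 k0' e0' sq sy dy hq.
  have sn := su n; have sn1 := su n.+1.
  have dz : dv (fun x => u n.+1 x - y x) (fun x => - u n x * u n x - 2 * k * (u n.+1 x - y x)).
    by have d1 := du n; dv_compute; ring.
  have sm : sch (fun x => - u n x) by sch_tac.
  have sz : sch (fun x => u n.+1 x - y x) by sch_tac.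
  have hm : I (fun x => (- u n x) ^+ 2) <= 2^-1.
    rewrite (_ : I _ = I (fun x => u n x ^+ 2)); first by lra.
    by apply: eq_I => x; rewrite sqrrN.
  have [hz _] := riccati_step k16' sm sn sz dz hm.
  have := I_sqrD (sch_nice sy) (sch_nice sz).
  rewrite (_ : I _ = I (fun x => u n.+1 x ^+ 2)); first by lra.
  by apply: eq_I => x; congr (_ ^+ 2); ring.
pose dl n x := u n.+1 x - u n x.
have sdl n : sch (dl n) by have s1 := su n; have s2 := su n.+1; rewrite /dl; sch_tac.
have ddl n : dv (dl n.+1) (fun x => - (u n.+1 x + u n x) * dl n x - 2 * k * dl n.+1 x).
  by rewrite /dl; have d1 := du n; have d2 := du n.+1; dv_compute; ring.
have hdl n : I (fun x => dl n.+1 x ^+ 2) <= I (fun x => dl n x ^+ 2) / 8 /\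
    forall x, dl n.+1 x ^+ 2 <= 2 * I (fun x => dl n x ^+ 2).
  have sn := su n; have sn1 := su n.+1.
  apply: (riccati_step k16' _ (sdl n) (sdl n.+1) (ddl n)); first by sch_tac.
  rewrite (_ : I _ = I (fun x => (u n.+1 x + u n x) ^+ 2)); last first.
    by apply: eq_I => x; rewrite sqrrN.
  have := I_sqrD (sch_nice sn1) (sch_nice sn); have := Iu n; have := Iu n.+1; lra.
have Idl n : I (fun x => dl n x ^+ 2) <= (2^-1) ^+ (2 * n).
  elim: n => [|n IH].
    rewrite muln0 expr0 (_ : I _ = I (fun x => u 1%N x ^+ 2)).
      by have := Iu 1%N; lra.
    by apply: eq_I => x; rewrite /dl u0 subr0.
  have [h _] := hdl n; apply: (le_trans h).
  have : 0 <= I (fun x => dl n x ^+ 2) by apply: I_ge0 => x; exact: sqr_ge0.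
  by rewrite mulnS 2!exprS; move: (_ ^+ (2 * n)) IH => t; lra.
have sdlb n x : `|u n.+2 x - u n.+1 x| <= 2 * (2^-1) ^+ n.
  have [_ /(_ x) h] := hdl n.
  have h2 : `|dl n.+1 x| ^+ 2 <= (2 * 2^-1 ^+ n) ^+ 2.
    rewrite real_normK ?num_real// exprMn -exprM mulnC.
    have := Idl n; have : 0 <= (2^-1 : R) ^+ (2 * n) by rewrite exprn_ge0// invr_ge0.
    by lra.
  rewrite -/(dl n.+1 x) -ler_sqr ?nnegrE// mulr_ge0// exprn_ge0// invr_ge0//.
have [U hU] : exists U : R -> R, forall x n, `|u n.+1 x - U x| <= 2 * 2 * (2^-1) ^+ n.
  suff h x : exists l, forall n, `|u n.+1 x - l| <= 2 * 2 * (2^-1) ^+ n.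
    by have [U hU] := choice h; exists U.
  by apply: (@geometric_limit (fun n => u n.+1 x)) => n; exact: sdlb.
have p2 n : 0 < (2^-1 : R) ^+ n by rewrite exprn_gt0// invr_gt0.
have p21 n : (2^-1 : R) ^+ n <= 1.
  have h1 : (2^-1 : R) <= 1 by lra.
  have h0 : 0 <= (2^-1 : R) by lra.
  exact: exprn_ile1.
have small (a : R) : (forall n, a <= (2^-1) ^+ n) -> a <= 0.
  move=> ha; rewrite leNgt; apply/negP => a0.
  have [n hn] : exists n : nat, a^-1 < n%:R.
    by exists (Num.truncn `|a^-1|).+1; rewrite (le_lt_trans (ler_norm _))// truncnS_gt.
  have := ha n; rewrite exprVn leNgt => /negP; apply.
  rewrite -[a]invrK ltf_pV2 ?posrE ?invr_gt0// ?exprn_gt0//.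
  apply: (lt_le_trans hn); rewrite -natrX ler_nat; exact: ltnW (ltn_expl _ _).
have small2 (a C : R) : 0 <= C -> (forall n, a <= C * (2^-1) ^+ n) -> a <= 0.
  move=> C0 ha; suff h : a / (C + 1) <= 0.
    by move: h; rewrite pmulr_lle0// invr_gt0 ltr_wpDl.
  apply: small => n; rewrite ler_pdivrMr ?ltr_wpDl// (le_trans (ha n))//.
  by have := p2 n; lra.
have [B1 hB1] := rapid_bounded (sch_rapid (su 1%N)).
have [Bq hBq] := rapid_bounded (sch_rapid sq).
have B10 : 0 <= B1 := le_trans (normr_ge0 _) (hB1 0).
have Bq0 : 0 <= Bq := le_trans (normr_ge0 _) (hBq 0).
pose B := B1 + 8.
have UB x : `|U x| <= B.
  have := hU x 0%N; have := hB1 x; rewrite expr0 mulr1 -[in X in _ -> _ -> X](subrK (u 1%N x) (U x)).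
  move=> h1 h2; apply: (le_trans (ler_normD _ _)); rewrite distrC.
  by rewrite /B; lra.
have uB n x : `|u n.+1 x| <= B.
  have := hU x n; have := hU x 0%N; have := hB1 x; rewrite expr0 mulr1.
  rewrite -[in X in _ -> _ -> _ -> X](subrK (u 1%N x) (u n.+1 x)).
  move=> h1 h2 h3; apply: (le_trans (ler_normD _ _)).
  have := ler_distD (U x) (u n.+1 x) (u 1%N x); rewrite [`|U x - u 1%N x|]distrC.
  by have := p21 n; rewrite /B; lra.
have B0 : 0 <= B by rewrite /B; lra.
have cU : continuous U.
  pose M := Bq + B ^+ 2 + 2 * k * B.
  have M0 : 0 <= M by rewrite /M; nonneg_tac.
  have lip x y : `|U x - U y| <= M * `|x - y|.
    suff h : `|U x - U y| - M * `|x - y| <= 0 by lra.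
    apply: (@small2 _ 8) => // n.
    have h1 := hU x n.+1; have h2 := hU y n.+1; rewrite exprSr in h1 h2.
    have h3 : `|u n.+2 x - u n.+2 y| <= M * `|x - y|.
      apply: (@dv_lip _ _ _ y x M (du n.+1)) => z.
      rewrite (le_trans (ler_normB _ _))// lerD//; last first.
        rewrite !normrM ger0_norm// [`|k|]gtr0_norm//.
        by rewrite ler_wpM2l//; nonneg_tac.
      rewrite (le_trans (ler_normB _ _))// lerD// normrX lerXn2r ?nnegrE//.
    have := ler_distD (u n.+2 x) (U x) (U y); rewrite [`|U x - u n.+2 x|]distrC.
    have := ler_distD (u n.+2 y) (u n.+2 x) (U y).
    by have := p2 n; lra.
  move=> x; apply/cvgrPdist_le => d d0.
  near=> y; apply: (le_trans (lip _ _)).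
  have d1 : `|x - y| <= d / (M + 1).
    near: y; apply: cvgr_dist_le; first exact: cvg_id.
    by rewrite divr_gt0// ltr_wpDl.
  apply: (@le_trans _ _ ((M + 1) * `|x - y|)).
    by rewrite ler_wpM2r// lerDl.
  by rewrite mulrC -ler_pdivlMr// ltr_wpDl.
pose V x := q x - 2 * k * U x - U x ^+ 2.
have cV : continuous V.
  apply: contD; last by apply: contN; exact: contX.
  apply: contD; first exact: nice_cont.
  by apply: contN; apply: contM => //; exact: cont_cst.
have sqd n x : `|u n.+1 x ^+ 2 - U x ^+ 2| <= 8 * B * (2^-1) ^+ n.
  rewrite subr_sqr normrM.
  have h1 : `|u n.+1 x + U x| <= 2 * B.
    by apply: (le_trans (ler_normD _ _)); have := uB n x; have := UB x; lra.
  apply: (le_trans (ler_pM _ _ (hU x n) h1)) => //.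
  by rewrite le_eqVlt; apply/orP; left; apply/eqP; ring.
have dU : dv U V.
  (* [U - G] is compared with the iterates minus [G], whose derivatives tend to 0 uniformly; hence
     [U - G] is constant and [U] has derivative [V]. *)
  have [G dG] := antiderivative cV.
  pose K := 8 * B + 8 * k.
  have K0 : 0 <= K by rewrite /K; nonneg_tac.
  have der n x : `|(q x - u n.+1 x ^+ 2 - 2 * k * u n.+2 x) - V x| <= K * (2^-1) ^+ n.
    have -> : (q x - u n.+1 x ^+ 2 - 2 * k * u n.+2 x) - V x =
       - (u n.+1 x ^+ 2 - U x ^+ 2) - 2 * k * (u n.+2 x - U x) by rewrite /V; ring.
    have h2 : `|2 * k * (u n.+2 x - U x)| <= 8 * k * 2^-1 ^+ n.
      rewrite !normrM ger0_norm// [`|k|]gtr0_norm//.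
      have h := hU x n.+1; rewrite exprSr in h.
      have h1 : `|u n.+2 x - U x| <= 4 * 2^-1 ^+ n by have := p2 n; lra.
      have h2 : 0 <= 2 * k by nonneg_tac.
      by have := ler_wpM2l h2 h1; lra.
    apply: (le_trans (ler_normB _ _)); rewrite normrN.
    by have := sqd n x; rewrite /K; lra.
  have cst x y : U x - G x <= U y - G y.
    suff h : (U x - G x) - (U y - G y) <= 0 by lra.
    apply: (@small2 _ (8 + K * `|x - y|)) => [|n]; first by nonneg_tac.
    have dd : dv (fun z => u n.+2 z - G z) (fun z => (q z - u n.+1 z ^+ 2 - 2 * k * u n.+2 z) - V z).
      by have d1 := du n.+1; dv_compute; ring.
    have h1 := dv_lip y x dd (der n).
    have := hU x n.+1; have := hU y n.+1; rewrite exprSr.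
    move: h1; rewrite !ler_norml => /andP[h1 h2] /andP[h3 h4] /andP[h5 h6].
    by have := p2 n; rewrite mulrDl; lra.
  have e1 z : U z = G z + (U 0 - G 0).
    by have := cst z 0; have := cst 0 z; lra.
  apply: (dv_fun_eq (f := fun z => G z + (U 0 - G 0))); last by move=> z; rewrite -e1.
  by dv_compute; ring.
(* Integrability of [U ^+ 2] is not known yet. The bound [4 e] on the oscillation of its
   antiderivative passes to the limit on each bounded interval, and this is what [rapid_decay]
   requires. *)
have [P dP] := antiderivative (contX (n := 2) cU).
have oscP x y : y <= x -> P x - P y <= 4 * e.
  move=> yx; suff h : P x - P y - 4 * e <= 0 by lra.
  have xy0 : 0 <= x - y by lra.
  apply: (@small2 _ (8 * B * (x - y))) => [|n]; first by nonneg_tac.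
  have sn := su n.+1.
  have nn : nice (fun z => u n.+1 z ^+ 2) by nice_tac.
  have [Pn dPn] := antiderivative (nice_cont nn).
  have h1 := I_ge_osc x y dPn nn (fun z => sqr_ge0 _).
  have dd : dv (fun z => P z - Pn z) (fun z => U z ^+ 2 - u n.+1 z ^+ 2) by dv_compute; ring.
  have : `|P x - Pn x - (P y - Pn y)| <= 8 * B * 2^-1 ^+ n * `|x - y|.
    by apply: (@dv_lip _ _ _ y x _ dd) => z; rewrite distrC.
  rewrite [`|x - y|]ger0_norm// => /(le_trans (ler_norm _)).
  by have := Iu n.+1; lra.
pose S := [set P x | x in [set: R]].
have mono x y : x <= y -> P x <= P y by apply: (dv_le dP) => z _; exact: sqr_ge0.
have osc x y : P x - P y <= 4 * e.
  have [yx|xy] := leP y x; first exact: oscP.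
  by have := mono _ _ (ltW xy); lra.
have S0 : S !=set0 by exists (P 0); exists 0.
have lS : has_lbound S by exists (P 0 - 4 * e) => _ [x _ <-]; have := osc 0 x; lra.
have drho : dv (fun x => P x - inf S) (fun x => U x ^+ 2) by dv_compute; ring.
have r0 x : 0 <= P x - inf S by rewrite subr_ge0; apply: ge_inf => //; exists x.
have rM x : P x - inf S <= 4 * e.
  rewrite lerBlDl -lerBlDr; apply: lb_le_inf => // _ [y _ <-].
  by have := osc x y; lra.
have dUl : dv U (fun x => q x - (2 * k + U x) * U x).
  by apply: (dv_eq dU) => x; rewrite /V; ring.
have rU : rapid U.
  apply: (rapid_decay k0' drho r0 rM dUl _ (sch_rapid sq)).
  by exists B.
have sU : sch U.
  apply: (sch_bootstrap cU rU dU) => m sm.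
  apply: smrD; last by apply: smrN; apply: smrM.
  by apply: smrD => //; apply: smrN; exact: smrZ.
exists U; first by split.
by apply: (I_le_osc dP); [nice_tac|move=> x y; exact: oscP].
Unshelve. all: by end_near. Qed.

End RiccatiExistence.
End Riccati.

Ltac pos_tac := repeat first [ done | assumption | exact: expR_gt0 | exact: wt_gt0 | apply: mulr_gt0
  | rewrite invr_gt0 | apply: exprn_gt0 | (apply: ltr_wpDl; [nonneg_tac|]) ].

(** * Evolution under KdV *)

Section TimeDerivative.
Context {R : realType}.
Implicit Types (phi : R -> R) (c k x e d t : R).

Lemma dv_derive1E (f f' : R -> R) : dv f f' -> f^`() = f'.
Proof. by move=> df; apply/funext => x; exact: dv_derive1 df. Qed.

Lemma schwartz_sup_wt k (M F : R) (b y f : R -> R) : 2 <= k -> sch b -> sch y ->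
  I (fun x => b x ^+ 2) <= M ->
  dv y (fun x => f x - (2 * k + b x) * y x) -> (forall x, `|f x| <= F * wt x) ->
  forall x, `|y x| <= 2 * expR (M / k) / k * F * wt x.
Proof.
move=> k2 sb sy bM dy fF x.
have k0 : 0 < k by lra.
have [|z|rho [drho r0 rM]] := @nice_antiderivative _ (fun x => b x ^+ 2).
- by nice_tac.
- exact: sqr_ge0.
have rM' z : rho z <= M by exact: le_trans bM.
have [_ [B hB]] := sch_nice sy.
have := @linear_sup _ k M b rho k0 drho r0 rM' y f wt _ F dy dv_wt wt_gt0.
have -> : 2 * expR (M / k) / k * F = 2 * expR (M / k) * (F / k) by ring.
apply => //; last by exists B.
move=> z; have -> : - (2 * z) * wt z ^+ 2 = - (2 * z * wt z * wt z) by ring.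
rewrite normrN normrM [`|wt z|]ger0_norm ?wt_ge0// ler_wpM2r ?wt_ge0//.
by have := wt_slow z; lra.
Qed.

Lemma linear_sup_back k (M F : R) (b y f : R -> R) : 0 < k -> sch b ->
  (exists B : R, forall x, `|y x| <= B) ->
  I (fun x => b x ^+ 2) <= M ->
  dv y (fun x => (2 * k + b x) * y x - f x) -> (forall x, `|f x| <= F) ->
  forall x, `|y x| <= 2 * expR (M / k) / k * F.
Proof.
move=> k0 sb [B hB] bM dy fF x.
have sb' := sch_opp sb.
have [|z|rho [drho r0 rM]] := @nice_antiderivative _ (fun x => b x ^+ 2).
- by nice_tac.
- exact: sqr_ge0.
(* Reflection makes the antiderivative decreasing; its difference from the total mass is again an
   antiderivative with values between 0 and that mass. *)
have drho' : dv (fun x => I (fun x => b x ^+ 2) - rho (- x)) (fun x => b (- x) ^+ 2).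
  by apply: dv_eq; [apply: (dvD (dv_cst _) (dvN (dv_opp drho)))|move=> z /=; ring].
have dy' : dv (fun x => y (- x)) (fun x => f (- x) - (2 * k + b (- x)) * y (- x)).
  by apply: (dv_eq (dv_opp dy)) => z; ring.
have := @linear_sup _ k M _ _ k0 drho' _ _ _ _ (fun=> 1) (fun=> 0) F dy' (dv_cst 1).
have -> : 2 * expR (M / k) * (F / k) * 1 = 2 * expR (M / k) / k * F by ring.
move=> h; rewrite -[x]opprK; apply: h => //.
- by move=> z; rewrite subr_ge0.
- by move=> z; have := r0 (- z); lra.
- by move=> z; rewrite normr0 mulr1; nonneg_tac.
- by move=> z; rewrite mulr1.
- by exists B => z; rewrite mulr1.
Qed.

Lemma is_derive_eps (F : R -> R) t l :
  (forall e, 0 < e -> exists2 eta : R, 0 < eta & forall h, 0 < `|h| < eta ->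
    `|(F (t + h) - F t) / h - l| <= e) -> is_derive t (1 : R) F l.
Proof.
move=> H.
have cv : (fun h : R => h^-1 *: (F (h *: (1 : R) + t) - F t)) @ 0^' --> l.
  apply/cvgrPdist_le => e e0; have [eta eta0 h] := H e e0.
  near=> y.
  have y0 : y != 0 by near: y; exact: nbhs_dnbhs_neq.
  have ye : `|y| < eta.
    by near: y; apply: dnbhs0_lt.
  have := h y; rewrite normr_gt0 y0 ye => /(_ isT).
  by rewrite distrC /GRing.scale /= mulr1 [y + t]addrC [y^-1 * _]mulrC.
apply: DeriveDef; first by apply/cvg_ex; exists l.
exact/cvg_lim.
Unshelve. all: by end_near. Qed.

(** Differentiability in time for the norm [sup |f| / wt]. It suffices to differentiate integrals
    and is stable under squares and under solving the Riccati equation, without control of space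
    derivatives at each of these steps. *)
Definition tdiff (q : R -> R -> R) (qd : R -> R) t :=
  forall e, 0 < e -> exists2 eta : R, 0 < eta & forall h, 0 < `|h| < eta ->
    forall x, `|(q (t + h) x - q t x) / h - qd x| <= e * wt x.

Lemma tdiffD f g fd gd t : tdiff f fd t -> tdiff g gd t ->
  tdiff (fun s x => f s x + g s x) (fun x => fd x + gd x) t.
Proof.
move=> hf hg e e0; have e2 : 0 < e / 2 by lra.
have [a a0 ha] := hf _ e2; have [b b0 hb] := hg _ e2.
exists (Num.min a b); first by rewrite lt_min a0.
move=> h /andP[h0]; rewrite lt_min => /andP[h1 h2] x.
have -> : (f (t + h) x + g (t + h) x - (f t x + g t x)) / h - (fd x + gd x) =
  ((f (t + h) x - f t x) / h - fd x) + ((g (t + h) x - g t x) / h - gd x) by ring.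
have := ha h; rewrite h0 h1 => /(_ isT x) h3.
have := hb h; rewrite h0 h2 => /(_ isT x) h4.
by rewrite (le_trans (ler_normD _ _))//; lra.
Qed.

Lemma tdiffM g f fd (C : R) t : (forall x, `|g x| <= C) -> tdiff f fd t ->
  tdiff (fun s x => g x * f s x) (fun x => g x * fd x) t.
Proof.
move=> gC hf e e0.
have C0 : 0 <= C := le_trans (normr_ge0 _) (gC 0).
have e2 : 0 < e / (C + 1) by rewrite divr_gt0// ltr_wpDl.
have [a a0 ha] := hf _ e2.
exists a => // h h1 x.
have -> : (g x * f (t + h) x - g x * f t x) / h - g x * fd x =
   g x * ((f (t + h) x - f t x) / h - fd x) by ring.
rewrite normrM.
apply: (@le_trans _ _ (C * (e / (C + 1) * wt x))).
  by rewrite ler_pM//; exact: ha.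
rewrite mulrA ler_wpM2r ?wt_ge0// mulrCA ler_piMr//; first exact: ltW.
by rewrite ler_pdivrMr ?ltr_wpDl// mul1r lerDl.
Qed.

Lemma tdiff_bound f fd t : nice fd -> tdiff f fd t ->
  exists C : R, 0 < C /\ exists2 eta : R, 0 < eta & forall h, 0 < `|h| < eta ->
    forall x, `|(f (t + h) x - f t x) / h| <= C * wt x.
Proof.
move=> [_ [C hC]] hf; have [a a0 ha] := hf 1 ltr01.
exists (`|C| + 1); split; first by rewrite ltr_wpDl.
exists a => // h h1 x.
have h2 := ha h h1 x; have h3 := hC x.
have h4 := ler_wpM2r (wt_ge0 x) (ler_norm C).
have := ler_normD ((f (t + h) x - f t x) / h - fd x) (fd x); rewrite subrK; lra.
Qed.

Lemma wt_sq_le x : wt x ^+ 2 <= wt x.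
Proof. by rewrite expr2 ler_piMl ?wt_ge0// wt_le1. Qed.

Lemma tdiff_sqr f fd t : bddc (f t) -> nice fd -> tdiff f fd t ->
  tdiff (fun s x => f s x ^+ 2) (fun x => 2 * f t x * fd x) t.
Proof.
move=> [_ [B hB]] nfd hf e e0.
have B0 : 0 <= B := le_trans (normr_ge0 _) (hB 0).
have [C [C0 [b b0 hb]]] := tdiff_bound nfd hf.
have e2 : 0 < e / (4 * (B + 1)) by rewrite divr_gt0// mulr_gt0// ltr_wpDl.
have [a a0 ha] := hf _ e2.
have c0 : 0 < e / (2 * C ^+ 2) by pos_tac.
exists (Num.min a (Num.min b (e / (2 * C ^+ 2)))); first by rewrite !lt_min a0 b0 c0.
move=> h /andP[h0]; rewrite !lt_min => /and3P[h1 h2 h3] x.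
have hn0 : h != 0 by rewrite -normr_gt0.
set D := (f (t + h) x - f t x) / h.
have -> : (f (t + h) x ^+ 2 - f t x ^+ 2) / h - 2 * f t x * fd x =
    2 * f t x * (D - fd x) + h * D ^+ 2 by rewrite /D; field.
have hD : `|D| <= C * wt x by apply: hb; rewrite h0 h2.
have hE : `|D - fd x| <= e / (4 * (B + 1)) * wt x by apply: ha; rewrite h0 h1.
have k1 : `|2 * f t x * (D - fd x)| <= e / 2 * wt x.
  rewrite normrM normrM ger0_norm//.
  apply: (@le_trans _ _ (2 * (B + 1) * (e / (4 * (B + 1)) * wt x))).
    apply: ler_pM; [by nonneg_tac|by []| |exact: hE].
    by rewrite ler_wpM2l// (le_trans (hB x))// lerDl.
  rewrite le_eqVlt; apply/orP; left; apply/eqP; field.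
  by apply: lt0r_neq0; rewrite ltr_wpDl.
have k2 : `|h * D ^+ 2| <= e / 2 * wt x.
  rewrite normrM normrX.
  apply: (@le_trans _ _ (e / (2 * C ^+ 2) * (C ^+ 2 * wt x))).
    apply: ler_pM; [by []|by nonneg_tac|exact: ltW|].
    apply: (@le_trans _ _ ((C * wt x) ^+ 2)).
      by rewrite lerXn2r ?nnegrE// mulr_ge0 ?wt_ge0// ltW.
    by rewrite exprMn ler_wpM2l ?sqr_ge0// wt_sq_le.
  by rewrite le_eqVlt; apply/orP; left; apply/eqP; field; exact: lt0r_neq0.
by rewrite (le_trans (ler_normD _ _))//; lra.
Qed.

Lemma I_wt_le (f : R -> R) (C : R) : nice f -> (forall x, `|f x| <= C * wt x) ->
  `|I f| <= C * pi.
Proof.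
move=> nf hf; rewrite (le_trans (I_abs nf))//.
have [|_ h] := @I_wt_shift _ f C 0 (nice_cont nf) _.
  by move=> x; rewrite subr0.
exact: h.
Qed.

Lemma I_tdiff f fd phi t : (forall s, nice (f s)) -> nice fd -> bddc phi -> tdiff f fd t ->
  is_derive t (1 : R) (fun s => I (fun x => f s x * phi x)) (I (fun x => fd x * phi x)).
Proof.
move=> nf nfd bphi hf; apply: is_derive_eps => e e0.
have [_ [B hB]] := bphi.
have B0 : 0 <= B := le_trans (normr_ge0 _) (hB 0).
have p0 := pi_gt0 R.
have e2 : 0 < e / (B + 1) / pi by rewrite !divr_gt0// ltr_wpDl.
have [a a0 ha] := hf _ e2.
exists a => // h h1.
have n1 := nf (t + h); have n2 := nf t.
have -> : (I (fun x => f (t + h) x * phi x) - I (fun x => f t x * phi x)) / h -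
   I (fun x => fd x * phi x) = I (fun x => ((f (t + h) x - f t x) / h - fd x) * phi x).
  rewrite -IB; [|by nice_tac|by nice_tac]; rewrite mulrC -IZ; last by nice_tac.
  rewrite -IB; [|by nice_tac|by nice_tac].
  by apply: eq_I => x; ring.
have -> : e = (e / (B + 1) / pi) * (B + 1) * pi.
  have B1 : B + 1 != 0 by rewrite lt0r_neq0// ltr_wpDl.
  have p1 : pi != 0 :> R by exact: lt0r_neq0.
  by rewrite mulrAC divfK// divfK.
apply: I_wt_le; first by nice_tac.
move=> x; rewrite normrM mulrAC; apply: ler_pM; [by []|by []|exact: ha|].
by rewrite (le_trans (hB x))// lerDl.
Qed.

(** The difference quotient [D] of [u] solves a linear equation with coefficient [u (t + h) + u t]
    and source the difference quotient [Q] of [q], which first gives [D = O(wt)]. Then [D - z]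
    solves the linearised equation with the small source [Q - qd - h D^2]. *)
Lemma Ric_tdiff k (q u : R -> R -> R) (qd z : R -> R) t (eta0 : R) : 2 <= k -> 0 < eta0 ->
  (forall s, `|s - t| < eta0 -> Ric k (q s) (u s) /\ I (fun x => u s x ^+ 2) <= 1) ->
  nice qd -> tdiff q qd t -> sch z -> dv z (fun x => qd x - (2 * k + 2 * u t x) * z x) ->
  tdiff u z t.
Proof.
move=> k2 eta00 hR nqd hq sz dz e e0.
have k0 : 0 < k by lra.
pose K : R := 2 * expR (4 / k) / k.
have K0 : 0 < K by rewrite /K; pos_tac.
have [C [C0 [b b0 hb]]] := tdiff_bound nqd hq.
pose K1 := K * C.
have K10 : 0 < K1 by rewrite mulr_gt0.
have e2 : 0 < e / (2 * K) by rewrite divr_gt0// mulr_gt0.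
have [a a0 ha] := hq _ e2.
have c0 : 0 < e / (2 * K * K1 ^+ 2) by pos_tac.
exists (Num.min eta0 (Num.min a (Num.min b (e / (2 * K * K1 ^+ 2))))).
  by rewrite !lt_min eta00 a0 b0 c0.
move=> h /andP[h0]; rewrite !lt_min => /and4P[h1 h2 h3 h4] x.
have hn0 : h != 0 by rewrite -normr_gt0.
have [|[su du] Iu] := hR t; first by rewrite subrr normr0.
have [|[su1 du1] Iu1] := hR (t + h); first by rewrite [t + h]addrC addrK.
pose D x := (u (t + h) x - u t x) / h.
pose Q x := (q (t + h) x - q t x) / h.
have sD : sch D by rewrite /D; sch_tac.
have dD : dv D (fun x => Q x - (2 * k + (u (t + h) x + u t x)) * D x).
  by rewrite /D /Q; dv_compute; field.
have sb1 : sch (fun x => u (t + h) x + u t x) by sch_tac.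
have sb2 : sch (fun x => 2 * u t x) by sch_tac.
have Ib1 : I (fun x => (u (t + h) x + u t x) ^+ 2) <= 4.
  by have := I_sqrD (sch_nice su1) (sch_nice su); lra.
have Ib2 : I (fun x => (2 * u t x) ^+ 2) <= 4.
  rewrite (_ : I _ = I (fun x => 4 * u t x ^+ 2)); last by apply: eq_I => y; ring.
  by rewrite IZ; [lra|nice_tac].
have hD y : `|D y| <= K1 * wt y.
  by apply: (schwartz_sup_wt k2 sb1 sD Ib1 dD) => w; apply: hb; rewrite h0 h3.
have dE : dv (fun x => D x - z x)
   (fun x => (Q x - qd x - h * D x ^+ 2) - (2 * k + 2 * u t x) * (D x - z x)).
  apply: (dv_eq (dvD dD (dvN dz))) => y /=.
  have -> : u (t + h) y = u t y + h * D y by rewrite /D; field.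
  by ring.
have sE : sch (fun x => D x - z x) by sch_tac.
have := schwartz_sup_wt k2 sb2 sE Ib2 dE.
move=> /(_ (e / (2 * K) + e / (2 * K * K1 ^+ 2) * K1 ^+ 2)) hE.
have -> : e = 2 * expR (4 / k) / k * (e / (2 * K) + e / (2 * K * K1 ^+ 2) * K1 ^+ 2).
  have n1 : K != 0 by exact: lt0r_neq0.
  have n2 : K1 != 0 by exact: lt0r_neq0.
  by rewrite -/K; field; rewrite ?n1 ?n2.
apply: hE => y.
apply: (le_trans (ler_normB _ _)); rewrite mulrDl lerD//.
  by apply: ha; rewrite h0 h2.
rewrite normrM normrX -mulrA; apply: ler_pM; [by []|by nonneg_tac|exact: ltW|].
apply: (@le_trans _ _ ((K1 * wt y) ^+ 2)).
  by rewrite lerXn2r ?nnegrE// mulr_ge0 ?wt_ge0// ltW.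
by rewrite exprMn ler_wpM2l ?sqr_ge0// wt_sq_le.
Qed.

Lemma kdv_rhsE (f : R -> R) x :
  kdv_rhs f x = - f^`()^`()^`() x + 6 * f x * f^`() x.
Proof. by rewrite /kdv_rhs !derive1nS. Qed.

(* The time derivative of [u] when [q] solves KdV (Gardner's equation). *)
Definition gardner k (q u : R -> R) : R -> R := fun x =>
  - q^`()^`() x + 2 * (q x - 2 * k * u x - u x ^+ 2) * q x + 2 * (u x + k) * q^`() x
  - 4 * k ^+ 2 * (q x - 2 * k * u x - u x ^+ 2).

Lemma sch_gardner k (q u : R -> R) : sch q -> Ric k q u -> sch (gardner k q u).
Proof.
move=> sq [su du]; rewrite /gardner.
rewrite (_ : (fun x => _) = fun x => - q^`()^`() x + 2 * (q x - 2 * k * u x - u x ^+ 2) * q x +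
  (2 * u x * q^`() x + 2 * k * q^`() x) - 4 * k ^+ 2 * (q x - 2 * k * u x - u x ^+ 2)).
  by sch_tac.
by apply/funext => x; ring.
Qed.

Lemma dv_gardner k (q u : R -> R) : sch q -> Ric k q u ->
  dv (gardner k q u) (fun x => kdv_rhs q x - (2 * k + 2 * u x) * gardner k q u x).
Proof.
move=> sq [su du]; have s1 := sch_d sq; have s2 := sch_d s1.
rewrite /gardner; eapply dv_eq; [dv_tac|move=> x /=]; rewrite kdv_rhsE.
by move: (q^`()^`()^`() x) (q^`()^`() x) (q^`() x) (q x) (u x) => *; ring.
Qed.

(** The Riccati equation turns [gardner] into $-u''' + 12k u u' + 6u^2 u'$, and $2u$ times this is
    the derivative of the [F] given below. This is the infinitesimal form of the conservation of
    $\int u_k^2$ by KdV. *)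
Lemma I_gardner k (q u : R -> R) : sch q -> Ric k q u ->
  I (fun x => 2 * u x * gardner k q u x) = 0.
Proof.
move=> sq rq; have sg := sch_gardner sq rq; have [su du] := rq.
have s1 := sch_d sq.
pose U1 x := q x - 2 * k * u x - u x ^+ 2.
have sU : sch U1 by rewrite /U1; sch_tac.
have dU : dv U1 (fun x => q^`() x - 2 * k * U1 x - 2 * u x * U1 x).
  by rewrite /U1; dv_compute; ring.
apply: (I_dv (F := fun x => 2 * (- u x * (q^`() x - 2 * k * U1 x - 2 * u x * U1 x) +
   U1 x ^+ 2 / 2 + 4 * k * u x ^+ 3 + 3 / 2 * u x ^+ 4))); [|by nice_tac|by nice_tac].
have du' : dv u U1 by exact: du.
have s2 := sch_d s1.
by dv_compute; rewrite /gardner -/(U1 _) /U1; field.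
Qed.

(** Connectedness of the line: the indicator function of a locally constant property has derivative
    0. *)
Lemma locally_constant_prop (P : R -> Prop) :
  (forall t, exists2 eta : R, 0 < eta & forall s, `|s - t| < eta -> (P s <-> P t)) ->
  P 0 -> forall t, P t.
Proof.
move=> H P0 t; pose f s : R := if `[< P s >] then 1 else 0.
have df : dv f (fun=> 0).
  move=> s; apply: is_derive_eps => e e0; have [eta eta0 h] := H s.
  exists eta => // y /andP[_ ye]; rewrite (_ : f (s + y) = f s).
    by rewrite !subrr mul0r subr0 normr0 ltW.
  rewrite /f; congr (if _ then _ else _); apply: asbool_equiv_eq.
  by apply: h; rewrite [s + y]addrC addrK.
have := dv_zero_cst t 0 df; rewrite /f (asboolT P0).
by case: asboolP => // _ /eqP; rewrite eq_sym oner_eq0.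
Qed.

Definition kdvsol (q : R -> R -> R) :=
  (forall t, sch (q t)) /\ forall t, tdiff q (kdv_rhs (q t)) t.

Lemma sch_kdv_rhs (q : R -> R) : sch q -> sch (kdv_rhs q).
Proof.
move=> sq; rewrite (_ : kdv_rhs q = fun x => - q^`()^`()^`() x + 6 * q x * q^`() x).
  by sch_tac.
by apply/funext => x; exact: kdv_rhsE.
Qed.

(** The increment in time is [O(|s - t| wt)], hence small in L^2, which for [k >= 16] controls its
    contribution to [Hsm]. Two contributions of [256^-1] give [4 / 256 = 64^-1], the threshold of
    [riccati_exists]. *)
Lemma Hsm_near k e (q : R -> R -> R) t : 16 <= k -> kdvsol q -> 0 <= e -> e <= 256^-1 ->
  Hsm k e (q t) -> exists2 eta : R, 0 < eta & forall s, `|s - t| < eta -> Hsm k 64^-1 (q s).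
Proof.
move=> k16 [sq hq] e0 e256 hs.
have k0 : 0 < k by lra.
have [C [C0 [b b0 hb]]] := tdiff_bound (sch_nice (sch_kdv_rhs (sq t))) (hq t).
have p0 := pi_gt0 R.
pose y : R := C ^+ 2 * pi + 1.
have y0 : 0 < y by rewrite /y ltr_wpDl//; nonneg_tac; exact: ltW.
have y1 : 0 < Num.min 1 (1 / y) by rewrite lt_min ltr01 divr_gt0.
exists (Num.min b (Num.min 1 (1 / y))); first by rewrite lt_min b0.
move=> s; rewrite !lt_min => /and3P[sb s1 sy] phi sphi.
have sphi1 := sch_d sphi.
have ss := sq s; have st := sq t.
set H := I (fun x => phi^`() x ^+ 2 + 4 * k ^+ 2 * phi x ^+ 2).
have H0 : 0 <= H by apply: I_ge0 => x; nonneg_tac.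
have h1 : I (fun x => q t x * phi x) ^+ 2 <= e * H by exact: hs.
have h2 : I (fun x => (q s x - q t x) * phi x) ^+ 2 <= 256^-1 * H.
  have [->|sne] := eqVneq s t.
    rewrite (_ : I _ = 0) ?expr0n ?mulr_ge0//.
    apply: (I_dv (F := fun=> 0)); [|by nice_tac|by nice_tac].
    by dv_compute; ring.
  have hd x : `|q s x - q t x| <= `|s - t| * (C * wt x).
    have st0 : 0 < `|s - t| by rewrite normr_gt0 subr_eq0.
    have := hb (s - t); rewrite st0 sb => /(_ isT x).
    rewrite [t + _]addrC subrK normrM normfV.
    by rewrite ler_pdivrMr// mulrC.
  apply: (le_trans (cauchy_schwarz _ _)); [by nice_tac|by nice_tac|].
  have i1 : I (fun x => (q s x - q t x) ^+ 2) <= `|s - t| ^+ 2 * C ^+ 2 * pi.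
    apply: (le_trans (ler_norm _)); apply: I_wt_le; first by nice_tac.
    move=> x; rewrite normrX.
    apply: (@le_trans _ _ ((`|s - t| * (C * wt x)) ^+ 2)).
      rewrite lerXn2r ?nnegrE//; have := wt_ge0 x => ?; nonneg_tac.
    rewrite !exprMn mulrA ler_wpM2l; first by [].
      by nonneg_tac.
    exact: wt_sq_le.
  have i2 : I (fun x => phi x ^+ 2) <= 1024^-1 * H.
    rewrite -IZ; last by nice_tac.
    apply: I_le; try nice_tac; move=> x.
    have : 256 <= k ^+ 2.
      by have : (16 : R) * 16 <= k * k; [rewrite ler_pM//; lra | rewrite expr2; lra].
    move=> /(ler_wpM2r (sqr_ge0 (phi x))); have := sqr_ge0 (phi^`() x); lra.
  have i0 : 0 <= I (fun x => phi x ^+ 2) by apply: I_ge0 => x; exact: sqr_ge0.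
  have i3 : `|s - t| ^+ 2 * C ^+ 2 * pi <= 1.
    have : `|s - t| ^+ 2 <= `|s - t| by rewrite expr2 ler_piMl// ltW.
    have : `|s - t| * y <= 1 by rewrite -ler_pdivlMr// ltW.
    rewrite /y => h3 h4; rewrite -mulrA.
    apply: (@le_trans _ _ (`|s - t| * (C ^+ 2 * pi))).
      by rewrite ler_wpM2r//; nonneg_tac; exact: ltW.
    by move: h3; rewrite mulrDr mulr1; have := normr_ge0 (s - t); lra.
  have := ler_pM (I_ge0 (fun x => sqr_ge0 _)) i0 (le_trans i1 i3) i2.
  by lra.
have -> : I (fun x => q s x * phi x) = I (fun x => q t x * phi x) +
    I (fun x => (q s x - q t x) * phi x).
  by rewrite -ID; [|by nice_tac|by nice_tac]; apply: eq_I => x; ring.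
set A := I (fun x => q t x * phi x) in h1 *; set B := I _ in h2 *.
have := sqr_ge0 (A - B).
have := ler_wpM2r H0 e256.
by lra.
Qed.

Lemma Ric_near k e (q : R -> R -> R) t : 16 <= k -> kdvsol q -> 0 <= e -> e <= 256^-1 ->
  Hsm k e (q t) -> exists (u : R -> R -> R) (eta : R), [/\ 0 < eta,
    forall s, `|s - t| < eta -> Ric k (q s) (u s) /\ I (fun x => u s x ^+ 2) <= 1 &
    forall s, `|s - t| < eta -> I (fun x => u s x ^+ 2) = I (fun x => u t x ^+ 2)].
Proof.
move=> k16 hq e0 e256 hs.
have [eta eta0 hn] := Hsm_near k16 hq e0 e256 hs.
have [sq tq] := hq.
have [u hu] : exists u : R -> R -> R, forall s, `|s - t| < eta ->
   Ric k (q s) (u s) /\ I (fun x => u s x ^+ 2) <= 1.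
  suff h s : exists v, `|s - t| < eta -> Ric k (q s) v /\ I (fun x => v x ^+ 2) <= 1.
    by have [u hu] := choice h; exists u.
  have [st|st] := ltP `|s - t| eta; last by exists (fun=> 0).
  have h0 : (0 : R) <= 64^-1 by lra.
  have [v rv Iv] := riccati_exists k16 h0 (lexx _) (sq s) (hn s st).
  by exists v => _; split => //; lra.
exists u, eta; split => // s st.
(* Extension by 0 outside the time interval where the Riccati solution is known, since [I_tdiff]
   asks for niceness at all times. *)
pose v s := if `|s - t| < eta then u s else (fun=> 0).
have sv r : sch (v r).
  by rewrite /v; case: ifPn => [h|_]; [have [[]] := hu r h|exact: sch0].
have dN r : `|r - t| < eta -> is_derive r (1 : R) (fun s => I (fun x => v s x ^+ 2)) 0.
  move=> rt; pose eta1 := eta - `|r - t|.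
  have eta10 : 0 < eta1 by rewrite subr_gt0.
  have near r1 : `|r1 - r| < eta1 -> `|r1 - t| < eta.
    by move=> h; have := ler_distD r r1 t; rewrite /eta1 in h; lra.
  have vu r1 : `|r1 - r| < eta1 -> v r1 = u r1.
    by move=> /near; rewrite /v => ->.
  have vr : v r = u r by apply: vu; rewrite subrr normr0.
  have [rr Ir] := hu r rt.
  have td : tdiff v (gardner k (q r) (v r)) r.
    apply: (@Ric_tdiff k q v (kdv_rhs (q r)) _ r eta1 _ eta10 _ _ (tq r)).
    - by lra.
    - by move=> r1 h; rewrite vu//; apply: hu; exact: near.
    - exact/sch_nice/sch_kdv_rhs.
    - by apply: sch_gardner => //; rewrite vr.
    - by apply: dv_gardner => //; rewrite vr.
  have nv s1 : nice (fun x => v s1 x ^+ 2) by have svs := sv s1; nice_tac.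
  have svr := sv r.
  have sg : sch (gardner k (q r) (v r)) by apply: sch_gardner => //; rewrite vr.
  have ng : nice (fun x => 2 * v r x * gardner k (q r) (v r) x) by nice_tac.
  have b1 : bddc (fun=> 1 : R) by exact: bddc_cst.
  have td2 : tdiff (fun s x => v s x ^+ 2) (fun x => 2 * v r x * gardner k (q r) (v r) x) r.
    by apply: tdiff_sqr => //; [exact: nice_bddc (sch_nice _)|exact: sch_nice].
  have := I_tdiff nv ng b1 td2.
  rewrite (_ : (fun s => I _) = (fun s => I (fun x => v s x ^+ 2))); last first.
    by apply/funext => s1; apply: eq_I => x; rewrite mulr1.
  rewrite (_ : I _ = 0)//.
  transitivity (I (fun x => 2 * v r x * gardner k (q r) (v r) x)).
    by apply: eq_I => x; rewrite mulr1.
  by apply: I_gardner => //; rewrite vr.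
suff h : I (fun x => v s x ^+ 2) = I (fun x => v t x ^+ 2).
  by move: h; rewrite /v st subrr normr0 eta0.
have cst a b : a <= b -> `|a - t| < eta -> `|b - t| < eta ->
    I (fun x => v a x ^+ 2) = I (fun x => v b x ^+ 2).
  move=> ab at1 bt1.
  have inn c : a <= c <= b -> `|c - t| < eta.
    move: at1 bt1; rewrite !ltr_norml => /andP[a1 a2] /andP[a3 a4] /andP[a5 a6].
    by apply/andP; split; lra.
  have [||c _ ] := @MVT_segment R (fun s => I (fun x => v s x ^+ 2)) (fun=> 0) a b ab.
  - by move=> c; rewrite in_itv /= => /andP[h1 h2]; apply: dN; apply: inn; rewrite !ltW.
  - apply: derivable_within_continuous => c; rewrite in_itv /= => cab.
    have h := dN c (inn c cab).
    exact: (@ex_derive _ _ _ _ _ _ _ h).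
  by rewrite mul0r => /eqP; rewrite subr_eq0 => /eqP.
have tt : `|t - t| < eta by rewrite subrr normr0.
have [le|ge] := leP s t; first exact: cst.
by apply/esym/cst => //; exact: ltW.
Qed.

(** Continuation in time. Existence with integral [c] implies [Hsm k (4 * c)]. Where this inequality
    holds, [Ric_near] makes existence locally constant, as [4 c <= 256^-1]. Where it fails, one test
    function violates it strictly, also at nearby times, so existence fails on a neighbourhood. A
    property true at time 0 and locally constant is true at all times. *)
Lemma Ric_conserved k (q : R -> R -> R) (v : R -> R) : 16 <= k -> kdvsol q ->
  Ric k (q 0) v -> I (fun x => v x ^+ 2) <= 1024^-1 ->
  exists u : R -> R -> R, forall t, Ric k (q t) (u t) /\
    I (fun x => u t x ^+ 2) = I (fun x => v x ^+ 2).
Proof.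
move=> k16 hq rv Iv; have [sq tq] := hq.
have k0 : 0 < k by lra.
set c := I (fun x => v x ^+ 2) in Iv *.
have c0 : 0 <= c by apply: I_ge0 => x; exact: sqr_ge0.
suff h t : exists u, Ric k (q t) u /\ I (fun x => u x ^+ 2) = c.
  by have [u hu] := choice h; exists u.
move: t; apply: locally_constant_prop; last by exists v.
move=> t.
have PH s : (exists u, Ric k (q s) u /\ I (fun x => u x ^+ 2) = c) -> Hsm k (4 * c) (q s).
  move=> [u [ru Iu]]; apply: (@Ric_Hsm _ k (q s) u c _ (sq s) ru).
  - by lra.
  - by rewrite Iu.
  - by lra.
have [hs|hs] := pselect (Hsm k (4 * c) (q t)).
  have [||u [eta [eta0 h1 h2]]] := @Ric_near k (4 * c) q t k16 hq _ _ hs.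
  - by nonneg_tac.
  - by lra.
  exists eta => // s st.
  have [r1 I1] := h1 s st.
  have tt : `|t - t| < eta by rewrite subrr normr0.
  have [r2 I2] := h1 t tt.
  split=> -[w [rw Iw]].
  - exists (u t); split => //; rewrite -(h2 s st) -Iw; apply: eq_I => x.
    by rewrite (Ric_unique k0 rw r1).
  - exists (u s); split => //; rewrite (h2 s st) -Iw; apply: eq_I => x.
    by rewrite (Ric_unique k0 rw r2).
have nP s : ~ Hsm k (4 * c) (q s) -> ~ (exists u, Ric k (q s) u /\ I (fun x => u x ^+ 2) = c).
  by move=> nh /PH.
have [phi sphi hphi] : exists2 phi, sch phi & 4 * c * I (fun x => phi^`() x ^+ 2 + 4 * k ^+ 2 * phi x ^+ 2) <
    I (fun x => q t x * phi x) ^+ 2.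
  apply: contrapT => hn; apply: hs => phi sphi.
  by rewrite leNgt; apply/negP => h; apply: hn; exists phi.
have nq s : nice (q s) by exact: sch_nice.
have bphi : bddc phi by exact/nice_bddc/sch_nice.
have d := I_tdiff nq (sch_nice (sch_kdv_rhs (sq t))) bphi (tq t).
have cF : {for t, continuous (fun s => I (fun x => q s x * phi x) ^+ 2)}.
  have c1 : {for t, continuous (fun s => I (fun x => q s x * phi x))}.
    apply/differentiable_continuous/derivable1_diffP.
    exact: (@ex_derive _ _ _ _ _ _ _ d).
  rewrite (_ : (fun s => _) = fun s => I (fun x => q s x * phi x) * I (fun x => q s x * phi x)).
    by apply: cvgM.
  by apply/funext => s; rewrite expr2.
have gap : 0 < I (fun x => q t x * phi x) ^+ 2 -
    4 * c * I (fun x => phi^`() x ^+ 2 + 4 * k ^+ 2 * phi x ^+ 2) by rewrite subr_gt0.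
move/cvgrPdist_lt : cF => /(_ _ gap) /nbhs_ballP[eta /= eta0 hb].
exists eta => // s st; split=> hP; exfalso; last exact: (nP t hs).
have hsm := PH _ hP phi sphi.
have : 4 * c * I (fun x => phi^`() x ^+ 2 + 4 * k ^+ 2 * phi x ^+ 2) < I (fun x => q s x * phi x) ^+ 2.
  have := hb s; rewrite /ball /= distrC => /(_ st).
  by rewrite ltr_norml => /andP[_]; lra.
by rewrite ltNge hsm.
Qed.

(* This is [q - 2 u'] when [Ric k q u]. *)
Definition backlund k (q u : R -> R) : R -> R := fun x => - q x + 4 * k * u x + 2 * u x ^+ 2.

Lemma sch_backlund k (q u : R -> R) : sch q -> sch u -> sch (backlund k q u).
Proof. by move=> sq su; rewrite /backlund; sch_tac. Qed.

(** Time derivatives are eliminated through [gardner] and space derivatives of [u] through the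
    Riccati equation. Both sides of KdV become polynomials in [u], [q] and the space derivatives of
    [q], and they coincide. *)
Lemma backlund_kdvsol k (q u : R -> R -> R) : 2 <= k -> kdvsol q ->
  (forall t, Ric k (q t) (u t) /\ I (fun x => u t x ^+ 2) <= 1) ->
  kdvsol (fun t => backlund k (q t) (u t)).
Proof.
move=> k2 [sq tq] hu.
split=> [t|t]; first by have [[su _] _] := hu t; exact: sch_backlund.
have [[su du] Iu] := hu t; have sqt := sq t.
have sg := sch_gardner sqt (hu t).1.
have tu : tdiff u (gardner k (q t) (u t)) t.
  apply: (@Ric_tdiff k q u (kdv_rhs (q t)) _ t 1 k2 ltr01 _ _ (tq t)) => //.
  - exact/sch_nice/sch_kdv_rhs.
  - exact: (dv_gardner sqt (hu t).1).
have c4 : forall x : R, `|(fun=> 4 * k) x| <= `|4 * k| by [].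
have c2 : forall x : R, `|(fun=> 2 : R) x| <= `|2 : R| by [].
have c1 : forall x : R, `|(fun=> -1 : R) x| <= `|-1 : R| by [].
have h1 := tdiffM c4 tu.
have h2 := tdiffM c2 (tdiff_sqr (nice_bddc (sch_nice su)) (sch_nice sg) tu).
have h3 := tdiffM c1 (tq t).
have h := tdiffD (tdiffD h3 h1) h2.
rewrite (_ : (fun s => backlund k (q s) (u s)) =
   (fun s x => -1 * q s x + 4 * k * u s x + 2 * u s x ^+ 2)); last first.
  by apply/funext => s; apply/funext => x; rewrite /backlund; ring.
rewrite (_ : kdv_rhs _ = (fun x => -1 * kdv_rhs (q t) x + 4 * k * gardner k (q t) (u t) x +
   2 * (2 * u t x * gardner k (q t) (u t) x)))//.
apply/funext => x; rewrite !kdv_rhsE.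
set q0 := q t in sqt du *; set u0 := u t in su du *.
pose U1 x := q0 x - 2 * k * u0 x - u0 x ^+ 2.
have s1 := sch_d sqt; have s2 := sch_d s1.
have dU0 : dv u0 U1 by exact: du.
have dU : dv U1 (fun x => q0^`() x - 2 * k * U1 x - 2 * u0 x * U1 x).
  by rewrite {1}/U1; dv_compute; ring.
pose U2 x := q0^`() x - 2 * k * U1 x - 2 * u0 x * U1 x.
have dU' : dv U1 U2 by exact: dU.
have dU2 : dv U2 (fun x => q0^`()^`() x - 2 * k * U2 x - 2 * U1 x ^+ 2 - 2 * u0 x * U2 x).
  by rewrite {1}/U2; dv_compute; ring.
pose U3 x := q0^`()^`() x - 2 * k * U2 x - 2 * U1 x ^+ 2 - 2 * u0 x * U2 x.
have dU2' : dv U2 U3 by exact: dU2.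
set p := backlund k q0 u0.
have e1 : p^`() = fun x => - q0^`() x + 4 * k * U1 x + 4 * u0 x * U1 x.
  by apply: dv_derive1E; rewrite /p /backlund; dv_compute; ring.
have e2 : p^`()^`() = fun x => - q0^`()^`() x + 4 * k * U2 x + 4 * U1 x ^+ 2 + 4 * u0 x * U2 x.
  by rewrite e1; apply: dv_derive1E; dv_compute; ring.
have e3 : p^`()^`()^`() = fun x => - q0^`()^`()^`() x + 4 * k * U3 x + 12 * U1 x * U2 x + 4 * u0 x * U3 x.
  by rewrite e2; apply: dv_derive1E; dv_compute; ring.
rewrite e3 e1 /p /backlund /gardner /U3 /U2 /U1.
by move: (q0^`()^`()^`() x) (q0^`()^`() x) (q0^`() x) (q0 x) (u0 x) => *; ring.
Qed.

End TimeDerivative.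

(** * Green function and permutability of Backlund transformations *)

Section Green.
Context {R : realType}.
Implicit Types (phi q u U v h : R -> R) (k K : R).

(** If $\psi' = (k + u)\psi$, then $\psi$ solves the Schrodinger equation and decays at $-\infty$,
    and the diagonal Green function is $g = \psi^2 \int_x^\infty \psi^{-2}$, so that $g' = 2(k + u)
    g - 1$. Subtracting the free value $1/(2k)$ leaves the Schwartz function [h]. *)
Definition green k u h := sch h /\ dv h (fun x => (2 * k + 2 * u x) * h x + u x / k).

(* The diagonal of the Green function of $-\partial^2 + q + k^2$. *)
Definition gf k h : R -> R := fun x => (2 * k)^-1 + h x.

Lemma bddc_gf k h : sch h -> bddc (gf k h).
Proof. by move=> sh; have nh := sch_nice sh; rewrite /gf; bddc_tac. Qed.

Lemma green_exists k u : 0 < k -> sch u -> exists h, green k u h.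
Proof.
move=> k0 su; have s2 : sch (fun x => 2 * u x) by sch_tac.
have sf : sch (fun x => - (u x / k)) by sch_tac.
have [h [sh dh]] := linear_schwartz_back k0 s2 sf.
by exists h; split => //; apply: (dv_eq dh) => x; rewrite opprK.
Qed.

Lemma green_unique k u h h1 : 0 < k -> sch u -> green k u h ->
  dv h1 (fun x => (2 * k + 2 * u x) * h1 x + u x / k) ->
  (exists B : R, forall x, `|h1 x| <= B) -> h =1 h1.
Proof.
move=> k0 su [sh dh] dh1 bh1; have s2 : sch (fun x => 2 * u x) by sch_tac.
apply: (linear_unique_back (f := fun x => - (u x / k)) k0 s2) => //.
- by apply: (dv_eq dh) => x; rewrite opprK.
- by apply: (dv_eq dh1) => x; rewrite opprK.
- exact: rapid_bounded (sch_rapid sh).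
Qed.

Lemma dv_gf k u h : 0 < k -> green k u h ->
  dv (gf k h) (fun x => (2 * k + 2 * u x) * gf k h x - 1).
Proof.
move=> k0 [sh dh]; have kn : k != 0 by exact: lt0r_neq0.
by rewrite /gf; dv_compute; field.
Qed.

Lemma gf_sup k u h x : 16 <= k -> sch u -> I (fun x => u x ^+ 2) <= 1 ->
  green k u h -> `|gf k h x| <= 4 / k.
Proof.
move=> k16 su Iu gh; have k0 : 0 < k by lra.
have s2 : sch (fun x => 2 * u x) by sch_tac.
have I2 : I (fun x => (2 * u x) ^+ 2) <= 4.
  rewrite (_ : I _ = I (fun x => 4 * u x ^+ 2)); last by apply: eq_I => y; ring.
  by rewrite IZ; [lra|nice_tac].
have bg := bddc_gf k gh.1.
have hh : `|gf k h x| <= 2 * expR (4 / k) / k * 1.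
  by apply: (linear_sup_back k0 s2 bg.2 I2 (dv_gf k0 gh)) => z; rewrite normr1.
apply: (le_trans hh).
rewrite mulr1 ler_pM2r ?invr_gt0//.
suff : expR (4 / k) <= 2 by lra.
by apply: expR_le2; rewrite ler_pdivrMr//; lra.
Qed.

(** The equation reads $h' - 2kh = 2u g$. Squaring and integrating, the cross term is an exact
    derivative; the right side is bounded with $|g| \le 4/k$. *)
Lemma green_L2 k u h : 16 <= k -> sch u -> I (fun x => u x ^+ 2) <= 1 -> green k u h ->
  I (fun x => ((2 * k + 2 * u x) * h x + u x / k) ^+ 2) + 4 * k ^+ 2 * I (fun x => h x ^+ 2)
  <= 64 / k ^+ 2 * I (fun x => u x ^+ 2).
Proof.
move=> k16 su Iu gh; have k0 : 0 < k by lra.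
have hg x := gf_sup x k16 su Iu gh.
have [sh dh] := gh; have bg := bddc_gf k sh.
have kn : k != 0 by exact: lt0r_neq0.
rewrite -!IZ; [|by nice_tac|by nice_tac]; rewrite -ID; [|by nice_tac|by nice_tac].
apply: (@le_trans _ _ (I (fun x => 4 * (u x * gf k h x) ^+ 2))).
  rewrite le_eqVlt; apply/orP; left; apply/eqP.
  apply: (I_dv_eq (F := fun x => 2 * k * h x ^+ 2)); try nice_tac.
  by dv_compute; rewrite /gf; field.
apply: I_le; try nice_tac; move=> x.
have h1 : gf k h x ^+ 2 <= 16 / k ^+ 2.
  rewrite -real_normK ?num_real//; have -> : 16 / k ^+ 2 = (4 / k) ^+ 2 by field.
  by rewrite lerXn2r ?nnegrE//; nonneg_tac.
have := ler_wpM2l (sqr_ge0 (u x)) h1; rewrite exprMn; lra.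
Qed.

(** To first order $q = k(\partial^2 - 4k^2) h$. After integration by parts the difference contains
    only $u^2$ and $u h$, and [green_L2] makes $h$ of size $u / k^2$ in L^2: the error is quadratic
    in [u]. *)
Lemma test_approx k q u h phi (S : R) : 16 <= k -> sch q -> Ric k q u ->
  I (fun x => u x ^+ 2) <= 1 -> green k u h -> sch phi ->
  (forall x, `|phi x| <= S) -> (forall x, `|phi^`() x| <= S) ->
  `|I (fun x => q x * phi x) - I (fun x => h x * (k * (phi^`()^`() x - 4 * k ^+ 2 * phi x)))|
   <= 100 * S * I (fun x => u x ^+ 2).
Proof.
move=> k16 sq [su du] Iu gh sphi S0 S1; have k0 : 0 < k by lra.
have SS : 0 <= S := le_trans (normr_ge0 _) (S0 0).
have s1 := sch_d sphi; have s2 := sch_d s1.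
have h2 := green_L2 k16 su Iu gh; have [sh dh] := gh.
have kn : k != 0 by exact: lt0r_neq0.
rewrite -IB; [|by nice_tac|by nice_tac].
have -> : I (fun x => q x * phi x - h x * (k * (phi^`()^`() x - 4 * k ^+ 2 * phi x))) =
  I (fun x => u x ^+ 2 * phi x - 2 * k * (u x * h x) * (2 * k * phi x - phi^`() x)).
  apply: (I_dv_eq (F := fun x => u x * phi x + k * h x * (2 * k * phi x - phi^`() x))); try nice_tac.
  by dv_compute; field.
set i := I (fun x => u x ^+ 2) in Iu h2 *.
have i0 : 0 <= i by apply: I_ge0 => x; exact: sqr_ge0.
apply: (@le_trans _ _ (I (fun x => S * u x ^+ 2 + S * (4 * u x ^+ 2 + 4 * k ^+ 2 * k ^+ 2 * h x ^+ 2)))).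
  apply: I_abs_le; try nice_tac; move=> x.
  apply: (le_trans (ler_normB _ _)); apply: lerD.
    by rewrite normrM ger0_norm ?sqr_ge0// mulrC ler_wpM2r ?sqr_ge0.
  have a1 : `|2 * k * phi x - phi^`() x| <= 4 * k * S.
    apply: (le_trans (ler_normB _ _)); rewrite normrM ger0_norm; last by nonneg_tac.
    have k2 : 0 <= 2 * k by nonneg_tac.
    have := ler_wpM2l k2 (S0 x); have := S1 x.
    have : S <= 2 * k * S by rewrite ler_peMl//; lra.
    by lra.
  have a2 : `|2 * k * (u x * h x)| * (4 * k) <= 4 * u x ^+ 2 + 4 * k ^+ 2 * k ^+ 2 * h x ^+ 2.
    rewrite normrM ger0_norm; last by nonneg_tac.
    rewrite normrM -(real_normK (num_real (u x))) -(real_normK (num_real (h x))).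
    have := sqr_ge0 (2 * `|u x| - 2 * k ^+ 2 * `|h x|); lra.
  rewrite normrM.
  apply: (@le_trans _ _ (`|2 * k * (u x * h x)| * (4 * k * S))); first by rewrite ler_wpM2l.
  by have := ler_wpM2l SS a2; lra.
have -> : I (fun x => S * u x ^+ 2 + S * (4 * u x ^+ 2 + 4 * k ^+ 2 * k ^+ 2 * h x ^+ 2)) =
   S * (5 * i + k ^+ 2 * (4 * k ^+ 2 * I (fun x => h x ^+ 2))).
  have -> : I (fun x => S * u x ^+ 2 + S * (4 * u x ^+ 2 + 4 * k ^+ 2 * k ^+ 2 * h x ^+ 2)) =
     I (fun x => 5 * S * u x ^+ 2 + 4 * k ^+ 2 * k ^+ 2 * S * h x ^+ 2).
    by apply: eq_I => x; ring.
  rewrite ID; [|by nice_tac|by nice_tac]; rewrite IZ; last by nice_tac.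
  by rewrite IZ; [rewrite -/i; ring|nice_tac].
have h3 : 0 <= I (fun x => ((2 * k + 2 * u x) * h x + u x / k) ^+ 2).
  by apply: I_ge0 => x; exact: sqr_ge0.
have h4 : 4 * k ^+ 2 * I (fun x => h x ^+ 2) <= 64 / k ^+ 2 * i by lra.
have kk : 0 <= k ^+ 2 by nonneg_tac.
have h5 := ler_wpM2l kk h4.
have e5 : k ^+ 2 * (64 / k ^+ 2 * i) = 64 * i by field.
rewrite e5 in h5.
have h6 : 5 * i + k ^+ 2 * (4 * k ^+ 2 * I (fun x => h x ^+ 2)) <= 100 * i by lra.
by have := ler_wpM2l SS h6; lra.
Qed.

(** Comparison principle: [expR A * m] is nondecreasing, and a bounded [m] contributes nothing at
    minus infinity, where [A] falls at rate [k] up to a bounded error. *)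
Lemma linear_nonneg k (M : R) (b rho m m' : R -> R) : 0 < k -> continuous b ->
  dv rho (fun x => b x ^+ 2) -> (forall x, 0 <= rho x) -> (forall x, rho x <= M) ->
  dv m m' -> (forall x, 0 <= m' x + (2 * k + b x) * m x) ->
  (exists B : R, forall x, `|m x| <= B) -> forall x, 0 <= m x.
Proof.
move=> k0 cb drho r0 rM dm hm [B hB] x.
have kn : k != 0 by exact: lt0r_neq0.
have [A dA] : exists A, dv A (fun x => 2 * k + b x).
  by apply: antiderivative; apply: contD => //; exact: cont_cst.
have dE : dv (fun z => expR (A z) * m z) (fun z => expR (A z) * (m' z + (2 * k + b z) * m z)).
  by dv_compute; ring.
have dP : dv (fun z => A z + rho z / (2 * k) - k * z)
   (fun z => 2 * k + b z + b z ^+ 2 / (2 * k) - k) by dv_compute; ring.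
apply/ler_addgt0Pr => e e0; rewrite -lerBlDr sub0r.
have B0 : 0 <= B := le_trans (normr_ge0 _) (hB 0).
have [n [hn nx]] : exists n : nat, expR (- (k * (x + n%:R))) * (expR (M / (2 * k)) * B) <= e /\ - n%:R <= x.
  have h1 := expRN_vanish x (expR (M / (2 * k)) * B) k0 e0; have h2 := @nbhs_infty_ger R (- x).
  have : \forall n \near \oo, expR (- (k * (x + n%:R))) * (expR (M / (2 * k)) * B) <= e /\ - n%:R <= x.
    near=> n; split; first by near: n.
    by rewrite lerNl; near: n.
  by case=> N _ /(_ N (leqnn N)) h; exists N.
have h1 : expR (A (- n%:R)) * m (- n%:R) <= expR (A x) * m x.
  by apply: (dv_le dE) => // z _; rewrite mulr_ge0 ?expR_ge0.
have h2 : A (- n%:R) + rho (- n%:R) / (2 * k) - k * - n%:R <= A x + rho x / (2 * k) - k * x.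
  apply: (dv_le dP) => // z _.
  have : 0 <= (k + b z) ^+ 2 / (2 * k) by nonneg_tac.
  have -> : (k + b z) ^+ 2 / (2 * k) = k / 2 + b z + b z ^+ 2 / (2 * k) by field.
  by lra.
have h3 : A (- n%:R) <= A x + M / (2 * k) - k * (x + n%:R).
  have : 0 <= rho (- n%:R) / (2 * k) by have := r0 (- n%:R) => ?; nonneg_tac.
  have : rho x / (2 * k) <= M / (2 * k) by rewrite ler_pM2r// invr_gt0 mulr_gt0.
  by move: (rho x / _) (rho (- _) / _) (M / _) h2 => *; lra.
have h4 : expR (A (- n%:R)) * - B <= expR (A x) * m x.
  apply: le_trans h1; rewrite ler_wpM2l ?expR_ge0//.
  by have := hB (- n%:R); rewrite ler_norml => /andP[].
have h5 : expR (A (- n%:R)) <= expR (A x) * (expR (- (k * (x + n%:R))) * expR (M / (2 * k))).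
  by rewrite -!expRD ler_expR; lra.
have h6 := ler_wpM2r B0 h5.
have h7 : expR (A x) * (- e) <= expR (A x) * m x.
  apply: le_trans h4.
  have := ler_wpM2l (expR_ge0 (A x)) hn; lra.
by rewrite ler_pM2l ?expR_gt0// in h7.
Unshelve. all: by end_near. Qed.

(** * Riccati solution and Green function after a Backlund step *)

Section Permutability.
Variables (k K : R) (q u U : R -> R).
Hypotheses (k0 : 0 < k) (kK : k < K) (sq : sch q) (ru : Ric k q u) (rU : Ric K q U).

(** If $\psi_k$ and $\psi_K$ have logarithmic derivatives $k + u$ and $K + U$, this is the
    logarithmic derivative of $\psi_K / \psi_k$, their Wronskian over their product. It occurs as a
    denominator in the Backlund transform and has to stay away from 0. *)
Definition permD : R -> R := fun x => K - k + U x - u x.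

Let su : sch u. Proof. by have [] := ru. Qed.
Let du : dv u (fun x => q x - 2 * k * u x - u x ^+ 2). Proof. by have [] := ru. Qed.
Let sU : sch U. Proof. by have [] := rU. Qed.
Let dU : dv U (fun x => q x - 2 * K * U x - U x ^+ 2). Proof. by have [] := rU. Qed.

Lemma dv_permD : dv permD (fun x => (K ^+ 2 - k ^+ 2) - (2 * ((K + k) / 2) + (U x + u x)) * permD x).
Proof. by have d1 := du; have d2 := dU; rewrite /permD; dv_compute; field. Qed.

(** [permD] solves a damped linear equation with positive source [K ^+ 2 - k ^+ 2]; a multiple of
    [expR (- (rho x / (2 * L)))] is a subsolution, and the comparison principle applies. *)
Lemma permD_lb : exists2 c : R, 0 < c & forall x, c <= permD x.
Proof.
have sb : sch (fun x => U x + u x) by have s1 := su; have s2 := sU; sch_tac.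
have [|z|rho [drho r0 rM]] := @nice_antiderivative _ (fun x => (U x + u x) ^+ 2).
- by nice_tac.
- exact: sqr_ge0.
set M := I _ in rM.
have k0' := k0; have kK' := kK.
pose L := (K + k) / 2.
have L0 : 0 < L by rewrite /L; lra.
have Ln : L != 0 by exact: lt0r_neq0.
have KK : 0 < K ^+ 2 - k ^+ 2 by rewrite subr_sqr mulr_gt0; lra.
(* Completing the square bounds $2L + b - b^2/(2L)$ by $5L/2$, where $b = U + u$; this [c] makes
   $5L/2$ times [c] equal to the source. *)
pose c := 2 * (K ^+ 2 - k ^+ 2) / (5 * L).
have c0 : 0 < c by rewrite /c; pos_tac.
have cL : c * (5 * L) = 2 * (K ^+ 2 - k ^+ 2) by rewrite /c; field.
have dY : dv (fun x => c * expR (- (rho x / (2 * L))))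
  (fun x => - ((U x + u x) ^+ 2 / (2 * L)) * (c * expR (- (rho x / (2 * L))))).
  by dv_compute; ring.
have d1 : dv permD (fun x => (K ^+ 2 - k ^+ 2) - (2 * L + (U x + u x)) * permD x).
  exact: dv_permD.
have dm := dvD d1 (dvN dY); rewrite /= in dm.
have cE y : c * expR (- (rho y / (2 * L))) <= c.
  rewrite -[leRHS]mulr1 ler_pM2l// expR_le1 oppr_le0; have := r0 y => ?; nonneg_tac.
exists (c * expR (- (M / (2 * L)))); first by pos_tac.
move=> x; apply: (@le_trans _ _ (c * expR (- (rho x / (2 * L))))).
  by rewrite ler_pM2l// ler_expR lerN2 ler_pM2r ?rM// invr_gt0 mulr_gt0.
rewrite -subr_ge0.
apply: (@linear_nonneg L M _ _ _ _ L0 (sch_cont sb) drho r0 rM dm) => [y|].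
  set b := U y + u y; set Y := c * _.
  have Y0 : 0 <= Y by rewrite /Y; nonneg_tac.
  have Yc : Y <= c by exact: cE.
  have hb : 0 <= (L - b) ^+ 2 / (2 * L) by nonneg_tac.
  have eb : (L - b) ^+ 2 / (2 * L) = L / 2 - b + b ^+ 2 / (2 * L) by field.
  have h1 : 2 * L + b - b ^+ 2 / (2 * L) <= 5 * L / 2 by lra.
  have h2 := ler_wpM2r Y0 h1.
  have h3 : 5 * L / 2 * Y <= K ^+ 2 - k ^+ 2.
    have l0 : 0 <= 5 * L / 2 by nonneg_tac.
    by have := ler_wpM2l l0 Yc; lra.
  by move: (b ^+ 2 / (2 * L)) h2 => t h2; lra.
have [B hB] := rapid_bounded (sch_rapid sU); have [B' hB'] := rapid_bounded (sch_rapid su).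
exists (`|K - k| + B + B' + c) => y; apply: (le_trans (ler_normD _ _)); apply: lerD.
  by rewrite /permD (le_trans (ler_normB _ _))// lerD// (le_trans (ler_normD _ _))// lerD.
by rewrite normrN ger0_norm ?cE//; nonneg_tac.
Qed.

Let D0 x : 0 < permD x.
Proof. by have [c c0 h] := permD_lb; exact: lt_le_trans (h x). Qed.

Let Dn x : permD x != 0. Proof. exact: lt0r_neq0. Qed.

(* The Riccati solution at [k] of the Backlund transform of [q] at [K]; it is
   [u + (log permD)']. *)
Definition permv : R -> R :=
  fun x => u x + ((K ^+ 2 - k ^+ 2) / permD x - (K + k + U x + u x)).

Let dVD : dv (fun x => (permD x)^-1)
  (fun x => - ((K ^+ 2 - k ^+ 2) - (2 * ((K + k) / 2) + (U x + u x)) * permD x) / permD x ^+ 2).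
Proof. by apply: dvV => //; exact: dv_permD. Qed.

Lemma dv_permv : dv permv (fun x => backlund K q U x - 2 * k * permv x - permv x ^+ 2).
Proof.
have d1 := du; have d2 := dU; have d3 := dVD; rewrite {1}/permv.
eapply dv_eq; [dv_tac|move=> x /=].
have := Dn x; rewrite /permv /backlund.
have -> : U x = permD x - K + k + u x by rewrite /permD; ring.
by move: (permD x) (u x) (q x) => D v p Dn'; field.
Qed.

Let permE x : permv x = u x + (permD x)^-1 * (2 * k * u x + u x ^+ 2 - 2 * K * U x - U x ^+ 2).
Proof.
have := Dn x; rewrite /permv.
have -> : U x = permD x - K + k + u x by rewrite /permD; ring.
by move: (permD x) (u x) => D v Dn'; field.
Qed.

Let bVD : exists C : R, forall x, `|(permD x)^-1| <= C.
Proof.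
have [c c0 h] := permD_lb; exists c^-1 => x.
by rewrite gtr0_norm ?invr_gt0// lef_pV2 ?posrE.
Qed.

Let sDn : sch (fun x => 2 * k * u x + u x ^+ 2 - 2 * K * U x - U x ^+ 2).
Proof. by have s1 := su; have s2 := sU; sch_tac. Qed.

Let rapid_perm : rapid (fun x => (permD x)^-1 * (2 * k * u x + u x ^+ 2 - 2 * K * U x - U x ^+ 2)).
Proof. by have [C hC] := bVD; apply: (rapidMb hC); exact: sch_rapid sDn. Qed.

Lemma permv_Ric : Ric k (backlund K q U) permv.
Proof.
split; last exact: dv_permv.
apply: (sch_bootstrap (dv_continuous dv_permv) _ dv_permv) => [|m sm].
  rewrite (_ : permv = fun x => u x + (permD x)^-1 * (2 * k * u x + u x ^+ 2 - 2 * K * U x - U x ^+ 2)).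
    by apply: rapidD; [exact: sch_rapid|exact: rapid_perm].
  by apply/funext => x; exact: permE.
apply: smrD; last by apply: smrN; apply: smrM.
apply: smrD; last by apply: smrN; exact: smrZ.
exact: (sch_backlund K sq sU).
Qed.

(** Integrating the three Riccati equations, of [q] at [k], of [q] at [K] and of the transform at
    [k], reduces the claim to $\int (\mathtt{permv} - u) = 0$. That integrand is the derivative of
    the logarithm of [permD], which tends to [ln (K - k)] at both ends. *)
Lemma permv_I : I (fun x => permv x ^+ 2) = I (fun x => u x ^+ 2).
Proof.
have s1 := su; have s2 := sU; have sv := permv_Ric.1; have sq' := sq.
have sb := sch_backlund K sq sU.
have e1 : I (fun x => backlund K q U x - 2 * k * permv x - permv x ^+ 2) = 0.
  by apply: (I_dv dv_permv); nice_tac.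
have e2 : I (fun x => q x - 2 * k * u x - u x ^+ 2) = 0.
  by apply: (I_dv du); nice_tac.
have e3 : I (fun x => q x - 2 * K * U x - U x ^+ 2) = 0.
  by apply: (I_dv dU); nice_tac.
have e4 : I (fun x => permv x - u x) = 0.
  have -> : I (fun x => permv x - u x) = I (fun x => ((K ^+ 2 - k ^+ 2) -
    (2 * ((K + k) / 2) + (U x + u x)) * permD x) / permD x).
    apply: eq_I => x; rewrite /permv; have := Dn x; move: (permD x) => D Dn'; by field.
  have dL := dv_ln dv_permD D0.
  have nL : nice (fun x => ((K ^+ 2 - k ^+ 2) - (2 * ((K + k) / 2) + (U x + u x)) * permD x) / permD x).
    rewrite (_ : (fun x => _) = fun x => permv x - u x); first by nice_tac.
    apply/funext => x; rewrite /permv; have := Dn x; move: (permD x) => D Dn'; by field.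
  have kK0 : 0 < K - k by rewrite subr_gt0.
  have nUu : nice (fun x => U x - u x) by nice_tac.
  have [l1 l2] := nice_cvg0 nUu.
  have lim (w : nat -> R) : (fun n => U (w n) - u (w n)) @ \oo --> 0 ->
     (fun n => ln (permD (w n))) @ \oo --> ln (K - k).
    move=> hw.
    have hD : (fun n => permD (w n)) @ \oo --> K - k.
      apply/cvgrPdist_lt => e e0; move/cvgrPdist_lt : hw => /(_ e e0).
      apply: filterS => n; rewrite sub0r normrN => hn.
      by rewrite /permD distrC (_ : _ - _ = U (w n) - u (w n))//; ring.
    exact: (cvg_comp _ _ hD (continuous_ln kK0)).
  by rewrite (I_cvg_eq dL nL (lim _ l1) (lim _ l2)) subrr.
rewrite !IB in e1 e2 e3 e4; try nice_tac.
have e5 : I (backlund K q U) = - I q + 4 * K * I U + 2 * I (fun x => U x ^+ 2).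
  rewrite /backlund ID; [|by nice_tac|by nice_tac]; rewrite ID; [|by nice_tac|by nice_tac].
  by rewrite IN; [|by nice_tac]; rewrite !IZ//; nice_tac.
rewrite !IZ in e1 e2 e3; try nice_tac.
have e6 : I permv = I u by lra.
by rewrite e6 in e1; lra.
Qed.

(** The right side is bounded and satisfies the first order equation of the Green function of the
    transform, whose bounded solution is unique. *)
Lemma permv_gf h hv x : green k u h -> green k permv hv ->
  gf k hv x = permD x * (1 + gf k h x * permD x) / (K ^+ 2 - k ^+ 2).
Proof.
move=> gh gv; have [svv _] := permv_Ric.
have KK : 0 < K ^+ 2 - k ^+ 2.
  by have k0' := k0; have kK' := kK; rewrite subr_sqr mulr_gt0; lra.
have KKn : K ^+ 2 - k ^+ 2 != 0 by exact: lt0r_neq0.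
have kn : k != 0 by exact: lt0r_neq0 k0.
pose w y := permD y * (1 + gf k h y * permD y) / (K ^+ 2 - k ^+ 2) - (2 * k)^-1.
suff e : hv x = w x by rewrite {1}/gf e /w; ring.
have bg := bddc_gf k gh.1.
have dg := dv_gf k0 gh; have dD := dv_permD.
apply: (green_unique k0 svv gv).
  rewrite {1}/w; eapply dv_eq; [dv_tac|move=> y /=].
  rewrite /w /permv; have := Dn y.
  move: (gf k h y) => g.
  have -> : U y = permD y - K + k + u y by rewrite /permD; ring.
  by move: (permD y) (u y) => D v Dn'; field; rewrite ?KKn ?kn ?Dn'.
have bD : bddc permD.
  have s1 := sch_nice su; have s2 := sch_nice sU; rewrite /permD; bddc_tac.
have : bddc w by rewrite /w; bddc_tac.
by case.
Qed.

(** Weak form of [permv_gf]. Subtracting an exact derivative removes the terms quadratic in [U],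
    which then enters linearly and only against the derivative of [chi]. *)
Lemma permv_test h hv chi : green k u h -> green k permv hv -> sch chi ->
  (K ^+ 2 - k ^+ 2) * I (fun x => hv x * chi x) =
  I (fun x => h x * ((K ^+ 2 - k ^+ 2) * chi x + chi^`()^`() x / 2 + K * chi^`() x)) +
  I (fun x => U x * gf k h x * chi^`() x).
Proof.
move=> gh gv sc; have [shv _] := gv; have [sh dh] := gh.
have s1 := su; have s2 := sU; have sc1 := sch_d sc; have sc2 := sch_d sc1.
have bg := bddc_gf k sh; have dg := dv_gf k0 gh.
have KK : 0 < K ^+ 2 - k ^+ 2.
  by have k0' := k0; have kK' := kK; rewrite subr_sqr mulr_gt0; lra.
have KKn : K ^+ 2 - k ^+ 2 != 0 by exact: lt0r_neq0.
have kn : k != 0 by exact: lt0r_neq0 k0.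
rewrite -IZ; last by nice_tac.
rewrite -ID; [|by nice_tac|by nice_tac].
have d1 := du; have d2 := dU.
apply: (I_dv_eq (F := fun x => (k * h x + u x * h x + u x / (2 * k) - K * h x - U x * gf k h x) * chi x
   - h x * chi^`() x / 2)); try nice_tac.
eapply dv_eq; [dv_tac|move=> x /=].
have e1 : hv x = permD x * (1 + gf k h x * permD x) / (K ^+ 2 - k ^+ 2) - (2 * k)^-1.
  by rewrite -(permv_gf x gh gv) /gf; ring.
rewrite e1 /permD /gf.
by move: (h x) (u x) (U x) (q x) (chi x) (chi^`() x) (chi^`()^`() x) => *; field; rewrite ?KKn ?kn.
Qed.

End Permutability.

(** * Evolution of the Green function under KdV *)

Section GreenTime.
Variables (k : R).
Hypothesis k16 : 16 <= k.

(* The time derivative of [gf k h] when [q] solves KdV. *)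
Definition greent q u h : R -> R := fun x =>
  - 2 * q^`() x * gf k h x + 2 * (q x - 2 * k ^+ 2) * ((2 * k + 2 * u x) * h x + u x / k).

Let k0 : 0 < k. Proof. have := k16; lra. Qed.
Let kn : k != 0. Proof. exact: lt0r_neq0 k0. Qed.

Lemma sch_greent q u h : sch q -> sch u -> sch h -> sch (greent q u h).
Proof.
move=> sq su sh; have s1 := sch_d sq.
rewrite (_ : greent q u h = fun x => - 2 * (2 * k)^-1 * q^`() x + (- 2) * q^`() x * h x +
  (2 * q x * (2 * k * h x + 2 * u x * h x + u x / k) - 4 * k ^+ 2 * (2 * k * h x + 2 * u x * h x + u x / k))).
  by sch_tac.
by apply/funext => x; rewrite /greent /gf; ring.
Qed.

Lemma dv_greent q u h : sch q -> Ric k q u -> green k u h ->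
  dv (greent q u h) (fun x => (2 * k + 2 * u x) * greent q u h x + 2 * gardner k q u x * gf k h x).
Proof.
move=> sq [su du] gh; have [sh dh] := gh; have s1 := sch_d sq; have dg := dv_gf k0 gh.
rewrite {1}/greent; eapply dv_eq; [dv_tac|move=> x /=].
rewrite /greent /gardner /gf.
by move: (h x) (u x) (q x) (q^`() x) (q^`()^`() x) => *; field.
Qed.

(** Integration by parts moves the derivatives to [phi]. No square of [q] appears, only its product
    with the smoother [gf]; this is why the Green function is followed in time instead of [q]. *)
Lemma greent_test q u h phi : sch q -> Ric k q u -> green k u h -> sch phi ->
  I (fun x => greent q u h x * phi x) =
  I (fun x => h x * (- 2 * phi^`()^`()^`() x + 12 * k ^+ 2 * phi^`() x)) +
  6 * I (fun x => q x * gf k h x * phi^`() x).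
Proof.
move=> sq [su du] gh sphi; have [sh dh] := gh; have s1 := sch_d sq; have dg := dv_gf k0 gh.
have bg := bddc_gf k sh.
have sp1 := sch_d sphi; have sp2 := sch_d sp1; have sp3 := sch_d sp2.
have sgt := sch_greent sq su sh.
rewrite -IZ; last by nice_tac.
rewrite -ID; [|by nice_tac|by nice_tac].
pose h1 x := (2 * k + 2 * u x) * h x + u x / k.
have dh1 : dv h h1 by exact: dh.
have nh1 : nice h1 by rewrite /h1; nice_tac.
pose h2 x := 2 * (q x - 2 * k * u x - u x ^+ 2) * gf k h x + (2 * k + 2 * u x) * h1 x.
have dh2 : dv h1 h2.
  rewrite /h1; eapply dv_eq; [dv_tac|move=> x /=]; rewrite /h2 /h1 /gf; have := kn.
  by move: (h x) (u x) (q x) => *; field.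
have nh2 : nice h2 by rewrite /h2; nice_tac.
have dh3 : dv h2 (fun x => 2 * (q^`() x - 2 * k * (q x - 2 * k * u x - u x ^+ 2)
   - 2 * u x * (q x - 2 * k * u x - u x ^+ 2)) * gf k h x
   + 4 * (q x - 2 * k * u x - u x ^+ 2) * h1 x + (2 * k + 2 * u x) * h2 x).
  rewrite {1}/h2; eapply dv_eq; [dv_tac|move=> x /=]; rewrite /h2 /h1 /gf; have := kn.
  by move: (h x) (u x) (q x) (q^`() x) => *; field.
suff main p1 p2 p3 : sch p1 -> sch p2 -> sch p3 -> dv phi p1 -> dv p1 p2 -> dv p2 p3 ->
    I (fun x => greent q u h x * phi x) =
    I (fun x => h x * (- 2 * p3 x + 12 * k ^+ 2 * p1 x) + 6 * (q x * gf k h x * p1 x)).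
  exact: (main _ _ _ sp1 sp2 sp3 (sch_dv sphi) (sch_dv sp1) (sch_dv sp2)).
move=> {sp1 sp2 sp3} sp1 sp2 sp3 dp1 dp2 dp3.
apply: (I_dv_eq (F := fun x => (2 * h2 x - 6 * q x * gf k h x - 12 * k ^+ 2 * h x) * phi x
   - 2 * h1 x * p1 x + 2 * h x * p2 x)); try nice_tac.
eapply dv_eq; [dv_tac|move=> x /=].
rewrite /greent -/(h1 x) /h2 /h1 /gf; have := kn.
by move: (h x) (u x) (q x) (q^`() x) (phi x) (p1 x) (p2 x) (p3 x) => *; field.
Qed.

(** The error [E] of the difference quotient solves an equation of the same type as [h], with a
    source that is small because [u] is differentiable in time. The sup estimate makes [E] uniformly
    small, which suffices against the integrable [phi]. *)
Lemma green_time (q u h : R -> R -> R) phi t : kdvsol q ->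
  (forall t, Ric k (q t) (u t) /\ I (fun x => u t x ^+ 2) <= 1) ->
  (forall t, green k (u t) (h t)) -> sch phi ->
  is_derive t (1 : R) (fun s => I (fun x => h s x * phi x))
    (I (fun x => greent (q t) (u t) (h t) x * phi x)).
Proof.
move=> hq hu hh sphi; have [sq tq] := hq.
have k0' := k0; have k16' := k16; have kn' := kn.
have k2 : 2 <= k by lra.
have [[su du] Iu] := hu t; have [sh dh] := hh t; have sqt := sq t.
have sga := sch_gardner sqt (hu t).1.
have td : tdiff u (gardner k (q t) (u t)) t.
  apply: (@Ric_tdiff _ k q u (kdv_rhs (q t)) _ t 1 k2 ltr01 _ _ (tq t)) => //.
  - exact/sch_nice/sch_kdv_rhs.
  - exact: (dv_gardner sqt (hu t).1).
have sgt := sch_greent sqt su sh.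
have [G hG] := rapid_bounded (sch_rapid sgt).
have G0 : 0 <= G := le_trans (normr_ge0 _) (hG 0).
pose N := I (fun x => `|phi x|).
have N0 : 0 <= N by exact: I_ge0.
pose L := 2 * expR (4 / k) / k.
have L0 : 0 < L by rewrite /L; pos_tac.
apply: is_derive_eps => e e0.
have [C [C0 [b b0 hb]]] := tdiff_bound (sch_nice sga) td.
pose d := e / (L * (N + 1)).
have d0 : 0 < d by rewrite /d; pos_tac.
have d2 : 0 < d / 4 by pos_tac.
have [a a0 ha] := td _ d2.
have c0 : 0 < d / (4 * C * (G + 1)) by pos_tac.
exists (Num.min a (Num.min b (d / (4 * C * (G + 1))))); first by rewrite !lt_min a0 b0 c0.
move=> s /andP[s0]; rewrite !lt_min => /and3P[s1 s2 s3].
have sn0 : s != 0 by rewrite -normr_gt0.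
have [[su1 du1] Iu1] := hu (t + s); have [sh1 dh1] := hh (t + s).
pose E x := (h (t + s) x - h t x) / s - greent (q t) (u t) (h t) x.
have sE : sch E by rewrite /E; sch_tac.
have dgt := dv_greent sqt (hu t).1 (hh t).
pose V x := (u (t + s) x - u t x) / s.
have dE : dv E (fun x => (2 * k + 2 * u (t + s) x) * E x -
   (- (2 * s * V x * greent (q t) (u t) (h t) x) - 2 * (V x - gardner k (q t) (u t) x) * gf k (h t) x)).
  rewrite {1}/E; eapply dv_eq; [dv_tac|move=> x /=]; rewrite /E /V /gf.
  move: (greent _ _ _ x) (gardner _ _ _ x) (u (t + s) x) (u t x) (h (t + s) x) (h t x) => *; field.
  by rewrite ?kn' ?sn0.
have sb : sch (fun x => 2 * u (t + s) x) by sch_tac.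
have I2 : I (fun x => (2 * u (t + s) x) ^+ 2) <= 4.
  rewrite (_ : I _ = I (fun x => 4 * u (t + s) x ^+ 2)); last by apply: eq_I => y; ring.
  by rewrite IZ; [lra|nice_tac].
have Ed x : `|E x| <= L * d.
  apply: (@linear_sup_back _ k 4 d _ _ _ k0' sb (rapid_bounded (sch_rapid sE)) I2 dE) => y.
  have w1 := wt_le1 y; have w0 := wt_ge0 y.
  have hV : `|V y| <= C.
    have := hb s; rewrite s0 s2 => /(_ isT y) h1; apply: (le_trans h1).
    by rewrite ler_piMr// ltW.
  have hW : `|V y - gardner k (q t) (u t) y| <= d / 4.
    have := ha s; rewrite s0 s1 => /(_ isT y) h1; apply: (le_trans h1).
    by rewrite ler_piMr// ltW.
  have hg : `|gf k (h t) y| <= 1.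
    apply: (le_trans (gf_sup y k16 su Iu (hh t))).
    by rewrite ler_pdivrMr//; lra.
  apply: (le_trans (ler_normB _ _)); rewrite normrN.
  have a1 : `|2 * s * V y * greent (q t) (u t) (h t) y| <= d / 2.
    rewrite normrM normrM normrM ger0_norm//.
    apply: (@le_trans _ _ (2 * (d / (4 * C * (G + 1))) * C * (G + 1))).
      apply: ler_pM; [by nonneg_tac|by []| |by rewrite (le_trans (hG y))// lerDl].
      apply: ler_pM; [by nonneg_tac|by []| |by []].
      by rewrite ler_pM2l// ltW.
    rewrite le_eqVlt; apply/orP; left; apply/eqP; field.
    by rewrite (lt0r_neq0 C0) lt0r_neq0// ltr_wpDl.
  have a2 : `|2 * (V y - gardner k (q t) (u t) y) * gf k (h t) y| <= d / 2.
    rewrite normrM normrM ger0_norm//.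
    have -> : d / 2 = 2 * (d / 4) * 1 by field.
    apply: ler_pM; [by nonneg_tac|by []| |by []].
    by rewrite ler_pM2l.
  by lra.
have -> : (I (fun x => h (t + s) x * phi x) - I (fun x => h t x * phi x)) / s
   - I (fun x => greent (q t) (u t) (h t) x * phi x) = I (fun x => E x * phi x).
  rewrite -IB; [|by nice_tac|by nice_tac]; rewrite mulrC -IZ; last by nice_tac.
  rewrite -IB; [|by nice_tac|by nice_tac].
  by apply: eq_I => x; rewrite /E; ring.
apply: (@le_trans _ _ (I (fun x => L * d * `|phi x|))).
  apply: I_abs_le; try nice_tac; move=> x.
  by rewrite normrM ler_wpM2r.
rewrite IZ; last by nice_tac.
rewrite -/N /d.
have -> : L * (e / (L * (N + 1))) * N = e * (N / (N + 1)).
  by field; rewrite (lt0r_neq0 L0) lt0r_neq0// ltr_wpDl.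
rewrite ler_piMr//; first exact: ltW.
by rewrite ler_pdivrMr ?ltr_wpDl// mul1r lerDl.
Qed.

End GreenTime.
End Green.

(** * One Backlund step *)

Section OneStep.
Context {R : realType}.
Implicit Types (f phi : R -> R) (c x y t : R).

Lemma wt_near x s c : 0 <= c -> c <= 1 -> x - c <= s <= x -> wt s <= 3 * wt x.
Proof.
move=> c0 c1 /andP[h1 h2]; rewrite /wt -[leRHS]invrK lef_pV2 ?posrE ?oneDsq_gt0//; last first.
  by rewrite invr_gt0 mulr_gt0// invr_gt0 oneDsq_gt0.
rewrite invfM invrK mulrC ler_pdivrMr//.
have : (x - s) ^+ 2 <= 1 by rewrite -(expr1n _ 2) lerXn2r// ?nnegrE; lra.
by have := sqr_ge0 (2 * s - x); nra.
Qed.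

Lemma taylor1 f f' (S : R) c x : dv f f' -> 0 <= S -> (forall z, `|f' z| <= S * wt z) ->
  0 <= c -> c <= 1 -> `|f (x - c) - f x| <= 3 * S * c * wt x.
Proof.
move=> df S0 hf c0 c1; have [->|cn] := eqVneq c 0.
  by rewrite subr0 subrr normr0 mulr0 mul0r.
have cp : 0 < c by rewrite lt_def cn.
have [|s /andP[h1 h2] e] := @dv_MVT _ _ _ (x - c) x df; first by lra.
rewrite distrC e normrM.
have -> : x - (x - c) = c by ring.
rewrite (gtr0_norm cp) -[leRHS]mulrA [c * _]mulrC mulrA ler_pM2r//.
have hs : wt s <= 3 * wt x by apply: (wt_near c0 c1); rewrite !ltW.
apply: (le_trans (hf s)); have := ler_wpM2l S0 hs; lra.
Qed.

(** Induction step for the Taylor estimates below. The factor gained by integrating a power is given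
    away, so the constant stays the same at every order. *)
Lemma taylor_step (G G' : R -> R) (S : R) n c : dv G G' -> G 0 = 0 ->
  (forall s, 0 <= s -> s <= 1 -> `|G' s| <= S * s ^+ n) -> 0 <= c -> c <= 1 ->
  `|G c| <= S * c ^+ n.+1.
Proof.
move=> dG G0 hG c0 c1; have [->|cn] := eqVneq c 0.
  by rewrite G0 normr0 exprS mul0r mulr0.
have cp : 0 < c by rewrite lt_def cn.
have [s /andP[h1 h2] e] := dv_MVT dG cp.
have -> : G c = G' s * c by have := e; rewrite G0 !subr0.
have S0 : 0 <= S.
  have := le_trans (normr_ge0 _) (hG 1 ler01 (lexx _)); by rewrite expr1n mulr1.
rewrite normrM (gtr0_norm cp) exprSr mulrA ler_pM2r//.
apply: (le_trans (hG s (ltW h1) _)); first by lra.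
by rewrite ler_wpM2l// lerXn2r ?nnegrE// ltW.
Qed.

Lemma taylor2 f f1 f2 (S : R) c x : dv f f1 -> dv f1 f2 -> 0 <= S ->
  (forall z, `|f2 z| <= S * wt z) -> 0 <= c -> c <= 1 ->
  `|f (x - c) - f x + c * f1 x| <= 3 * S * c ^+ 2 * wt x.
Proof.
move=> d0 d1 S0 h c0 c1.
have dG : dv (fun s => f (- s + x) - f x + s * f1 x) (fun s => - f1 (- s + x) + f1 x).
  have d0' := dv_opp (dv_shift x d0); rewrite /= in d0'.
  by dv_compute; ring.
have -> : 3 * S * c ^+ 2 * wt x = 3 * S * wt x * c ^+ 2 by ring.
rewrite [x - c]addrC; apply: (taylor_step (n := 1) dG) => // [|s s0 s1].
  by rewrite oppr0 add0r mul0r subrr add0r.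
rewrite addrC distrC [- s + x]addrC expr1; apply: (le_trans (taylor1 x d1 S0 h s0 s1)); lra.
Qed.

Lemma taylor3 f f1 f2 f3 (S : R) c x : dv f f1 -> dv f1 f2 -> dv f2 f3 -> 0 <= S ->
  (forall z, `|f3 z| <= S * wt z) -> 0 <= c -> c <= 1 ->
  `|f (x - c) - f x + c * f1 x - c ^+ 2 / 2 * f2 x| <= 3 * S * c ^+ 3 * wt x.
Proof.
move=> d0 d1 d2 S0 h c0 c1.
have dG : dv (fun s => f (- s + x) - f x + s * f1 x - s ^+ 2 / 2 * f2 x)
   (fun s => - (f1 (- s + x) - f1 x + s * f2 x)).
  have d0' := dv_opp (dv_shift x d0); rewrite /= in d0'.
  by dv_compute; field.
have -> : 3 * S * c ^+ 3 * wt x = 3 * S * wt x * c ^+ 3 by ring.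
rewrite [x - c]addrC; apply: (taylor_step (n := 2) dG) => // [|s s0 s1].
  by rewrite oppr0 add0r !expr0n /= !mul0r subrr; ring.
rewrite normrN [- s + x]addrC; apply: (le_trans (taylor2 x d1 d2 S0 h s0 s1)); lra.
Qed.

Lemma taylor4 f f1 f2 f3 f4 (S : R) c x : dv f f1 -> dv f1 f2 -> dv f2 f3 -> dv f3 f4 ->
  0 <= S -> (forall z, `|f4 z| <= S * wt z) -> 0 <= c -> c <= 1 ->
  `|f (x - c) - f x + c * f1 x - c ^+ 2 / 2 * f2 x + c ^+ 3 / 6 * f3 x|
   <= 3 * S * c ^+ 4 * wt x.
Proof.
move=> d0 d1 d2 d3 S0 h c0 c1.
have dG : dv (fun s => f (- s + x) - f x + s * f1 x - s ^+ 2 / 2 * f2 x + s ^+ 3 / 6 * f3 x)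
   (fun s => - (f1 (- s + x) - f1 x + s * f2 x - s ^+ 2 / 2 * f3 x)).
  have d0' := dv_opp (dv_shift x d0); rewrite /= in d0'.
  by dv_compute; field.
have -> : 3 * S * c ^+ 4 * wt x = 3 * S * wt x * c ^+ 4 by ring.
rewrite [x - c]addrC; apply: (taylor_step (n := 3) dG) => // [|s s0 s1].
  by rewrite oppr0 add0r !expr0n /= !mul0r subrr; ring.
rewrite normrN [- s + x]addrC; apply: (le_trans (taylor3 x d1 d2 d3 S0 h s0 s1)); lra.
Qed.

Lemma I_wt_shift_le f (C : R) y : nice f -> (forall x, `|f x| <= C * wt (x - y)) ->
  `|I f| <= C * pi.
Proof.
move=> nf hf; rewrite (le_trans (I_abs nf))//.
by have [_ h] := I_wt_shift (nice_cont nf) hf.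
Qed.

Lemma I_prod_le f g (d : R) : 0 < d -> nice f -> nice g ->
  I (fun x => f x ^+ 2) <= d ^+ 2 ->
  I (fun x => `|f x * g x|) <= d * ((1 + I (fun x => g x ^+ 2)) / 2).
Proof.
move=> d0 nf ng hf; have dn : d != 0 by exact: lt0r_neq0.
apply: (@le_trans _ _ (I (fun x => (2 * d)^-1 * f x ^+ 2 + d / 2 * g x ^+ 2))).
  apply: I_le; try nice_tac; move=> x; rewrite normrM.
  have h : 0 <= (`|f x| - d * `|g x|) ^+ 2 / (2 * d) by nonneg_tac.
  have e : (`|f x| - d * `|g x|) ^+ 2 / (2 * d) =
     (2 * d)^-1 * `|f x| ^+ 2 + d / 2 * `|g x| ^+ 2 - `|f x| * `|g x| by field.
  by move: h; rewrite e !real_normK ?num_real//; lra.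
rewrite ID; [|by nice_tac|by nice_tac]; rewrite !IZ; [|by nice_tac|by nice_tac].
have d2 : 0 <= (2 * d)^-1 by nonneg_tac.
have := ler_wpM2l d2 hf; have -> : (2 * d)^-1 * d ^+ 2 = d / 2 by field.
lra.
Qed.

Lemma I_wt_sq y : nice (fun x => wt (x - y)) /\ I (fun x => wt (x - y) ^+ 2) <= 4.
Proof.
have cw : continuous (fun x => wt (x - y)) by apply: (dv_continuous (dv_shift (- y) dv_wt)).
have [|nw _] := @I_wt_shift _ (fun x => wt (x - y)) 1 y cw.
  by move=> x; rewrite mul1r ger0_norm ?wt_ge0.
split => //; apply: (le_trans (ler_norm _)).
have n2 : nice (fun x => wt (x - y) ^+ 2) by nice_tac.
have : `|I (fun x => wt (x - y) ^+ 2)| <= 1 * pi.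
  apply: (I_wt_shift_le n2) => x; rewrite mul1r ger0_norm ?sqr_ge0//; exact: wt_sq_le.
by rewrite mul1r; have := @pihalf_lt2 R; lra.
Qed.

Lemma pi_le4 : pi <= 4 :> R.
Proof. by have := @pihalf_lt2 R; lra. Qed.

(** A pure inequality between numbers, with the integrals replaced by variables so that linear
    arithmetic meets few atoms. [remainder_arith] and [increment_arith] play the same part for the
    estimate of one step. *)
Lemma drift_arith (k S A1 A2 A3 B1 C0 : R) : 16 <= k -> 0 <= S ->
  `|A1| <= 5 / 2 * S * 1 -> `|A2| <= S * 1 -> `|A3| <= S * 1 ^+ 2 -> `|B1| <= 5 / 2 * S * 1 ->
  `|C0| <= S * (2 + 12 * k ^+ 2) * 4 ->
  `|C0 + 6 * (2 * k * A1 + A3 - A2 - B1)| <= 200 * S * (1 + k ^+ 2).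
Proof.
move=> k16 S0 a1 a2 a3 b1 c2.
apply: (le_trans (ler_normD _ _)).
have d1 : `|6 * (2 * k * A1 + A3 - A2 - B1)| <= 6 * (2 * k * (5 / 2 * S) + S + S + 5 / 2 * S).
  rewrite normrM (ger0_norm (ler0n _ 6)) ler_pM2l//.
  apply: (le_trans (ler_normB _ _)); apply: lerD; last by lra.
  apply: (le_trans (ler_normB _ _)); apply: lerD; last by lra.
  apply: (le_trans (ler_normD _ _)); apply: lerD; last by rewrite expr1n in a3; lra.
  have k2 : 0 <= 2 * k by lra.
  by rewrite normrM (ger0_norm k2) ler_wpM2l//; lra.
have kS : k * S <= k ^+ 2 * S by rewrite ler_wpM2r// expr2 ler_peMl//; lra.
have kS2 : 0 <= k ^+ 2 * S by nonneg_tac.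
lra.
Qed.

Lemma normM_le (b z C : R) : 0 <= b -> `|z| <= C -> `|b * z| <= b * C.
Proof. by move=> b0 hz; rewrite normrM (ger0_norm b0) ler_wpM2l. Qed.

Lemma remainder_arith (a c k K S w r4 r2 r3 p1 p2 : R) :
  0 <= a -> 0 <= c -> c <= 1 -> a <= 2 * c ^+ 2 -> 0 <= a * K -> a * K <= 2 * c -> 0 <= w -> 0 <= S -> 0 <= k ->
  `|r4| <= 3 * S * c ^+ 4 * w -> `|r2| <= 3 * S * c ^+ 2 * w -> `|r3| <= 3 * S * c ^+ 3 * w ->
  `|p1| <= S * w -> `|p2| <= S * w ->
  `|r4 + a / 2 * r2 + a * K * r3 + k ^+ 4 * a * c ^+ 3 * p1 - k ^+ 2 * a * c ^+ 2 / 2 * p2| <=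
  S * c ^+ 4 * (12 + 2 * k ^+ 4 + k ^+ 2) * w.
Proof.
move=> a0 c0 c1 a2 aK0 acK w0 S0 k0 m0 h2 h3 h1' h2'.
have m1 : `|a / 2 * r2| <= c ^+ 2 * (3 * S * c ^+ 2 * w).
  apply: (le_trans (normM_le _ h2)); first by nonneg_tac.
  by rewrite ler_wpM2r//; [nonneg_tac|lra].
have m2 : `|a * K * r3| <= 2 * c * (3 * S * c ^+ 3 * w).
  apply: (le_trans (normM_le aK0 h3)).
  by rewrite ler_wpM2r//; nonneg_tac.
have m3 : `|k ^+ 4 * a * c ^+ 3 * p1| <= 2 * k ^+ 4 * c ^+ 4 * (S * w).
  apply: (le_trans (normM_le _ h1')); first by nonneg_tac.
  rewrite ler_wpM2r//; first by nonneg_tac.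
  have -> : k ^+ 4 * a * c ^+ 3 = k ^+ 4 * c ^+ 3 * a by ring.
  apply: (@le_trans _ _ (k ^+ 4 * c ^+ 3 * (2 * c ^+ 2))).
    by rewrite ler_wpM2l//; nonneg_tac.
  have -> : k ^+ 4 * c ^+ 3 * (2 * c ^+ 2) = 2 * k ^+ 4 * c ^+ 4 * c by ring.
  by rewrite ler_piMr//; nonneg_tac.
have m4 : `|k ^+ 2 * a * c ^+ 2 / 2 * p2| <= k ^+ 2 * c ^+ 4 * (S * w).
  apply: (le_trans (normM_le _ h2')); first by nonneg_tac.
  rewrite ler_wpM2r//; first by nonneg_tac.
  have -> : k ^+ 2 * a * c ^+ 2 / 2 = k ^+ 2 * c ^+ 2 / 2 * a by ring.
  have -> : k ^+ 2 * c ^+ 4 = k ^+ 2 * c ^+ 2 / 2 * (2 * c ^+ 2) by field.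
  by rewrite ler_wpM2l//; nonneg_tac.
apply: (le_trans (ler_normB _ _)).
apply: (le_trans (lerD (ler_normD _ _) (lexx _))).
apply: (le_trans (lerD (lerD (ler_normD _ _) (lexx _)) (lexx _))).
apply: (le_trans (lerD (lerD (lerD (ler_normD _ _) (lexx _)) (lexx _)) (lexx _))).
lra.
Qed.

Lemma increment_arith (a c k S d X0 X1 X2 X3 X4 X5 : R) :
  0 <= a -> 0 <= c -> c <= 1 -> a <= 2 * c ^+ 2 -> 0 <= S -> 0 <= k -> 0 < d -> d <= 1 ->
  `|X0| <= S * c ^+ 4 * (12 + 2 * k ^+ 4 + k ^+ 2) * 4 ->
  `|X1| <= 5 / 2 * (3 * S * c) * d -> `|X2| <= 5 / 2 * S * d -> `|X3| <= S * d ->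
  `|X4| <= S * d ^+ 2 -> `|X5| <= 5 / 2 * S * d ->
  `|X0 + a * X1 + k ^+ 2 * a * c ^+ 2 * X2 - c ^+ 3 / 2 * (X4 - X3 - X5)| <=
  c ^+ 3 / 12 * (2000 * S * (1 + k ^+ 2 + k ^+ 4) * (c + d)).
Proof.
move=> a0 c0 c1 a2 S0 k0 d0 d1 B0 A1 A2 A3 A4 A5.
have b1 : `|a * X1| <= 15 * S * c ^+ 3 * d.
  apply: (le_trans (normM_le a0 A1)).
  have -> : 15 * S * c ^+ 3 * d = 2 * c ^+ 2 * (5 / 2 * (3 * S * c) * d) by field.
  by rewrite ler_wpM2r//; nonneg_tac.
have b2 : `|k ^+ 2 * a * c ^+ 2 * X2| <= 5 * k ^+ 2 * S * c ^+ 3 * d.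
  apply: (le_trans (normM_le _ A2)); first by nonneg_tac.
  apply: (@le_trans _ _ (k ^+ 2 * (2 * c ^+ 2) * c ^+ 2 * (5 / 2 * S * d))).
    rewrite ler_wpM2r//; first by nonneg_tac.
    by rewrite ler_wpM2r//; [nonneg_tac|rewrite ler_wpM2l//; nonneg_tac].
  have -> : k ^+ 2 * (2 * c ^+ 2) * c ^+ 2 * (5 / 2 * S * d) = 5 * k ^+ 2 * S * c ^+ 3 * d * c by field.
  by rewrite ler_piMr//; nonneg_tac.
have b3 : `|c ^+ 3 / 2 * (X4 - X3 - X5)| <= c ^+ 3 / 2 * (5 * S * d).
  apply: normM_le; first by nonneg_tac.
  apply: (le_trans (ler_normB _ _)).
  apply: (le_trans (lerD (ler_normB _ _) (lexx _))).
  have Sd : S * d ^+ 2 <= S * d by rewrite expr2 ler_wpM2l// ler_piMr//; exact: ltW.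
  have Sd0 : 0 <= S * d by rewrite mulr_ge0//; exact: ltW.
  lra.
apply: (le_trans (ler_normB _ _)).
apply: (le_trans (lerD (ler_normD _ _) (lexx _))).
apply: (le_trans (lerD (lerD (ler_normD _ _) (lexx _)) (lexx _))).
have p0 : 0 <= S * c ^+ 4 by nonneg_tac.
have p1 : 0 <= S * c ^+ 4 * k ^+ 2 by nonneg_tac.
have p2 : 0 <= S * c ^+ 4 * k ^+ 4 by nonneg_tac.
have p3 : 0 <= S * c ^+ 3 * d by nonneg_tac.
have p4 : 0 <= S * c ^+ 3 * d * k ^+ 2 by nonneg_tac.
have p5 : 0 <= S * c ^+ 3 * d * k ^+ 4 by nonneg_tac.
lra.
Qed.

Definition shiftf y phi : R -> R := fun x => phi (x - y).

Lemma shiftf_d y f f' : dv f f' -> (shiftf y f)^`() = shiftf y f'.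
Proof. by move=> df; apply: dv_derive1E; exact: (dv_shift (- y) df). Qed.

Lemma sch_shiftf y f : sch f -> sch (shiftf y f).
Proof.
by move=> /schP sf; apply/schP; exact: (schwartz_shift_subproof (- y) sf).
Qed.

Section Step.
Variables (k : R) (phi p1 p2 p3 p4 : R -> R) (S : R).
Hypotheses (k16 : 16 <= k) (sphi : sch phi)
  (dp1 : dv phi p1) (dp2 : dv p1 p2) (dp3 : dv p2 p3) (dp4 : dv p3 p4) (S0 : 0 <= S)
  (hS1 : forall x, `|p1 x| <= S * wt x)
  (hS2 : forall x, `|p2 x| <= S * wt x)
  (hS3 : forall x, `|p3 x| <= S * wt x)
  (hS4 : forall x, `|p4 x| <= S * wt x).

Let s1 : sch p1. Proof. by rewrite -(dv_derive1E dp1); exact: sch_d. Qed.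
Let s2 : sch p2. Proof. by rewrite -(dv_derive1E dp2); exact: sch_d s1. Qed.
Let s3 : sch p3. Proof. by rewrite -(dv_derive1E dp3); exact: sch_d s2. Qed.

Variables (q u h : R -> R).
Hypotheses (sq : sch q) (ru : Ric k q u) (Iu : I (fun x => u x ^+ 2) <= 1) (gh : green k u h).

Let k0 : 0 < k. Proof. have := k16; lra. Qed.
Let su : sch u. Proof. by have [] := ru. Qed.
Let sh : sch h. Proof. by have [] := gh. Qed.
Let h1 x := (2 * k + 2 * u x) * h x + u x / k.
Let dh : dv h h1. Proof. by have [] := gh. Qed.
Let nh1 : nice h1. Proof. by have su1 := su; have sh1 := sh; rewrite /h1; nice_tac. Qed.

Let g_le1 x : `|gf k h x| <= 1.
Proof.
apply: (le_trans (gf_sup x k16 su Iu gh)); have k0' := k0; have k16' := k16.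
by rewrite ler_pdivrMr//; lra.
Qed.

Let h_le1 x : `|h x| <= 1.
Proof.
have -> : h x = gf k h x - (2 * k)^-1 by rewrite /gf; ring.
apply: (le_trans (ler_normB _ _)); have h2 := gf_sup x k16 su Iu gh.
have k0' := k0; have k16' := k16.
have h3 : 4 / k <= 4^-1 by rewrite ler_pdivrMr//; lra.
have h4 : `|(2 * k)^-1| <= 4^-1.
  rewrite ger0_norm; last by nonneg_tac.
  by rewrite lef_pV2 ?posrE//; lra.
by lra.
Qed.

Let Ih1 : I (fun x => h1 x ^+ 2) <= 1.
Proof.
have := green_L2 k16 su Iu gh; have k0' := k0; have k16' := k16.
have n1 : 0 <= 4 * k ^+ 2 * I (fun x => h x ^+ 2).
  by rewrite mulr_ge0//; [nonneg_tac|apply: I_ge0 => x; exact: sqr_ge0].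
have n2 : 64 / k ^+ 2 * I (fun x => u x ^+ 2) <= 1.
  have i0 : 0 <= I (fun x => u x ^+ 2) by apply: I_ge0 => x; exact: sqr_ge0.
  have : 64 / k ^+ 2 <= 1 by rewrite ler_pdivrMr ?exprn_gt0//; nra.
  have e0 : 0 <= 64 / k ^+ 2 by nonneg_tac.
  by move=> h2; have := ler_pM e0 i0 h2 Iu; lra.
by rewrite -/h1 /h1; lra.
Qed.

Section Flux.
Variables (K d y : R) (U : R -> R).
Hypotheses (rU : Ric K q U) (d0 : 0 < d) (IU : I (fun x => U x ^+ 2) <= d ^+ 2).

Let sU : sch U. Proof. by have [] := rU. Qed.
Let dU : dv U (fun x => q x - 2 * K * U x - U x ^+ 2). Proof. by have [] := rU. Qed.

(** Each factor [U] is worth [d] in L^2, while [gf] is bounded by 1 and [h1] by 1 in L^2. The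
    constant [5 / 2] is [(1 + 4) / 2], where 4 bounds the integral of the squared weight. *)
Lemma flux_bounds (m : R -> R) (M : R) : nice m -> (forall x, `|m x| <= M * wt (x - y)) ->
  [/\ `|I (fun x => U x * gf k h x * m x)| <= 5 / 2 * M * d,
      `|I (fun x => U x * h1 x * m x)| <= M * d &
      `|I (fun x => U x ^+ 2 * gf k h x * m x)| <= M * d ^+ 2].
Proof.
move=> nm hm; have sU1 := sU; have bg := bddc_gf k sh; have n1 := nh1.
have M0 : 0 <= M by have := le_trans (normr_ge0 _) (hm 0); rewrite pmulr_lge0// wt_gt0.
have [nw Iw] := I_wt_sq y.
have mM x : `|m x| <= M.
  by apply: (le_trans (hm x)); rewrite ler_piMr// wt_le1.
split.
- have h2 := I_prod_le d0 (sch_nice sU) nw IU.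
  apply: (@le_trans _ _ (I (fun x => M * `|U x * wt (x - y)|))).
    apply: I_abs_le; try nice_tac; move=> x.
    rewrite !normrM [`|wt _|]ger0_norm ?wt_ge0// mulrCA -mulrA ler_wpM2l//.
    rewrite -[leRHS]mul1r; apply: ler_pM => //.
  rewrite IZ; last by nice_tac.
  have := ler_wpM2l M0 h2; have d0' := d0.
  have : d * ((1 + I (fun x => wt (x - y) ^+ 2)) / 2) <= d * (5 / 2).
    by rewrite ler_pM2l//; lra.
  move=> h3 h4; have := ler_wpM2l M0 h3; lra.
- have h2 := I_prod_le d0 (sch_nice sU) nh1 IU.
  apply: (@le_trans _ _ (I (fun x => M * `|U x * h1 x|))).
    apply: I_abs_le; try nice_tac; move=> x.
    by rewrite normrM mulrC ler_wpM2r.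
  rewrite IZ; last by nice_tac.
  rewrite ler_wpM2l//; apply: (le_trans h2); rewrite ler_piMr; [by []|exact: ltW|].
  by have := Ih1; lra.
- apply: (@le_trans _ _ (I (fun x => M * U x ^+ 2))).
    apply: I_abs_le; try nice_tac; move=> x.
    rewrite normrM normrM [`|U x ^+ 2|]ger0_norm ?sqr_ge0// -mulrA mulrC ler_wpM2r ?sqr_ge0//.
    by rewrite -[leRHS]mul1r; apply: ler_pM.
  by rewrite IZ; [rewrite ler_wpM2l|nice_tac].
Qed.

(** Inserts $q = U' + 2KU + U^2$ and integrates $U'$ by parts. Only the first term carries the large
    factor $K$. Multiplied by 6 and by the time step it gets the factor $K^{-2}$, which nearly
    cancels the factor $(K^2 - k^2)^{-1}$ coming from [permv_test]. *)
Lemma flux_split chi : sch chi -> I (fun x => q x * gf k h x * chi x) =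
  2 * K * I (fun x => U x * gf k h x * chi x) + I (fun x => U x ^+ 2 * gf k h x * chi x)
  - I (fun x => U x * h1 x * chi x) - I (fun x => U x * gf k h x * chi^`() x).
Proof.
move=> sc; have sU1 := sU; have bg := bddc_gf k sh; have n1 := nh1; have sc1 := sch_d sc.
have sh1 := sh; have d1 := dU; have d2 := dh.
have dg : dv (gf k h) h1 by rewrite /gf; dv_compute; ring.
rewrite -IZ; last by nice_tac.
rewrite -ID; [|by nice_tac|by nice_tac]; rewrite -IB; [|by nice_tac|by nice_tac]; rewrite -IB; [|by nice_tac|by nice_tac].
apply: (I_dv_eq (F := fun x => U x * gf k h x * chi x)); try nice_tac.
by dv_compute; ring.
Qed.

End Flux.

(** The flux is split at level [k] itself, with [u] in the role of [U] and [d = 1]. The bound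
    depends on [k] but not on [q], [K] or [y], and will be the Lipschitz constant in time. *)
Lemma drift_bound y : `|I (fun x => greent k q u h x * shiftf y phi x)|
  <= 200 * S * (1 + k ^+ 2).
Proof.
have sp := sch_shiftf y sphi.
have ss1 := sch_shiftf y s1; have ss2 := sch_shiftf y s2; have ss3 := sch_shiftf y s3.
have sh' := sh; have k0' := k0; have k16' := k16.
have comb (A B w : R) : 0 <= 12 * k ^+ 2 -> A <= S * w -> B <= S * w ->
    2 * A + 12 * k ^+ 2 * B <= S * (2 + 12 * k ^+ 2) * w.
  by move=> kk hA hB; have := ler_wpM2l kk hB; lra.
rewrite (greent_test k16 sq ru gh sp) (shiftf_d y dp1) (shiftf_d y dp2) (shiftf_d y dp3).
have IU1 : I (fun x => u x ^+ 2) <= 1 ^+ 2 by rewrite expr1n.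
rewrite (flux_split ru ss1) (shiftf_d y dp2).
have [a1 a2 a3] := flux_bounds (y := y) ru ltr01 IU1 (sch_nice ss1) (fun x => hS1 (x - y)).
have [b1 _ _] := flux_bounds (y := y) ru ltr01 IU1 (sch_nice ss2) (fun x => hS2 (x - y)).
have c1 : `|I (fun x => h x * (-2 * shiftf y p3 x + 12 * k ^+ 2 * shiftf y p1 x))|
   <= S * (2 + 12 * k ^+ 2) * pi.
  apply: (@I_wt_shift_le _ _ y); first by nice_tac.
  move=> x; rewrite normrM -[leRHS]mul1r; apply: ler_pM => //.
  apply: (le_trans (ler_normD _ _)).
  have kk : 0 <= 12 * k ^+ 2 by nonneg_tac.
  have j1 z : `|- 2 * z| = 2 * `|z| :> R by rewrite normrM normrN (ger0_norm (ler0n _ 2)).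
  have j2 z : `|12 * k ^+ 2 * z| = 12 * k ^+ 2 * `|z| :> R by rewrite normrM (ger0_norm kk).
  rewrite j1 j2; exact: (comb _ _ _ kk (hS3 (x - y)) (hS1 (x - y))).
have S2 : 0 <= S * (2 + 12 * k ^+ 2) by nonneg_tac.
have c2 := le_trans c1 (ler_wpM2l S2 pi_le4).
exact: (drift_arith k16 S0 a1 a2 a3 b1 c2).
Qed.

Section Increment.
Variables (K d y : R) (U hv : R -> R).
Hypotheses (kK : 2 * k <= K) (rU : Ric K q U) (d0 : 0 < d) (d1 : d <= 1)
  (IU : I (fun x => U x ^+ 2) <= d ^+ 2) (gv : green k (permv k K u U) hv).

Let tau := (12 * K ^+ 3)^-1.

(** Put $c = 1/K$ and $a = (K^2 - k^2)^{-1}$. On the part linear in [h], the Backlund step replaces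
    the test function by $1 + aK\partial + (a/2)\partial^2$ applied to its translate by $c$, and KdV
    replaces it by $1 + \tau(-2\partial^3 + 12k^2\partial)$. Taylor expansion shows agreement up to
    $O(c^4)$, which is beyond the size $c^3$ of $\tau$. The terms that contain [U] cancel up to
    $O(c^3 d)$. *)
Lemma one_step : `|I (fun x => hv x * shiftf (y + K^-1) phi x) - I (fun x => h x * shiftf y phi x)
   - tau * I (fun x => greent k q u h x * shiftf y phi x)|
   <= tau * (2000 * S * (1 + k ^+ 2 + k ^+ 4) * (K^-1 + d)).
Proof.
have k0' := k0; have k16' := k16; have kK' := kK; have d0' := d0; have d1' := d1; have S0' := S0.
have sh' := sh; have sU := rU.1.
have K0 : 0 < K by lra.
have Kn : K != 0 by exact: lt0r_neq0.
pose c := K^-1.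
have c0 : 0 < c by rewrite /c invr_gt0.
have c1 : c <= 1 by rewrite /c invf_le1//; lra.
have cn : c != 0 by exact: lt0r_neq0.
have KE : K = c^-1 by rewrite /c invrK.
have KK : 0 < K ^+ 2 - k ^+ 2 by rewrite subr_sqr mulr_gt0; lra.
have KKn : K ^+ 2 - k ^+ 2 != 0 by exact: lt0r_neq0.
pose a := (K ^+ 2 - k ^+ 2)^-1.
have a0 : 0 < a by rewrite /a invr_gt0.
(* The mismatch between the factor $(K^2 - k^2)^{-1}$ of the Backlund step and the factor $K^{-2}$
   of the flow is of order $c^4$. *)
have ac : a - c ^+ 2 = k ^+ 2 * a * c ^+ 2 by rewrite /a /c; field; rewrite KKn Kn.
have a2 : a <= 2 * c ^+ 2.
  have hk : 2 * k ^+ 2 <= K ^+ 2 by nra.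
  have e : 2 * c ^+ 2 = (K ^+ 2 / 2)^-1 by rewrite /c; field.
  by rewrite e /a lef_pV2 ?posrE ?divr_gt0 ?exprn_gt0//; lra.
have acK : a * K <= 2 * c.
  by have := ler_wpM2r (ltW K0) a2; rewrite (_ : 2 * c ^+ 2 * K = 2 * c)// KE; field.
have aK0 : 0 <= a * K by rewrite mulr_ge0// ltW.
pose r4 x := phi (x - c) - phi x + c * p1 x - c ^+ 2 / 2 * p2 x + c ^+ 3 / 6 * p3 x.
pose r3 x := p1 (x - c) - p1 x + c * p2 x - c ^+ 2 / 2 * p3 x.
pose r2 x := p2 (x - c) - p2 x + c * p3 x.
have h4 x : `|r4 x| <= 3 * S * c ^+ 4 * wt x.
  exact: (taylor4 x dp1 dp2 dp3 dp4 S0 hS4 (ltW c0) c1).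
have h3 x : `|r3 x| <= 3 * S * c ^+ 3 * wt x.
  exact: (taylor3 x dp2 dp3 dp4 S0 hS4 (ltW c0) c1).
have h2 x : `|r2 x| <= 3 * S * c ^+ 2 * wt x.
  exact: (taylor2 x dp3 dp4 S0 hS4 (ltW c0) c1).
have hd x : `|p1 (x - c) - p1 x| <= 3 * S * c * wt x.
  exact: (taylor1 x dp2 S0 hS2 (ltW c0) c1).
have sc : sch (shiftf (y + c) phi) by exact: sch_shiftf.
have sc1 : sch (shiftf (y + c) p1) by exact: sch_shiftf.
have sc2 : sch (shiftf (y + c) p2) by exact: sch_shiftf.
have t0 : sch (shiftf y phi) by exact: sch_shiftf.
have t1 : sch (shiftf y p1) by exact: sch_shiftf.
have t2 : sch (shiftf y p2) by exact: sch_shiftf.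
have t3 : sch (shiftf y p3) by exact: sch_shiftf.
have kltK : k < K by lra.
have shv := gv.1.
have bg := bddc_gf k sh.
have e1 : I (fun x => hv x * shiftf (y + c) phi x) = I (fun x => h x * (shiftf (y + c) phi x
    + a / 2 * shiftf (y + c) p2 x + a * K * shiftf (y + c) p1 x)) +
    a * I (fun x => U x * gf k h x * shiftf (y + c) p1 x).
  have := permv_test k0 kltK sq ru rU gh gv sc.
  rewrite (shiftf_d _ dp1) (shiftf_d _ dp2) => e.
  have := congr1 (fun z => a * z) e; rewrite mulrA /a mulVf// mul1r -/a => ->.
  rewrite mulrDr -(IZ a); last by nice_tac.
  congr (_ + _); apply: eq_I => x; rewrite /a; field; exact: KKn.
have e2 := greent_test k16 sq ru gh t0.
rewrite (shiftf_d _ dp1) (shiftf_d _ dp2) (shiftf_d _ dp3) in e2.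
have e3 := flux_split rU t1; rewrite (shiftf_d _ dp2) in e3.
have nc : nice (fun x => shiftf (y + c) p1 x - shiftf y p1 x) by nice_tac.
have hc x : `|shiftf (y + c) p1 x - shiftf y p1 x| <= 3 * S * c * wt (x - y).
  by rewrite /shiftf; have := hd (x - y); rewrite (_ : x - y - c = x - (y + c))//; ring.
have [A1 _ _] := flux_bounds rU d0 IU nc hc.
have [A2 A3 A4] := flux_bounds (y := y) rU d0 IU (sch_nice t1) (fun x => hS1 (x - y)).
have [A5 _ _] := flux_bounds (y := y) rU d0 IU (sch_nice t2) (fun x => hS2 (x - y)).
have tauE : tau = c ^+ 3 / 12 by rewrite /tau /c; field.
(* The Taylor remainders, together with the coefficients that do not cancel exactly: for $\phi'$ the
   difference of $aK - c = k^2 a c$ and $k^2 c^3$, and for $\phi''$ the half of $c^2 - a$. *)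
pose Rm x := r4 (x - y) + a / 2 * r2 (x - y) + a * K * r3 (x - y)
   + k ^+ 4 * a * c ^+ 3 * shiftf y p1 x - k ^+ 2 * a * c ^+ 2 / 2 * shiftf y p2 x.
have nRm : nice Rm.
  have q0 := sch_shiftf c sphi; have q1 := sch_shiftf c s1; have q2 := sch_shiftf c s2.
  have nr (f : R -> R) : sch f -> sch (fun x => f (x - y)) by move=> sf; exact: sch_shiftf.
  have sr4 : sch r4.
    by rewrite /r4; move: q0; rewrite /shiftf => q0; sch_tac.
  have sr3 : sch r3.
    by rewrite /r3; move: q1; rewrite /shiftf => q1; sch_tac.
  have sr2 : sch r2.
    by rewrite /r2; move: q2; rewrite /shiftf => q2; sch_tac.
  have z4 := nr _ sr4; have z3 := nr _ sr3; have z2 := nr _ sr2.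
  by rewrite /Rm; nice_tac.
have main : I (fun x => hv x * shiftf (y + c) phi x) - I (fun x => h x * shiftf y phi x)
   - tau * I (fun x => greent k q u h x * shiftf y phi x) =
  I (fun x => h x * Rm x) + a * I (fun x => U x * gf k h x * (shiftf (y + c) p1 x - shiftf y p1 x))
  + k ^+ 2 * a * c ^+ 2 * I (fun x => U x * gf k h x * shiftf y p1 x)
  - c ^+ 3 / 2 * (I (fun x => U x ^+ 2 * gf k h x * shiftf y p1 x)
      - I (fun x => U x * h1 x * shiftf y p1 x) - I (fun x => U x * gf k h x * shiftf y p2 x)).
  rewrite e1 e2 e3.
  have -> : I (fun x => U x * gf k h x * (shiftf (y + c) p1 x - shiftf y p1 x)) =
     I (fun x => U x * gf k h x * shiftf (y + c) p1 x) - I (fun x => U x * gf k h x * shiftf y p1 x).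
    by rewrite -IB; [|by nice_tac|by nice_tac]; apply: eq_I => x; ring.
  have -> : I (fun x => h x * Rm x) = I (fun x => h x * (shiftf (y + c) phi x
    + a / 2 * shiftf (y + c) p2 x + a * K * shiftf (y + c) p1 x)) -
    I (fun x => h x * shiftf y phi x) - tau * I (fun x => h x * (-2 * shiftf y p3 x +
      12 * k ^+ 2 * shiftf y p1 x)).
    rewrite -IZ; last by nice_tac.
    rewrite -IB; [|by nice_tac|by nice_tac]; rewrite -IB; [|by nice_tac|by nice_tac].
    apply: eq_I => x; rewrite /Rm /r4 /r3 /r2 /shiftf tauE.
    have -> : x - (y + c) = x - y - c by ring.
    have aE : a * K = c + k ^+ 2 * a * c.
      move: (a) ac => b hb; rewrite KE.
      have -> : b * c^-1 = (b - c ^+ 2) / c + c by field; exact: cn.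
      by rewrite hb; field; exact: cn.
    have c2E : c ^+ 2 = a - k ^+ 2 * a * c ^+ 2 by rewrite -ac; ring.
    have k4 : k ^+ 4 * a * c ^+ 3 = k ^+ 2 * a * c - k ^+ 2 * c ^+ 3.
      have -> : k ^+ 4 * a * c ^+ 3 = k ^+ 2 * c * (k ^+ 2 * a * c ^+ 2) by ring.
      by rewrite -ac; ring.
    have c1E : a * K * c = a by rewrite -mulrA /c divff// mulr1.
    rewrite k4.
    move: (phi (x - y - c)) (phi (x - y)) (p1 (x - y - c)) (p1 (x - y))
      (p2 (x - y - c)) (p2 (x - y)) (p3 (x - y)) => a0' b0' a1' b1' a2' b2' b3'.
    have -> : k ^+ 2 * a * c ^+ 2 / 2 = (a - c ^+ 2) / 2 by rewrite -ac.
    have -> : a * K * (a1' - b1' + c * b2' - c ^+ 2 / 2 * b3') =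
      a * K * a1' - (c + k ^+ 2 * a * c) * b1' + a * b2' - a * c / 2 * b3'.
      rewrite -aE; transitivity (a * K * a1' - a * K * b1' + a * K * c * b2' - a * K * c * c / 2 * b3').
        by move: (a * K) => b; field.
      by rewrite c1E.
    by field.
  rewrite tauE -ac.
  move: (I _) => Z1; move: (I (fun x => U x * gf k h x * shiftf (y + c) p1 x)) => Z2.
  move: (I (fun x => h x * shiftf y phi x)) => Z3.
  move: (I (fun x => h x * (_ + _))) => Z4.
  move: (I (fun x => U x * gf k h x * shiftf y p1 x)) (I (fun x => U x ^+ 2 * _ * _)) => Z5 Z6.
  move: (I (fun x => U x * gf k h x * shiftf y p2 x)) => Z8.
  move: (I (fun x => U x * h1 x * shiftf y p1 x)) => Z7.
  by rewrite KE; field; exact: cn.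
have a0' : 0 <= a by exact: ltW.
have c0' : 0 <= c by exact: ltW.
have hRm x : `|Rm x| <= S * c ^+ 4 * (12 + 2 * k ^+ 4 + k ^+ 2) * wt (x - y).
  exact: (remainder_arith a0' c0' c1 a2 aK0 acK (wt_ge0 (x - y)) S0 (ltW k0) (h4 _) (h2 _) (h3 _) (hS1 _) (hS2 _)).
have B0 : `|I (fun x => h x * Rm x)| <= S * c ^+ 4 * (12 + 2 * k ^+ 4 + k ^+ 2) * 4.
  apply: (le_trans (I_wt_shift_le (C := S * c ^+ 4 * (12 + 2 * k ^+ 4 + k ^+ 2)) (y := y) _ _)).
  - by nice_tac.
  - move=> x; rewrite normrM -[leRHS]mul1r; apply: ler_pM; [by []|by []|exact: h_le1|exact: hRm].
  - rewrite ler_wpM2l//; [by clear -S0 c0 k0'; nonneg_tac|exact: pi_le4].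
rewrite main tauE -/c.
exact: (increment_arith a0' c0' c1 a2 S0 (ltW k0) d0 d1 B0 A1 A2 A3 A4 A5).
Qed.

End Increment.
End Step.
End OneStep.

(** * Iterated Backlund steps and the KdV flow *)

Section ShiftedLines.
Context {R : realType}.

(* The functions $F_j$ vary by $\tau J_j$ from one index to the next and by
   $J_j$ per unit of time, so $F_j(t)$ is nearly constant on the lines
   $t + j\tau = $ const.  As nothing is known on the regularity of $J_j$, this is
   checked on averages over time intervals of length $s$. *)
Lemma shifted_lines (F J : nat -> R -> R) (C tau ep s : R) N :
  (forall j, dv (F j) (J j)) -> 0 < s -> 0 < tau ->
  (forall j t, `|J j t| <= C) ->
  (forall j t, (j < N)%N -> `|F j.+1 t - F j t - tau * J j t| <= tau * ep) ->
  `|F N 0 - F 0%N (N%:R * tau)| <= N%:R * tau * (ep + 2 * C * tau / s) + 2 * C * s.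
Proof.
move=> dF s0 t0 hJ hF; have C0 : 0 <= C := le_trans (normr_ge0 _) (hJ 0%N 0).
have [G dG] : exists G : nat -> R -> R, forall j, dv (G j) (F j).
  have [G hG] := choice (fun j => antiderivative (dv_continuous (dF j))).
  by exists G.
(* [Y j a] is [s] times the average of [F j] over [[a, a + s]]. *)
pose Y j a := G j (a + s) - G j a.
have Flip j x z : `|F j z - F j x| <= C * `|z - x| by exact: dv_lip (dF j) (hJ j).
have nsh (a : R) : `|a + s - a| = s.
  by rewrite (_ : a + s - a = s); [rewrite gtr0_norm|ring].
have YF j a : `|Y j a - s * F j a| <= C * s * s.
  have [|c /andP[c1 c2] e] := @dv_MVT _ _ _ a (a + s) (dG j); first by lra.
  have -> : Y j a - s * F j a = (F j c - F j a) * s by rewrite /Y e; ring.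
  rewrite normrM (gtr0_norm s0) ler_pM2r//; apply: (le_trans (Flip j a c)).
  by rewrite ler_wpM2l// ger0_norm; lra.
have step j a : (j < N)%N -> `|Y j.+1 a - Y j (a + tau)| <= tau * (ep * s + 2 * C * tau).
  move=> jN.
  have b1 : `|(Y j.+1 a - Y j a) - tau * (F j (a + s) - F j a)| <= tau * ep * s.
    have dH : dv (fun x => G j.+1 x - G j x - tau * F j x) (fun x => F j.+1 x - F j x - tau * J j x).
      by have g1 := dG j.+1; have g2 := dG j; have g3 := dF j; dv_compute; ring.
    have := dv_lip a (a + s) dH (fun x => hF j x jN); rewrite nsh; congr (`|_| <= _).
    by rewrite /Y; ring.
  (* After averaging, a step in the index and a shift in time both produce [tau] times the same
     increment [F j (a + s) - F j a]. It cancels, so [J j] is never compared at two different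
     times. *)
  have b2 : `|(Y j (a + tau) - Y j a) - tau * (F j (a + s) - F j a)| <= 2 * C * tau * tau.
    have dH : dv (fun x => G j (x + s) - G j x - (F j (a + s) - F j a) * x)
        (fun x => F j (x + s) - F j x - (F j (a + s) - F j a)).
      by have g1 := dG j; have g2 := dv_shift s (dG j); dv_compute; ring.
    have [|c /andP[c1 c2] e] := @dv_MVT _ _ _ a (a + tau) dH; first by lra.
    have -> : (Y j (a + tau) - Y j a) - tau * (F j (a + s) - F j a) =
      ((F j (c + s) - F j (a + s)) - (F j c - F j a)) * tau.
      have -> : (F j (c + s) - F j (a + s)) - (F j c - F j a) =
         F j (c + s) - F j c - (F j (a + s) - F j a) by ring.
      have -> : tau = a + tau - a by ring.
      by rewrite -e /Y (_ : a + (a + tau - a) = a + tau); ring.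
    rewrite normrM (gtr0_norm t0) ler_pM2r//; apply: (le_trans (ler_normB _ _)).
    have ca : `|c - a| <= tau by rewrite ger0_norm; lra.
    have h1 := Flip j (a + s) (c + s); have h2 := Flip j a c.
    rewrite (_ : c + s - (a + s) = c - a) in h1; last by ring.
    have := ler_wpM2l C0 ca; lra.
  have -> : Y j.+1 a - Y j (a + tau) = ((Y j.+1 a - Y j a) - tau * (F j (a + s) - F j a)) -
     ((Y j (a + tau) - Y j a) - tau * (F j (a + s) - F j a)) by ring.
  by apply: (le_trans (ler_normB _ _)); lra.
have tel n : (n <= N)%N -> forall a, `|Y n a - Y 0%N (a + n%:R * tau)| <= n%:R * (tau * (ep * s + 2 * C * tau)).
  elim: n => [_ a|n IH nN a]; first by rewrite !mul0r addr0 subrr normr0.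
  have -> : Y n.+1 a - Y 0%N (a + n.+1%:R * tau) = (Y n.+1 a - Y n (a + tau)) +
     (Y n (a + tau) - Y 0%N (a + tau + n%:R * tau)).
    have -> : a + n.+1%:R * tau = a + tau + n%:R * tau by rewrite -natr1; ring.
    by ring.
  apply: (le_trans (ler_normD _ _)); have := step n a nN; have := IH (ltnW nN) (a + tau).
  by rewrite -[n.+1%:R]natr1; lra.
have := tel N (leqnn N) 0; rewrite add0r => hY.
have h1 := YF N 0; have h2 := YF 0%N (N%:R * tau).
have e : s * `|F N 0 - F 0%N (N%:R * tau)| <= N%:R * (tau * (ep * s + 2 * C * tau)) + C * s * s + C * s * s.
  rewrite -(gtr0_norm s0) -normrM (gtr0_norm s0).
  have -> : s * (F N 0 - F 0%N (N%:R * tau)) = (Y N 0 - Y 0%N (N%:R * tau)) - (Y N 0 - s * F N 0)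
    + (Y 0%N (N%:R * tau) - s * F 0%N (N%:R * tau)) by ring.
  apply: (le_trans (ler_normD _ _)); apply: lerD => //.
  by apply: (le_trans (ler_normB _ _)); apply: lerD.
rewrite -(ler_pM2l s0); apply: (le_trans e); rewrite le_eqVlt; apply/orP; left; apply/eqP.
by field; exact: lt0r_neq0.
Qed.

End ShiftedLines.

Section Flow.
Context {R : realType}.
Implicit Types (k K d : R) (q u phi : R -> R).

(** Smallness at frequency [k], in the form conserved by KdV and by Backlund transformations of
    larger parameter. [Ric_Hsm] and [riccati_exists] compare it with [Hsm] up to constants. *)
Definition rsm k d q := exists u, Ric k q u /\ I (fun x => u x ^+ 2) <= d.

(* Zero when there is no solution. *)
Definition ricsol k q : R -> R := xget (fun=> 0) [set u | Ric k q u].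
Definition hsol k q : R -> R := xget (fun=> 0) [set h | green k (ricsol k q) h].
Definition backlund_op K q : R -> R := backlund K q (ricsol K q).
Definition obs k q phi : R := I (fun x => hsol k q x * phi x).

Lemma ricsolP k q u : 0 < k -> Ric k q u -> ricsol k q = u.
Proof.
move=> k0 ru; have h : Ric k q (ricsol k q) by exact: (@xgetI _ _ [set u | Ric k q u] u ru).
by apply/funext => x; exact: (Ric_unique k0 h ru x).
Qed.

Lemma rsm_ricsol k d q : 0 < k -> rsm k d q ->
  Ric k q (ricsol k q) /\ I (fun x => ricsol k q x ^+ 2) <= d.
Proof. by move=> k0 [u [ru Iu]]; rewrite (ricsolP k0 ru). Qed.

Lemma hsolP k d q : 0 < k -> rsm k d q -> green k (ricsol k q) (hsol k q).
Proof.
move=> k0 hq; have [[su _] _] := rsm_ricsol k0 hq.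
by have [h hh] := green_exists k0 su; exact: (@xgetI _ _ [set h | green k _ h] h hh).
Qed.

(** The passage goes through [Hsm], which is monotone in the parameter; each of the two conversions
    costs a factor 4. *)
Lemma rsm_up k K d q : 16 <= k -> k <= K -> 0 <= d -> d <= 256^-1 -> sch q -> rsm k d q ->
  rsm K (16 * d) q.
Proof.
move=> k16 kK d0 d1 sq [u [ru Iu]].
have k1 : 1 <= k by lra.
have d2 : d <= 1 by lra.
have k0 : 0 <= k by lra.
have d4 : 0 <= 4 * d by lra.
have hK := Hsm_le d4 k0 kK (Ric_Hsm k1 sq ru Iu d2).
have K16 : 16 <= K by lra.
have d64 : 4 * d <= 64^-1 by lra.
have [v rv Iv] := riccati_exists K16 d4 d64 sq hK.
by exists v; split => //; lra.
Qed.

Lemma sch_backlund_op K D q : 0 < K -> sch q -> rsm K D q -> sch (backlund_op K q).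
Proof. by move=> K0 sq hq; have [[sU _] _] := rsm_ricsol K0 hq; exact: sch_backlund. Qed.

Lemma rsm_backlund_op k d K D q : 0 < k -> k < K -> sch q -> rsm k d q -> rsm K D q ->
  rsm k d (backlund_op K q).
Proof.
move=> k0 kK sq hk hK; have K0 : 0 < K by lra.
have [ru Iu] := rsm_ricsol k0 hk; have [rU _] := rsm_ricsol K0 hK.
exists (permv k K (ricsol k q) (ricsol K q)); split; first exact: permv_Ric.
by rewrite (permv_I k0 kK sq ru rU).
Qed.

(** The Backlund transformation at [K] is known to preserve the integrals only for parameters below
    [K]. Smallness is therefore recorded at [K / 2] and brought up to [K] by [rsm_up] at each step,
    so that the loss does not accumulate. *)
Definition bgood k K d d1 q := [/\ sch q, rsm k d q & rsm (K / 2) d1 q].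

Lemma shiftf0 phi : shiftf 0 phi = phi.
Proof. by apply/funext => x; rewrite /shiftf subr0. Qed.

Section Iterate.
Variables (k K d0 d1 : R).
Hypotheses (k16 : 16 <= k) (kK : 2 * k <= K) (d00 : 0 <= d0) (d01 : d0 <= 1024^-1)
  (d10 : 0 <= d1) (d11 : d1 <= 1024^-1).

Lemma bgood_rsm q : bgood k K d0 d1 q -> rsm K (16 * d1) q.
Proof.
move=> [sq hk h2]; have k16' := k16; have kK' := kK; have d11' := d11.
by apply: (rsm_up _ _ d10 _ sq h2); lra.
Qed.

Lemma bgood_backlund_op q : bgood k K d0 d1 q -> bgood k K d0 d1 (backlund_op K q).
Proof.
move=> hq; have hK := bgood_rsm hq; have [sq hk h2] := hq.
have k16' := k16; have kK' := kK.
split; first by apply: (sch_backlund_op _ sq hK); lra.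
- by apply: (rsm_backlund_op _ _ sq hk hK); lra.
- by apply: (rsm_backlund_op _ _ sq h2 hK); lra.
Qed.

Lemma bgood_iter q n : bgood k K d0 d1 q -> bgood k K d0 d1 (iter n (backlund_op K) q).
Proof. by move=> hq; elim: n => //= n IH; exact: bgood_backlund_op. Qed.

Lemma rsm_flow l d (q : R -> R -> R) : 16 <= l -> d <= 1024^-1 -> kdvsol q ->
  rsm l d (q 0) -> forall t, rsm l d (q t).
Proof.
move=> l16 dd hq [v [rv Iv]] t.
have [u hu] := Ric_conserved l16 hq rv (le_trans Iv dd).
by exists (u t); have [ru ->] := hu t.
Qed.

Lemma bgood_flow (q : R -> R -> R) : kdvsol q -> bgood k K d0 d1 (q 0) ->
  forall t, bgood k K d0 d1 (q t).
Proof.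
move=> hq [sq hk h2] t; have k16' := k16; have kK' := kK.
split; [exact: hq.1|exact: rsm_flow|apply: rsm_flow => //; lra].
Qed.

Lemma kdvsol_iter (q : R -> R -> R) n : kdvsol q -> bgood k K d0 d1 (q 0) ->
  kdvsol (fun t => iter n (backlund_op K) (q t)).
Proof.
move=> hq h0; elim: n => [//|n IH].
have K0 : 0 < K by have k16' := k16; have kK' := kK; lra.
apply: (backlund_kdvsol (u := fun t => ricsol K (iter n (backlund_op K) (q t))) _ IH).
  by have k16' := k16; have kK' := kK; lra.
move=> t; have [ru Iu] := rsm_ricsol K0 (bgood_rsm (bgood_iter n (bgood_flow hq h0 t))).
by split => //; have d11' := d11; lra.
Qed.

Variables (q : R -> R -> R) (phi p1 p2 p3 p4 : R -> R) (S d s : R) (N : nat).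
Hypotheses (hq : kdvsol q) (h0 : bgood k K d0 d1 (q 0)) (sphi : sch phi)
  (dp1 : dv phi p1) (dp2 : dv p1 p2) (dp3 : dv p2 p3) (dp4 : dv p3 p4) (S0 : 0 <= S)
  (hS1 : forall x, `|p1 x| <= S * wt x) (hS2 : forall x, `|p2 x| <= S * wt x)
  (hS3 : forall x, `|p3 x| <= S * wt x) (hS4 : forall x, `|p4 x| <= S * wt x)
  (dd0 : 0 < d) (dd1 : d <= 1) (dd : 16 * d1 <= d ^+ 2) (s0 : 0 < s).

Let tau := (12 * K ^+ 3)^-1.

(** [F j t] observes [j] Backlund steps applied to the solution at time [t], with the test function
    translated by [j / K]. As these iterates again solve KdV in time, [drift_bound] and [one_step]
    are the two inputs of [shifted_lines]. *)
Lemma flow_approx :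
  `|obs k (iter N (backlund_op K) (q 0)) (shiftf (N%:R / K) phi) - obs k (q (N%:R * tau)) phi| <=
  N%:R * tau * (2000 * S * (1 + k ^+ 2 + k ^+ 4) * (K^-1 + d) +
     2 * (200 * S * (1 + k ^+ 2)) * tau / s) + 2 * (200 * S * (1 + k ^+ 2)) * s.
Proof.
have k16' := k16; have kK' := kK; have d01' := d01.
have k0 : 0 < k by lra.
have K0 : 0 < K by lra.
pose p j t := iter j (backlund_op K) (q t).
pose F j t := obs k (p j t) (shiftf (j%:R / K) phi).
pose J j t := I (fun x => greent k (p j t) (ricsol k (p j t)) (hsol k (p j t)) x * shiftf (j%:R / K) phi x).
have gd j t : bgood k K d0 d1 (p j t) by apply: bgood_iter; exact: bgood_flow.
have ks j : kdvsol (p j) by exact: kdvsol_iter.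
have rk j t : Ric k (p j t) (ricsol k (p j t)) /\ I (fun x => ricsol k (p j t) x ^+ 2) <= 1.
  have [_ hk _] := gd j t; have [ru Iu] := rsm_ricsol k0 hk; split => //; lra.
have gr j t : green k (ricsol k (p j t)) (hsol k (p j t)).
  by have [_ hk _] := gd j t; exact: hsolP k0 hk.
have dF j : dv (F j) (J j).
  move=> t; apply: (green_time k16 t (ks j) (rk j) (gr j)); exact: sch_shiftf.
have t0 : 0 < tau by rewrite /tau invr_gt0 mulr_gt0// exprn_gt0.
have := @shifted_lines _ F J (200 * S * (1 + k ^+ 2)) tau
  (2000 * S * (1 + k ^+ 2 + k ^+ 4) * (K^-1 + d)) s N dF s0 t0.
rewrite /F /p /= mul0r shiftf0.
apply.
- move=> j t; have [ru Iu] := rk j t.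
  have [sq _ _] := gd j t.
  have := drift_bound k16 sphi dp1 dp2 dp3 S0 hS1 hS2 hS3 sq ru Iu (gr j t) (j%:R / K).
  exact.
- move=> j t _; have [ru Iu] := rk j t; have [rU IU] := rsm_ricsol K0 (bgood_rsm (gd j t)).
  have gE : green k (permv k K (ricsol k (p j t)) (ricsol K (p j t))) (hsol k (p j.+1 t)).
    have [sq _ _] := gd j t.
    have kltK : k < K by lra.
    by rewrite -(ricsolP k0 (permv_Ric k0 kltK sq ru rU)); exact: gr j.+1 t.
  have [sq _ _] := gd j t.
  have -> : j.+1%:R / K = j%:R / K + K^-1 by rewrite -natr1 mulrDl mul1r.
  have := one_step k16 sphi dp1 dp2 dp3 dp4 S0 hS1 hS2 hS4 sq ru Iu (gr j t) (j%:R / K) kK rU dd0 dd1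
    (le_trans IU dd) gE.
  exact.
Qed.

End Iterate.
End Flow.

(** * Weak stability *)

Section WeakStability.
Context {R : realType}.
Implicit Types (k K d : R) (p q u phi a f g : R -> R).

(** For sequences bounded in L^2, convergence of this quantity to 0 is the same as local convergence
    to 0 in L^2. *)
Definition Iw f : R := I (fun x => wt x * f x ^+ 2).

Lemma Iw_ge0 f : 0 <= Iw f.
Proof. by apply: I_ge0 => x; nonneg_tac. Qed.

Lemma Iw_lin c f g : nice f -> nice g ->
  Iw (fun x => f x + c * g x) <= 2 * Iw f + 2 * c ^+ 2 * Iw g.
Proof.
move=> nf ng; rewrite /Iw -!IZ; [|by nice_tac|by nice_tac]; rewrite -ID; [|by nice_tac|by nice_tac].
apply: I_le; try nice_tac; move=> x.
have -> : 2 * (wt x * f x ^+ 2) + 2 * c ^+ 2 * (wt x * g x ^+ 2) =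
  wt x * (f x + c * g x) ^+ 2 + wt x * (f x - c * g x) ^+ 2 by ring.
by rewrite lerDl; nonneg_tac.
Qed.

Lemma wt_L2 k c (b b2 e a : R -> R) : 1 <= k -> nice b -> nice b2 -> nice e -> nice a ->
  dv e (fun x => (c + b2 x) * a x - (2 * k + b x) * e x) ->
  Iw e <= expR (I (fun x => b x ^+ 2 / k + b2 x ^+ 2)) * (c ^+ 2 + 1) * Iw a.
Proof.
move=> k1 nb nb2 ne na de; have k0 : 0 < k by lra.
have W'le x : `|- (2 * x) * wt x ^+ 2| <= k * wt x.
  rewrite expr2 mulrA normrM mulNr normrN [`|wt x|]ger0_norm ?wt_ge0// ler_wpM2r ?wt_ge0//.
  exact: le_trans (wt_slow x) k1.
have := linear_L2 k0 nb nb2 ne na (nice_bddc nice_wt) dv_wt wt_ge0 W'le de.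
rewrite -/(Iw e) -/(Iw a) => h.
apply: (@le_trans _ _ (k * Iw e)); first by rewrite ler_peMl// Iw_ge0.
apply: (le_trans h); rewrite ler_wpM2r ?Iw_ge0// ler_wpM2l ?expR_ge0// lerD2r.
by rewrite ler_pdivrMr// ler_peMr// sqr_ge0.
Qed.

(* [p] and [q] differ by [a' + 2 k a] with [a] small on compact sets; for
   bounded families this is weak closeness of [p] and [q] in H^{-1}. *)
Definition wclose k (eta : R) p q := exists a, [/\ sch a,
  dv a (fun x => p x - q x - 2 * k * a x) & Iw a <= eta].

Lemma wclose_change k K : 1 <= k -> 0 < K -> exists C : R, 0 < C /\ forall p q eta,
  wclose K eta p q -> wclose k (C * eta) p q.
Proof.
move=> k1 K0; have k0 : 0 < k by lra.
exists (2 + 2 * (2 * (K - k)) ^+ 2 * 2); split; first by have := sqr_ge0 (2 * (K - k)); lra.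
move=> p q eta [a [sa da aeta]].
have [y [sy dy]] := linear_schwartz k0 sch0 sa.
have hy : Iw y <= 2 * Iw a.
  have n0 : nice (fun _ : R => 0 : R) by exact: nice0.
  have := @wt_L2 k 1 _ _ y a k1 n0 n0 (sch_nice sy) (sch_nice sa).
  rewrite (eq_I (g := fun=> 0)); last by move=> x; rewrite expr0n /= mul0r add0r.
  rewrite (_ : I (fun=> 0) = 0 :> R); last by rewrite /I Rintegral_cst// mul0r.
  rewrite expR0 mul1r expr1n; apply.
  by apply: (dv_eq dy) => x; ring.
(* With $y = (\partial + 2k)^{-1} a$ this is $(\partial + 2k)^{-1}(\partial + 2K) a$. *)
exists (fun x => a x + 2 * (K - k) * y x); split; first by sch_tac.
  by dv_compute; ring.
apply: (le_trans (Iw_lin _ (sch_nice sa) (sch_nice sy))).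
have s0 := sqr_ge0 (2 * (K - k)).
have h1 : (2 * (K - k)) ^+ 2 * Iw y <= (2 * (K - k)) ^+ 2 * (2 * Iw a) by rewrite ler_wpM2l.
have h2 : (2 * (K - k)) ^+ 2 * Iw a <= (2 * (K - k)) ^+ 2 * eta by rewrite ler_wpM2l.
by lra.
Qed.

(** Subtracting [a] from [u - v] removes [p - q] from the equation. What remains is linear with
    coefficient [u + v] and source [- (u + v) a], to which the weighted estimate applies; the
    exponent 8 bounds $2\int (u + v)^2$. *)
Lemma wclose_ric k : 1 <= k -> exists C : R, 0 < C /\ forall p q u v eta,
  Ric k p u -> Ric k q v -> I (fun x => u x ^+ 2) <= 1 -> I (fun x => v x ^+ 2) <= 1 ->
  wclose k eta p q -> Iw (fun x => u x - v x) <= C * eta.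
Proof.
move=> k1; exists (2 + 2 * expR 8); split; first by have := expR_gt0 (8 : R); lra.
move=> p q u v eta [su du] [sv dv'] Iu Iv [a [sa da aeta]].
pose e x := u x - v x + (-1) * a x.
have se : sch e by rewrite /e; sch_tac.
have sb : sch (fun x => u x + v x) by sch_tac.
have sb2 : sch (fun x => - (u x + v x)) by sch_tac.
have he : Iw e <= expR 8 * eta.
  have de : dv e (fun x => (0 + - (u x + v x)) * a x - (2 * k + (u x + v x)) * e x).
    by rewrite {1}/e; dv_compute; rewrite /e; ring.
  have := wt_L2 k1 (sch_nice sb) (sch_nice sb2) (sch_nice se) (sch_nice sa) de.
  rewrite expr0n /= add0r mulr1 => h; apply: (le_trans h).
  apply: ler_pM; [exact: expR_ge0|exact: Iw_ge0| |exact: aeta].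
  rewrite ler_expR.
  apply: (@le_trans _ _ (I (fun x => 2 * (u x + v x) ^+ 2))).
    apply: I_le; try nice_tac; move=> x.
    have : (u x + v x) ^+ 2 / k <= (u x + v x) ^+ 2.
      by rewrite ler_pdivrMr; [rewrite ler_peMr// sqr_ge0|lra].
    by rewrite sqrrN; lra.
  rewrite IZ; last by nice_tac.
  by have := I_sqrD (sch_nice su) (sch_nice sv); lra.
have -> : Iw (fun x => u x - v x) = Iw (fun x => e x + 1 * a x).
  by apply: eq_I => x; rewrite /e; ring.
apply: (le_trans (Iw_lin 1 (sch_nice se) (sch_nice sa))).
by rewrite expr1n; lra.
Qed.

Lemma wclose_backlund K : 1 <= K -> exists C : R, 0 < C /\ forall p q u v eta,
  Ric K p u -> Ric K q v -> I (fun x => u x ^+ 2) <= 1 -> I (fun x => v x ^+ 2) <= 1 ->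
  wclose K eta p q -> wclose K (C * eta) (backlund K p u) (backlund K q v).
Proof.
move=> K1; have [C [C0 hC]] := wclose_ric K1; have K0 : 0 < K by lra.
exists (2 * (2 + 8 * C) + 2 * (4 * K) ^+ 2 * (2 * C)); split.
  by rewrite ltr_pwDl//; nonneg_tac; lra.
move=> p q u v eta ru rv Iu Iv hpq; have hd := hC _ _ _ _ _ ru rv Iu Iv hpq.
have [su du] := ru; have [sv dv'] := rv; have [a [sa da aeta]] := hpq.
have sd : sch (fun x => u x - v x) by sch_tac.
have [y [sy dy]] := linear_schwartz K0 sch0 sd.
have hy : Iw y <= 2 * Iw (fun x => u x - v x).
  have n0 : nice (fun _ : R => 0 : R) by exact: nice0.
  have := @wt_L2 K 1 _ _ y _ K1 n0 n0 (sch_nice sy) (sch_nice sd).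
  rewrite (eq_I (g := fun=> 0)); last by move=> x; rewrite expr0n /= mul0r add0r.
  rewrite (_ : I (fun=> 0) = 0 :> R); last by rewrite /I Rintegral_cst// mul0r.
  rewrite expR0 mul1r expr1n; apply.
  by apply: (dv_eq dy) => x; ring.
(* Since [backlund] is $q - 2u'$, this is the witness up to the term $4K(u - v)$ in its equation,
   which adding $4K y$ with $y = (\partial + 2K)^{-1}(u - v)$ compensates. *)
pose w x := a x + (-2) * (u x - v x).
have sw : sch w by rewrite /w; sch_tac.
exists (fun x => w x + 4 * K * y x); split; first by sch_tac.
  by rewrite {1}/w; dv_compute; rewrite /w /backlund; ring.
apply: (le_trans (Iw_lin _ (sch_nice sw) (sch_nice sy))).
have hw := Iw_lin (-2) (sch_nice sa) (sch_nice sd).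
rewrite -/w in hw.
have h1 : (4 * K) ^+ 2 * Iw y <= (4 * K) ^+ 2 * (2 * (C * eta)).
  by rewrite ler_wpM2l ?sqr_ge0//; lra.
by lra.
Qed.

Lemma wclose_backlund_op k K d0 d1 : 16 <= k -> 2 * k <= K -> 0 <= d1 -> d1 <= 1024^-1 ->
  exists C : R, 0 < C /\ forall p q eta, bgood k K d0 d1 p -> bgood k K d0 d1 q ->
  wclose K eta p q -> wclose K (C * eta) (backlund_op K p) (backlund_op K q).
Proof.
move=> k16 kK d10 d11; have K1 : 1 <= K by lra.
have K0 : 0 < K by lra.
have [C [C0 hC]] := wclose_backlund K1; exists C; split => // p q eta hp hq.
have [ru Iu] := rsm_ricsol K0 (bgood_rsm k16 kK d10 d11 hp).
have [rv Iv] := rsm_ricsol K0 (bgood_rsm k16 kK d10 d11 hq).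
by apply: hC => //; lra.
Qed.

Lemma wclose_iter k K d0 d1 n : 16 <= k -> 2 * k <= K -> 0 <= d1 -> d1 <= 1024^-1 ->
  exists C : R, 0 < C /\ forall p q eta, bgood k K d0 d1 p -> bgood k K d0 d1 q ->
  wclose K eta p q -> wclose K (C * eta) (iter n (backlund_op K) p) (iter n (backlund_op K) q).
Proof.
move=> k16 kK d10 d11; have [C [C0 hC]] := wclose_backlund_op d0 k16 kK d10 d11.
elim: n => [|n [D [D0 hD]]]; first by exists 1; split => // p q eta _ _; rewrite mul1r.
exists (C * D); split; first by rewrite mulr_gt0.
move=> p q eta hp hq h; rewrite /= -mulrA; apply: hC; last exact: hD.
- exact: (bgood_iter k16 kK d10 d11 n hp).
- exact: (bgood_iter k16 kK d10 d11 n hq).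
Qed.

Lemma nice_opp f : nice f -> nice (fun x => f (- x)).
Proof.
move=> [cf [C hC]]; split; last by exists C => x; rewrite (le_trans (hC _))// /wt sqrrN.
by move=> x; apply: (@continuous_comp _ _ _ -%R f); [exact: continuousN|exact: cf].
Qed.

Lemma I_opp f : nice f -> I (fun x => f (- x)) = I f.
Proof.
move=> nf; have [F dF] := antiderivative (nice_cont nf).
have dG : dv (fun x => - F (- x)) (fun x => f (- x)).
  by apply: (dv_eq (dvN (dv_opp dF))) => x; rewrite opprK.
have h := I_lim dG (nice_opp nf).
have e : (fun n : nat => - F (- n%:R) - - F (- - n%:R)) = (fun n : nat => F n%:R - F (- n%:R)).
  by apply/funext => n; rewrite !opprK addrC.
by rewrite e in h; exact: (cvg_unique _ h (I_lim dF nf)).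
Qed.

Lemma Iw_opp f : nice f -> Iw (fun x => f (- x)) = Iw f.
Proof.
move=> nf; rewrite /Iw -[RHS]I_opp; last by nice_tac.
by apply: eq_I => x; rewrite /wt sqrrN.
Qed.

Lemma I_wt4 : I wt <= 4 :> R.
Proof.
have h : `|I wt| <= 1 * pi :> R.
  by apply: (I_wt_le nice_wt) => x; rewrite mul1r ger0_norm ?wt_ge0.
by apply: (le_trans (ler_norm _)); apply: (le_trans h); rewrite mul1r; exact: pi_le4.
Qed.

(** Young's inequality $|f| \le f^2/t + t$ under the weight. The parameter [t] is free and turns
    smallness of [Iw f] into smallness of the pairing; 4 bounds the integral of [wt]. *)
Lemma I_Iw f phi (S t : R) : nice f -> nice phi -> 0 <= S -> (forall x, `|phi x| <= S * wt x) ->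
  0 < t -> `|I (fun x => f x * phi x)| <= S * (Iw f / t + 4 * t).
Proof.
move=> nf nphi S0 hphi t0; have tn : t != 0 by exact: lt0r_neq0.
apply: (@le_trans _ _ (I (fun x => S * (t^-1 * (wt x * f x ^+ 2) + t * wt x)))).
  apply: I_abs_le; try nice_tac; move=> x; rewrite normrM mulrC.
  apply: (@le_trans _ _ (S * wt x * `|f x|)); first by rewrite ler_wpM2r.
  rewrite -mulrA ler_wpM2l//.
  have -> : t^-1 * (wt x * f x ^+ 2) + t * wt x = wt x * ((`|f x| - t) ^+ 2 / t + 2 * `|f x|).
    by rewrite -(real_normK (num_real (f x))); field.
  rewrite ler_wpM2l ?wt_ge0//.
  have : 0 <= (`|f x| - t) ^+ 2 / t by nonneg_tac.
  by have := normr_ge0 (f x); lra.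
rewrite IZ; last by nice_tac.
rewrite ler_wpM2l//; rewrite ID; [|by nice_tac|by nice_tac].
rewrite !IZ; [|by nice_tac|by nice_tac]; rewrite mulrC lerD2l mulrC ler_pM2r//.
exact: I_wt4.
Qed.

(** After reflection, the difference of the Green functions solves a damped equation whose source is
    $-2(u - v)$ times the second Green function, and the latter is bounded by 1. *)
Lemma green_close k p q (u v h g : R -> R) : 16 <= k -> Ric k p u -> Ric k q v ->
  I (fun x => u x ^+ 2) <= 1 -> I (fun x => v x ^+ 2) <= 1 -> green k u h -> green k v g ->
  Iw (fun x => h x - g x) <= 8 * expR 1 * Iw (fun x => u x - v x).
Proof.
move=> k16 ru rv Iu Iv gh gg; have k0 : 0 < k by lra.
have k1 : 1 <= k by lra.
have kn : k != 0 by exact: lt0r_neq0.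
have [su _] := ru; have [sv _] := rv; have [sh dh] := gh; have [sg dg] := gg.
have sd : sch (fun x => u x - v x) by sch_tac.
have sdo := sch_opp sd; have sgo := sch_opp sg; have sho := sch_opp sh; have suo := sch_opp su.
have se : sch (fun x => h (- x) - g (- x)) by sch_tac.
pose a x := - (u (- x) - v (- x)) / k + (-2) * ((u (- x) - v (- x)) * g (- x)).
have sa : sch a by rewrite /a; sch_tac.
have sb : sch (fun x => 2 * u (- x)) by sch_tac.
have n0 : nice (fun _ : R => 0 : R) by exact: nice0.
have de : dv (fun x => h (- x) - g (- x))
   (fun x => (1 + 0) * a x - (2 * k + 2 * u (- x)) * (h (- x) - g (- x))).
  have d1 := dv_opp dh; have d2 := dv_opp dg; dv_compute; rewrite /a.
  move: (u _) (v _) (h _) (g _) => *; field; exact: kn.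
have := wt_L2 k1 (sch_nice sb) n0 (sch_nice se) (sch_nice sa) de.
rewrite (Iw_opp (f := fun x => h x - g x)); last by nice_tac.
move=> hh; apply: (le_trans hh).
have Ia : Iw a <= 4 * Iw (fun x => u x - v x).
  rewrite -(Iw_opp (f := fun x => u x - v x)); last by nice_tac.
  rewrite /Iw -IZ; last by nice_tac.
  apply: I_le; try nice_tac; move=> x.
  have -> : a x = - 2 * gf k g (- x) * (u (- x) - v (- x)).
    by rewrite /a /gf; move: (u _) (v _) (g _) => *; field; exact: kn.
  have hg : gf k g (- x) ^+ 2 <= 1.
    rewrite -[gf _ _ _ ^+ 2]ger0_norm ?sqr_ge0// normrX expr_le1//.
    apply: (le_trans (gf_sup (- x) k16 sv Iv gg)).
    by rewrite ler_pdivrMr//; lra.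
  have -> : wt x * (-2 * gf k g (- x) * (u (- x) - v (- x))) ^+ 2 =
    4 * (wt x * (u (- x) - v (- x)) ^+ 2) * gf k g (- x) ^+ 2 by ring.
  by rewrite ler_piMr//; nonneg_tac.
have Iu1 : I (fun x => (2 * u (- x)) ^+ 2 / k + 0 ^+ 2) <= 1.
  apply: (@le_trans _ _ (I (fun x => u (- x) ^+ 2))); last first.
    by rewrite (I_opp (f := fun x => u x ^+ 2))//; nice_tac.
  apply: I_le; try nice_tac; move=> x.
  rewrite expr0n /= addr0 ler_pdivrMr//.
  by have := ler_wpM2l (sqr_ge0 (u (- x))) k16; have := sqr_ge0 (u (- x)); lra.
have i0 := Iw_ge0 (fun x => u x - v x).
have -> : 8 * expR 1 * Iw (fun x => u x - v x) = expR 1 * 2 * (4 * Iw (fun x => u x - v x)) by ring.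
apply: ler_pM; [by nonneg_tac|exact: Iw_ge0| |exact: Ia].
by rewrite expr1n -[1 + 1]/2 ler_pM2r// ler_expR.
Qed.

Lemma obs_close k d phi (e : R) : 16 <= k -> d <= 1 -> sch phi -> 0 < e ->
  exists2 eta : R, 0 < eta & forall p q, rsm k d p -> rsm k d q -> wclose k eta p q ->
  `|obs k p phi - obs k q phi| <= e.
Proof.
move=> k16 d1 sphi e0; have k1 : 1 <= k by lra.
have k0 : 0 < k by lra.
have [C [C0 hC]] := wclose_ric k1.
have [S hS] : exists S : R, forall x, `|phi x| <= S * wt x by have [_] := sch_nice sphi.
have S0 : 0 <= S by have := le_trans (normr_ge0 _) (hS 0); rewrite pmulr_lge0// wt_gt0.
(* The term [4 * t] of [I_Iw] then costs at most [e / 2]; [eta] below is chosen so that the term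
   with [Iw] takes the other half. *)
pose t := e / (8 * (S + 1)).
have t0 : 0 < t by rewrite divr_gt0// mulr_gt0//; lra.
pose D := 8 * expR 1 * C.
have D0 : 0 < D by rewrite !mulr_gt0// expR_gt0.
pose eta := t * e / (2 * (S + 1) * D).
have S1 : 0 < S + 1 by lra.
have eta0 : 0 < eta.
  by apply: divr_gt0; [exact: mulr_gt0|apply: mulr_gt0 D0; exact: mulr_gt0].
exists eta => // p q hp hq hpq.
have [ru Iu] := rsm_ricsol k0 hp; have [rv Iv] := rsm_ricsol k0 hq.
have Iu1 := le_trans Iu d1; have Iv1 := le_trans Iv d1.
have gh := hsolP k0 hp; have gg := hsolP k0 hq.
have sh := gh.1; have sg := gg.1.
rewrite /obs -IB; [|by nice_tac|by nice_tac].
have -> : I (fun x => hsol k p x * phi x - hsol k q x * phi x) =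
  I (fun x => (hsol k p x - hsol k q x) * phi x) by apply: eq_I => x; ring.
have nd : nice (fun x => hsol k p x - hsol k q x) by nice_tac.
apply: (le_trans (I_Iw nd (sch_nice sphi) S0 hS t0)).
have h1 := green_close k16 ru rv Iu1 Iv1 gh gg.
have h2 := hC _ _ _ _ _ ru rv Iu1 Iv1 hpq.
have h3 : Iw (fun x => hsol k p x - hsol k q x) <= D * eta.
  have e8 : 0 <= 8 * expR 1 :> R by rewrite mulr_ge0// expR_ge0.
  by apply: (le_trans h1); apply: (le_trans (ler_wpM2l e8 h2)); rewrite mulrA.
have tn : t != 0 by exact: lt0r_neq0.
have Dn : D != 0 by exact: lt0r_neq0.
have Sn : S + 1 != 0 by exact: lt0r_neq0.
have h4 : Iw (fun x => hsol k p x - hsol k q x) / t <= e / (2 * (S + 1)).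
  rewrite ler_pdivrMr//; apply: (le_trans h3); rewrite /eta le_eqVlt; apply/orP; left; apply/eqP.
  by field; rewrite Sn Dn.
apply: (@le_trans _ _ ((S + 1) * (e / (2 * (S + 1)) + 4 * t))).
  apply: ler_pM; [exact: S0| |by lra|by rewrite lerD2r].
  by apply: addr_ge0; [exact: divr_ge0 (Iw_ge0 _) (ltW t0)|apply: mulr_ge0; [|exact: ltW]].
by rewrite /t le_eqVlt; apply/orP; left; apply/eqP; field; exact: Sn.
Qed.

Lemma obs_iter_close k K d0 d1 n phi (e : R) : 16 <= k -> 2 * k <= K -> d0 <= 1 -> 0 <= d1 ->
  d1 <= 1024^-1 -> sch phi -> 0 < e -> exists2 eta : R, 0 < eta & forall p q,
  bgood k K d0 d1 p -> bgood k K d0 d1 q -> wclose K eta p q ->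
  `|obs k (iter n (backlund_op K) p) phi - obs k (iter n (backlund_op K) q) phi| <= e.
Proof.
move=> k16 kK d01 d10 d11 sphi e0; have k1 : 1 <= k by lra.
have K0 : 0 < K by lra.
have [eta eta0 heta] := obs_close k16 d01 sphi e0.
have [C [C0 hC]] := wclose_change k1 K0.
have [D [D0 hD]] := wclose_iter d0 n k16 kK d10 d11.
exists (eta / (C * D)); first by rewrite divr_gt0// mulr_gt0.
move=> p q hp hq h.
have gp := bgood_iter k16 kK d10 d11 n hp; have gq := bgood_iter k16 kK d10 d11 n hq.
apply: heta; [by have [] := gp|by have [] := gq|].
have := hC _ _ _ (hD _ _ _ hp hq h).
have -> // : C * (D * (eta / (C * D))) = eta.
by field; rewrite !lt0r_neq0.
Qed.

End WeakStability.

(** * Local compactness *)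

Section Compactness.
Context {R : realType}.
Implicit Types (f g y phi : R -> R) (k mu x s : R).

(** A positive Schwartz function whose second moment follows from its own differential equation; its
    translates serve as an approximate identity. *)
Definition gauss mu : R -> R := fun x => expR (- (mu * x ^+ 2)).

Lemma gauss_moment n mu : 0 < mu -> exists C : R, forall x, `|x ^+ n * gauss mu x| <= C.
Proof.
elim: n mu => [|n IH] mu mu0.
  exists 1 => x; rewrite expr0 mul1r ger0_norm ?expR_ge0//.
  by rewrite /gauss -expR0 ler_expR oppr_le0; nonneg_tac.
have h0 : 0 < mu / 2 by rewrite divr_gt0.
have [C hC] := IH _ h0; exists (C * (1 + (mu / 2)^-1)) => x.
have -> : x ^+ n.+1 * gauss mu x = x ^+ n * gauss (mu / 2) x * (x * gauss (mu / 2) x).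
  rewrite exprSr -mulrA [X in _ = X]mulrACA -mulrA; congr (_ * (_ * _)).
  by rewrite /gauss -expRD; congr expR; field.
rewrite normrM ler_pM// normrM [`|gauss _ _|]ger0_norm ?expR_ge0// /gauss expRN.
rewrite ler_pdivrMr ?expR_gt0//.
have e1 := expR_ge1Dx (mu / 2 * x ^+ 2).
have m0 : 0 <= 1 + (mu / 2)^-1 by rewrite addr_ge0// invr_ge0 ltW.
apply: (le_trans _ (ler_wpM2l m0 e1)).
have -> : (1 + (mu / 2)^-1) * (1 + mu / 2 * x ^+ 2) = 1 + x ^+ 2 + (mu / 2)^-1 + mu / 2 * x ^+ 2.
  by field; exact: lt0r_neq0.
have : 0 <= (`|x| - 1) ^+ 2 by exact: sqr_ge0.
have -> : (`|x| - 1) ^+ 2 = x ^+ 2 - 2 * `|x| + 1.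
  by rewrite -(real_normK (num_real x)); ring.
have i0 : 0 <= (mu / 2)^-1 by rewrite invr_ge0 ltW.
have j0 : 0 <= mu / 2 * x ^+ 2 by rewrite mulr_ge0 ?sqr_ge0// ltW.
by have := normr_ge0 x; have := sqr_ge0 x; lra.
Qed.

Lemma dv_gauss mu : dv (gauss mu) (fun x => - 2 * mu * (x * gauss mu x)).
Proof.
rewrite {1}/gauss; dv_compute; rewrite /gauss.
by move: (expR _) => e; ring.
Qed.

Lemma smr_mulx m f : smr m f -> smr m (fun x => x * f x).
Proof.
elim: m f => [|m IH] f.
  move=> [cf [rf _]]; split; [|split; [exact: rapidX|by []]].
  by move=> x; apply: cvgM; [exact: cvg_id|exact: cf].
move=> [cf [rf [f' [df sf']]]]; split; [|split; [exact: rapidX|]].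
  by move=> x; apply: cvgM; [exact: cvg_id|exact: cf].
exists (fun x => f x + x * f' x); split; first by dv_compute; ring.
apply: smrD; last exact: IH.
apply: smrW; split; [exact: cf|split; [exact: rf|by exists f']].
Qed.

Lemma sch_gauss mu : 0 < mu -> sch (gauss mu).
Proof.
move=> mu0; apply: (sch_bootstrap _ _ (@dv_gauss mu)) => [|n|m sm].
- exact: dv_continuous (@dv_gauss mu).
- exact: gauss_moment.
- by apply: smrZ; exact: smr_mulx.
Qed.

Lemma sch_mulx f : sch f -> sch (fun x => x * f x).
Proof. by move=> sf m; exact: smr_mulx. Qed.

Lemma I_gt0 f : nice f -> (forall x, 0 < f x) -> 0 < I f.
Proof.
move=> nf f0; have [F dF] := antiderivative (nice_cont nf).
have := I_ge_osc 1 0 dF nf (fun x => ltW (f0 x)).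
have [c _ ->] := dv_MVT dF (@ltr01 R).
by rewrite subr0 mulr1; exact: lt_le_trans.
Qed.

(** The normalised Gaussian has variance [1 / (2 * mu)], so averaging a function with quadratic
    modulus [th + D (s - x)^2] changes its value at [x] by at most [th + D / (2 * mu)]. *)
Lemma gauss_average mu x th D y : 0 < mu -> bddc y ->
  (forall s, `|y s - y x| <= th + D * (s - x) ^+ 2) ->
  `|y x| * I (shiftf x (gauss mu)) <=
  `|I (fun s => y s * shiftf x (gauss mu) s)| + (th + D / (2 * mu)) * I (shiftf x (gauss mu)).
Proof.
move=> mu0 by' hy; have mn : mu != 0 by exact: lt0r_neq0.
set G := shiftf x _; pose G2 := shiftf x (fun s => s * (s * gauss mu s)).
have sG : sch G by apply: sch_shiftf; exact: sch_gauss.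
have sG1 : sch (shiftf x (fun s => s * gauss mu s)).
  by apply: sch_shiftf; apply: sch_mulx; exact: sch_gauss.
have sG2 : sch G2 by apply: sch_shiftf; apply: sch_mulx; apply: sch_mulx; exact: sch_gauss.
have G0 s : 0 <= G s by exact: expR_ge0.
have m2 : I G2 = I G / (2 * mu).
  have -> : I G2 = (2 * mu)^-1 * I (fun s => 2 * mu * G2 s).
    by rewrite IZ; [field|nice_tac].
  rewrite mulrC; congr (_ * _).
  apply/esym; apply: (I_dv_eq (F := shiftf x (fun s => s * gauss mu s))); try nice_tac.
  have d := dv_gauss mu; apply: (dv_eq (dv_shift (- x) (dvM dv_id d))) => s /=.
  by rewrite /G /G2 /shiftf; move: (gauss _ _) => e; ring.
have nG := sch_nice sG; have nG2 := sch_nice sG2.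
have e1 : y x * I G = I (fun s => y s * G s) - I (fun s => (y s - y x) * G s).
  rewrite -IZ; last by nice_tac.
  by rewrite -IB; [|by nice_tac|by nice_tac]; apply: eq_I => s; ring.
rewrite -(gtr0_norm (I_gt0 nG (fun s => expR_gt0 _))) -normrM (gtr0_norm (I_gt0 nG (fun s => expR_gt0 _))) e1.
apply: (le_trans (ler_normB _ _)); rewrite lerD2l.
apply: (@le_trans _ _ (I (fun s => th * G s + D * G2 s))).
  apply: I_abs_le; try nice_tac; move=> s; rewrite normrM (ger0_norm (G0 s)).
  apply: (le_trans (ler_wpM2r (G0 s) (hy s))); rewrite /G2 /G /shiftf.
  by move: (gauss _ _) => e; rewrite le_eqVlt; apply/orP; left; apply/eqP; ring.
rewrite ID; [|by nice_tac|by nice_tac]; rewrite !IZ; [|by nice_tac|by nice_tac].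
by rewrite m2 le_eqVlt; apply/orP; left; apply/eqP; field.
Qed.

(** Integrates $|y'| \le y'^2/(4D) + D$. With [D] free, this is the Holder estimate of exponent 1/2
    in a form linear in [|s - x|]. *)
Lemma H1_modulus y y' (E D : R) x s : dv y y' -> nice y' -> I (fun x => y' x ^+ 2) <= E -> 0 < D ->
  `|y s - y x| <= E / (4 * D) + D * `|s - x|.
Proof.
move=> dy ny hE D0; have Dn : D != 0 by exact: lt0r_neq0.
have [|z|r [dr r0 rM]] := @nice_antiderivative _ (fun x => y' x ^+ 2); [by nice_tac|exact: sqr_ge0|].
wlog xs : x s / x <= s.
  move=> h; have [xs|sx] := leP x s; first exact: h.
  by rewrite distrC (distrC s); apply: h; exact: ltW.
have hr a b : r b - r a <= E by have := r0 a; have := rM b; lra.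
have c0 : 0 <= (4 * D)^-1 by rewrite invr_ge0 mulr_ge0// ltW.
have hc : (r s - r x) / (4 * D) <= E / (4 * D) by rewrite ler_wpM2r.
rewrite (@ger0_norm _ (s - x)) ?subr_ge0// ler_norml; apply/andP; split.
- have d1 : dv (fun z => r z / (4 * D) + D * z + y z) (fun z => y' z ^+ 2 / (4 * D) + D + y' z).
    by dv_compute; ring.
  have h z : 0 <= y' z ^+ 2 / (4 * D) + D + y' z.
    have -> : y' z ^+ 2 / (4 * D) + D + y' z = (y' z + 2 * D) ^+ 2 * (4 * D)^-1 by field.
    by nonneg_tac.
  by have := dv_le d1 (fun z _ => h z) xs; lra.
- have d1 : dv (fun z => r z / (4 * D) + D * z - y z) (fun z => y' z ^+ 2 / (4 * D) + D - y' z).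
    by dv_compute; ring.
  have h z : 0 <= y' z ^+ 2 / (4 * D) + D - y' z.
    have -> : y' z ^+ 2 / (4 * D) + D - y' z = (y' z - 2 * D) ^+ 2 * (4 * D)^-1 by field.
    by nonneg_tac.
  by have := dv_le d1 (fun z _ => h z) xs; lra.
Qed.

(** The bound on the derivatives makes the sequence equicontinuous, so that a value at a point is
    close to a Gaussian average, which tends to 0 by weak convergence. *)
Lemma weak_pointwise (y y' : nat -> R -> R) (E : R) : (forall n, bddc (y n)) ->
  (forall n, dv (y n) (y' n)) -> (forall n, nice (y' n)) ->
  (forall n, I (fun x => y' n x ^+ 2) <= E) ->
  (forall phi, sch phi -> I (fun x => y n x * phi x) @[n --> \oo] --> 0) ->
  forall x, y n x @[n --> \oo] --> 0.
Proof.
move=> bdy dy ny hE hw x; apply/cvgr0Pnorm_le => e e0.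
have E0 : 0 <= E by apply: le_trans (hE 0%N); apply: I_ge0 => z; exact: sqr_ge0.
(* [D] makes the constant of [H1_modulus] at most [e / 4], and [mu] makes the variance term equal to
   [e / 8]. The budget is [e / 8] for weak convergence, [e / 2] for the modulus and [e / 8] for the
   variance. *)
pose D := (E + 1) / e.
have D0 : 0 < D by apply: divr_gt0 => //; lra.
pose mu := D ^+ 2 / e ^+ 2 * 4.
have mu0 : 0 < mu by apply: mulr_gt0 => //; apply: divr_gt0; exact: exprn_gt0.
have Dn : D != 0 by exact: lt0r_neq0.
have en : e != 0 by exact: lt0r_neq0.
have nG : nice (shiftf x (gauss mu)) by apply: sch_nice; apply: sch_shiftf; exact: sch_gauss.
have m0 : 0 < I (shiftf x (gauss mu)) by apply: I_gt0 => // s; exact: expR_gt0.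
have sG : sch (shiftf x (gauss mu)) by apply: sch_shiftf; exact: sch_gauss.
have := hw _ sG.
have me : 0 < I (shiftf x (gauss mu)) * (e / 8) by apply: mulr_gt0 => //; lra.
move=> /cvgr0Pnorm_le/(_ _ me); apply: filterS => n hn.
have h1 s : `|y n s - y n x| <= (e / 4 + e / 4) + D ^+ 2 / e * (s - x) ^+ 2.
  apply: (le_trans (H1_modulus x s (dy n) (ny n) (hE n) D0)); rewrite -addrA; apply: lerD.
    rewrite ler_pdivrMr; last by apply: mulr_gt0.
    have -> : e / 4 * (4 * D) = E + 1 by rewrite /D; field.
    by lra.
  rewrite -(real_normK (num_real (s - x))).
  have : 0 <= (`|s - x| * D - e / 2) ^+ 2 / e by rewrite divr_ge0 ?sqr_ge0// ltW.
  have -> : (`|s - x| * D - e / 2) ^+ 2 / e = D ^+ 2 / e * `|s - x| ^+ 2 - D * `|s - x| + e / 4.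
    by field.
  by lra.
have := gauss_average mu0 (bdy n) h1.
have -> : D ^+ 2 / e / (2 * mu) = e / 8 by rewrite /mu; field; rewrite Dn en.
move=> h2; rewrite -(ler_pM2r m0); apply: (le_trans h2).
by have : 0 <= I (shiftf x (gauss mu)) * e by [apply: mulr_ge0; exact: ltW]; lra.
Qed.

Lemma I_dominated (f : nat -> R -> R) (C : R) : (forall n, nice (f n)) ->
  (forall n x, `|f n x| <= C * wt x) -> (forall x, f n x @[n --> \oo] --> 0) ->
  I (f n) @[n --> \oo] --> 0.
Proof.
move=> nf hf cf.
have nC : nice (fun x => C * wt x) by nice_tac.
have mf (g : R -> R) : nice g -> measurable_fun setT g.
  by move=> ng; apply: continuous_measurable_fun; exact: nice_cont.
have [|||||_ _ hc] := @dominated_convergence _ _ _ (@lebesgue_measure R) setT measurableT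
  (fun n x => (f n x)%:E) (fun=> 0%E) (fun x => (C * wt x)%:E).
- by move=> n; apply/measurable_EFinP; exact: mf.
- exact: measurable_cst.
- by apply/aeW => x _; apply: cvg_EFin; [exact: nearW|exact: cf].
- exact: nice_integrable nC.
- by apply/aeW => x n _ /=; rewrite lee_fin.
move: hc; rewrite integral0 => /fine_cvg.
by move=> h; apply: cvg_trans h; exact: cvg_id.
Qed.

Section Inner.
Variables (K lam ep : R) (r : nat -> R -> R).
Hypotheses (K1 : 1 <= K) (lam0 : 0 < lam) (ep0 : 0 <= ep) (sr : forall n, sch (r n))
  (hr : forall n, Hsm lam ep (r n))
  (wr : forall phi, sch phi -> I (fun x => r n x * phi x) @[n --> \oo] --> 0).

(** With $z = (\partial + 2\lambda)^{-1} r$ and $y = (\partial + 2K)^{-1} z$ one has $(\partial +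
    2K)^{-1} r = y' + 2\lambda y$. The first part is small in L^2 because $\int z^2$ is at most
    [ep]: this is how uniform smallness at high frequency prevents a loss of compactness. The second
    part is bounded in H^1 and tends weakly to 0, hence pointwise, and by domination also in
    [Iw]. *)
Lemma compact_resolvent : exists a : nat -> R -> R, exists y : nat -> R -> R,
  [/\ forall n, sch (a n), forall n, dv (a n) (fun x => r n x - 2 * K * a n x),
     forall n, Iw (a n) <= 2 * ep + 2 * (2 * lam) ^+ 2 * Iw (y n) &
     Iw (y n) @[n --> \oo] --> 0].
Proof.
have K0 : 0 < K by have := K1; lra.
have [zz hz] := choice (fun n => linear_schwartz lam0 sch0 (sr n)).
have [yy hy] := choice (fun n => linear_schwartz K0 sch0 (hz n).1).
have sz n := (hz n).1; have sy n := (hy n).1.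
have dz n : dv (zz n) (fun x => r n x - 2 * lam * zz n x).
  by apply: (dv_eq (hz n).2) => x; ring.
have dy n : dv (yy n) (fun x => zz n x - 2 * K * yy n x).
  by apply: (dv_eq (hy n).2) => x; ring.
have Iz n : I (fun x => zz n x ^+ 2) <= ep := resolvent_L2 lam0 ep0 (sr n) (sz n) (dz n) (hr n).
have s1 n : sch (fun x => zz n x - 2 * K * yy n x).
  by have h1 := sz n; have h2 := sy n; sch_tac.
have Iz2 n : I (fun x => (zz n x - 2 * K * yy n x) ^+ 2) + 4 * K ^+ 2 * I (fun x => yy n x ^+ 2) =
    I (fun x => zz n x ^+ 2).
  have h1 := sz n; have h2 := sy n; have d2 := dy n.
  rewrite -IZ; last by nice_tac.
  rewrite -ID; [|by nice_tac|by nice_tac].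
  apply: (I_dv_eq (F := fun x => - (2 * K) * yy n x ^+ 2)); try nice_tac.
  by dv_compute; ring.
have Iy0 n : 0 <= I (fun x => yy n x ^+ 2) by apply: I_ge0 => x; exact: sqr_ge0.
have K2 : 1 <= K ^+ 2 by rewrite exprn_ege1//; exact: K1.
have Iy n : I (fun x => yy n x ^+ 2) <= K ^+ 2 * I (fun x => yy n x ^+ 2) by rewrite ler_peMl.
have Iy' n : I (fun x => (zz n x - 2 * K * yy n x) ^+ 2) <= ep.
  by have := Iz n; have := Iz2 n; have := Iy n; have := Iy0 n; lra.
have ysup n x : yy n x ^+ 2 <= ep.
  apply: (le_trans (sup_H1 x (sch_nice (sy n)) (sch_nice (s1 n)) (dy n))).
  have h1 := sz n; have h2 := sy n.
  rewrite ID; [|by nice_tac|by nice_tac].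
  by have := Iz n; have := Iz2 n; have := Iy n; have := Iy0 n; lra.
exists (fun n x => (zz n x - 2 * K * yy n x) + 2 * lam * yy n x), yy; split => //.
- by move=> n; have h1 := sz n; have h2 := sy n; sch_tac.
- by move=> n; have h1 := dz n; have h2 := dy n; dv_compute; ring.
- move=> n; apply: (le_trans (Iw_lin _ (sch_nice (s1 n)) (sch_nice (sy n)))).
  rewrite lerD2r ler_pM2l//; apply: le_trans (Iy' n).
  have h1 := sz n; have h2 := sy n.
  by apply: I_le; try nice_tac; move=> x; rewrite ler_piMl ?sqr_ge0// wt_le1.
have ypt x : yy n x @[n --> \oo] --> 0.
  apply: (@weak_pointwise yy _ ep _ dy _ Iy').
  - by move=> n; exact: nice_bddc (sch_nice (sy n)).
  - by move=> n; exact: sch_nice.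
  move=> phi sphi.
  have [p [sp dp]] := linear_schwartz_back K0 sch0 sphi.
  have [q [sq dq]] := linear_schwartz_back lam0 sch0 sp.
  suff E n : I (fun x => yy n x * phi x) = I (fun x => r n x * q x).
    by under eq_fun do rewrite E; exact: wr.
  have h1 := sz n; have h2 := sy n; have h3 := dy n; have h4 := dz n; have h5 := sr n.
  transitivity (I (fun x => zz n x * p x)); apply/esym.
    apply: (I_dv_eq (F := fun x => yy n x * p x)); try nice_tac.
    by dv_compute; ring.
  apply: (I_dv_eq (F := fun x => zz n x * q x)); try nice_tac.
  by dv_compute; ring.
apply: (@I_dominated _ ep) => [n|n x|x].
- by have h2 := sy n; nice_tac.
- rewrite normrM !ger0_norm ?wt_ge0 ?sqr_ge0// mulrC ler_wpM2r ?wt_ge0//.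
- rewrite [X in _ --> X](_ : 0 = wt x * (0 * 0)); last by rewrite !mulr0.
  by apply: cvgM; [exact: cvg_cst|exact: cvgM].
Qed.

End Inner.

Lemma weak_wclose (K eta : R) (p q : nat -> R -> R) : 1 <= K -> 0 < eta ->
  (forall n, sch (p n)) -> (forall n, sch (q n)) ->
  (forall e, 0 < e -> exists2 lam : R, 0 < lam &
    \forall n \near \oo, Hsm lam e (fun x => p n x - q n x)) ->
  (forall phi, sch phi -> I (fun x => (p n x - q n x) * phi x) @[n --> \oo] --> 0) ->
  \forall n \near \oo, wclose K eta (p n) (q n).
Proof.
move=> K1 eta0 sp sq hH hw.
have e4 : 0 < eta / 4 by lra.
(* The bound holds only from index [N] on; the sequences are shifted by [N] so that it holds for all
   indices. *)
have [lam lam0 [N _ hN]] := hH _ e4.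
have srn n : sch (fun x => p (n + N)%N x - q (n + N)%N x).
  by have h1 := sp (n + N)%N; have h2 := sq (n + N)%N; sch_tac.
have [|||a [y [sa da ha hy]]] := @compact_resolvent K lam (eta / 4)
  (fun n x => p (n + N)%N x - q (n + N)%N x) K1 lam0 _ srn.
- exact: ltW.
- by move=> n; apply: hN; exact: leq_addl.
- move=> phi sphi; have := hw _ sphi.
  by rewrite -(cvg_shiftn N).
have c0 : 0 < eta / (4 * (1 + (2 * lam) ^+ 2)).
  by rewrite divr_gt0// mulr_gt0// ltr_pwDl// sqr_ge0.
have [M _ hM] := (cvgr0Pnorm_le _).1 hy _ c0.
exists (M + N)%N => // n /= Mn.
have nE : (n = (n - N) + N)%N by rewrite subnK// (leq_trans _ Mn)// leq_addl.
rewrite nE; exists (a (n - N)%N); split; [exact: sa|exact: da|].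
apply: (le_trans (ha _)).
have := hM (n - N)%N; rewrite /= leq_subRL; last by rewrite (leq_trans _ Mn)// leq_addl.
rewrite addnC => /(_ Mn); rewrite ger0_norm ?Iw_ge0// => h.
have l0 : 0 < 1 + (2 * lam) ^+ 2 by rewrite ltr_pwDl// sqr_ge0.
have h2 : (2 * lam) ^+ 2 * Iw (y (n - N)%N) <= eta / 4.
  apply: (le_trans (ler_wpM2l (sqr_ge0 _) h)).
  apply: (@le_trans _ _ ((1 + (2 * lam) ^+ 2) * (eta / (4 * (1 + (2 * lam) ^+ 2))))).
    by apply: ler_wpM2r; [exact: ltW|rewrite lerDr].
  by rewrite le_eqVlt; apply/orP; left; apply/eqP; field; exact: lt0r_neq0.
by lra.
Qed.

End Compactness.

(** * Equicontinuity *)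

Section Equicontinuity.
Context {R : realType}.
Implicit Types (phi psi z : schwartz R) (q u : Hm1 R).

Definition mkS (f : R -> R) (sf : sch f) : schwartz R := Schwartz ((schP f).1 sf).

Lemma schS phi : sch phi.
Proof. by apply/schP; exact: schwartz_funP. Qed.

Definition HsmF (lam e : R) q := forall phi,
  q phi ^+ 2 <= e * I (fun x => phi^`() x ^+ 2 + 4 * lam ^+ 2 * phi x ^+ 2).

Lemma HsmF_schwartz lam e (f : schwartz R) : HsmF lam e (Hm1_of_schwartz f) <-> Hsm lam e f.
Proof. by split => h phi; [move=> sp; exact: (h (mkS sp))|exact: h (schS phi)]. Qed.

Lemma Hm1norm_ge0 q : 0 <= Hm1norm q.
Proof. exact: (normr_ge0 q). Qed.

Lemma Hm1_lin3 q (w f g h : schwartz R) (a b c : R) :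
  (forall x, w x = a * f x + b * g x + c * h x) -> q w = a * q f + b * q g + c * q h.
Proof.
move=> hw; have -> : w = a *: f + (b *: g + c *: h).
  by apply/val_inj/funext => x; rewrite /= hw -addrA.
by rewrite (Hm1_linear q a f) (Hm1_linear q b g) Hm1Z addrA.
Qed.

Lemma H1norm2 phi : H1norm phi ^+ 2 = I (fun x => phi x ^+ 2) + I (fun x => phi^`() x ^+ 2).
Proof.
have sp := schS phi; have s1 := sch_d sp.
by rewrite H1norm_sqr -ID; [|by nice_tac|by nice_tac].
Qed.

Lemma H1norm_wt phi (C : R) : 0 <= C -> (forall x, `|phi x| <= C * wt x) ->
  (forall x, `|phi^`() x| <= C * wt x) -> H1norm phi <= 3 * C.
Proof.
move=> C0 h0 h1; have sp := schS phi; have s1 := sch_d sp.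
have C3 : 0 <= 3 * C by lra.
rewrite -(ler_pXn2r (n := 2))// ?nnegrE ?H1norm_ge0// H1norm2.
have h (f : R -> R) : sch f -> (forall x, `|f x| <= C * wt x) -> I (fun x => f x ^+ 2) <= C ^+ 2 * 4.
  move=> sf hf; apply: (@le_trans _ _ (I (fun x => C ^+ 2 * wt x))).
    apply: I_le; try nice_tac; move=> x.
    rewrite -(real_normK (num_real (f x))).
    apply: (@le_trans _ _ ((C * wt x) ^+ 2)).
      by rewrite lerXn2r// ?nnegrE//; nonneg_tac.
    by rewrite exprMn ler_wpM2l ?sqr_ge0// wt_sq_le.
  rewrite IZ; last by nice_tac.
  by rewrite ler_wpM2l ?sqr_ge0// I_wt4.
by have := h _ sp h0; have := h _ s1 h1; rewrite exprMn; have := sqr_ge0 C; lra.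
Qed.

Lemma taylor2_sym (f f1 f2 : R -> R) (S h x : R) : dv f f1 -> dv f1 f2 -> 0 <= S ->
  (forall y, `|f2 y| <= S * wt y) -> `|h| <= 1 ->
  `|f (x - h) - f x + h * f1 x| <= 3 * S * h ^+ 2 * wt x.
Proof.
move=> d0 d1 S0 hS h1; have [h0|h0] := leP 0 h.
  by apply: (taylor2 x d0 d1 S0 hS h0); move: h1; rewrite ger0_norm.
have d0' := dv_opp d0; have d1' : dv (fun x => - f1 (- x)) (fun x => f2 (- x)).
  by apply: (dv_eq (dvN (dv_opp d1))) => y; rewrite opprK.
have hS' y : `|f2 (- y)| <= S * wt y by rewrite (le_trans (hS _))// /wt sqrrN.
have mh0 : 0 <= - h by rewrite oppr_ge0 ltW.
have mh1 : - h <= 1 by move: h1; rewrite ltr0_norm.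
have := taylor2 (- x) d0' d1' S0 hS' mh0 mh1.
rewrite /wt !sqrrN opprB !opprK.
by rewrite mulrN mulNr opprK [- h + x]addrC.
Qed.

Definition shS (s : R) phi := schwartz_shift (- s) phi.

(** The functional sees the Taylor remainder of [z] only through its H^1 norm, which is [O(h^2)] and
    invariant under the translation by [t]. *)
Lemma Hm1_shift_dv q (z z1 : schwartz R) : z^`() = z1 ->
  dv (fun s => q (shS s z)) (fun s => - q (shS s z1)).
Proof.
move=> dz t; apply: is_derive_eps => e e0.
have sz := schS z; have sz1 := schS z1; have s2 := sch_d sz1; have s3 := sch_d s2.
have dz0 : dv z z1 by rewrite -dz; exact: sch_dv.
have [_ [A hA]] := sch_nice s2; have [_ [B hB]] := sch_nice s3.
pose S : R := `|A| + `|B|.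
have S0 : 0 <= S by rewrite addr_ge0.
have hS2 x : `|z1^`() x| <= S * wt x.
  apply: (le_trans (hA x)); rewrite ler_wpM2r ?wt_ge0// (le_trans (ler_norm A))// lerDl//.
have hS3 x : `|z1^`()^`() x| <= S * wt x.
  apply: (le_trans (hB x)); rewrite ler_wpM2r ?wt_ge0// (le_trans (ler_norm B))// lerDr//.
pose M := Hm1norm q * (3 * (3 * S)) + 1.
have N0 := Hm1norm_ge0 q.
have M0 : 0 < M by rewrite ltr_wpDl// mulr_ge0// !mulr_ge0.
exists (Num.min 1 (e / M)); first by rewrite lt_min ltr01 divr_gt0.
move=> h /andP[h0]; rewrite lt_min => /andP[h1 heM].
have hn : h != 0 by rewrite -normr_gt0.
have sW : sch (fun x => z (x - h) - z x + h * z1 x).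
  by have := sch_shiftf h sz; rewrite /shiftf => h2; sch_tac.
pose W := mkS sW.
have qW : q (shS t W) = q (shS (t + h) z) - q (shS t z) + h * q (shS t z1).
  rewrite (@Hm1_lin3 q (shS t W) (shS (t + h) z) (shS t z) (shS t z1) 1 (-1) h) ?mul1r ?mulN1r//.
  by move=> x /=; rewrite mul1r mulN1r opprD addrA.
have Wle : H1norm W <= 3 * (3 * S * h ^+ 2).
  apply: H1norm_wt => [|x|x]; first by apply: mulr_ge0 (sqr_ge0 _); apply: mulr_ge0.
    exact: (taylor2_sym x dz0 (sch_dv sz1) S0 hS2 (ltW h1)).
  have -> : W^`() = fun x => z1 (x - h) - z1 x + h * z1^`() x.
    apply: dv_derive1E; rewrite /W /=.
    have d1 := dv_shift (- h) dz0; have d2 := sch_dv sz1.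
    by dv_compute; ring.
  exact: (taylor2_sym x (sch_dv sz1) (sch_dv s2) S0 hS3 (ltW h1)).
have qWle : `|q (shS t W)| <= Hm1norm q * (3 * (3 * S * h ^+ 2)).
  apply: (le_trans (Hm1normP q _)); rewrite H1norm_shift ler_wpM2l//.
have -> : (q (shS (t + h) z) - q (shS t z)) / h - - q (shS t z1) = q (shS t W) / h.
  by rewrite qW; field.
rewrite normrM normfV ler_pdivrMr//; apply: (le_trans qWle).
have -> : Hm1norm q * (3 * (3 * S * h ^+ 2)) = Hm1norm q * (3 * (3 * S)) * `|h| * `|h|.
  by rewrite -(real_normK (num_real h)); ring.
rewrite ler_pM2r//; move: heM; rewrite ltr_pdivlMr// => heM.
apply: le_trans (ltW heM); rewrite mulrC ler_wpM2l//.
by rewrite /M lerDl.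
Qed.

Lemma le_of_sqr (x y : R) : 0 <= x -> 0 <= y -> x ^+ 2 <= y ^+ 2 -> x <= y.
Proof. by move=> x0 y0; rewrite ler_pXn2r. Qed.

Lemma resolvent_arith (a Hz Hp A B C P : R) : Hz ^+ 2 = A + B -> Hp ^+ 2 = P + C ->
  P = B + a ^+ 2 * A -> a ^+ 2 * B <= C -> 0 <= B -> (a * Hz) ^+ 2 <= Hp ^+ 2.
Proof. by rewrite exprMn => -> -> ->; lra. Qed.

Lemma resolvent_arith_L2 (a Hz A B P : R) : Hz ^+ 2 = A + B -> P = B + a ^+ 2 * A ->
  0 <= A -> 0 <= B -> (a * Hz) ^+ 2 <= (1 + a ^+ 2) * P.
Proof. by rewrite exprMn => -> -> A0 B0; have := mulr_ge0 (sqr_ge0 (a ^+ 2)) A0; lra. Qed.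

Section Resolvent.
Variables (q : Hm1 R) (B a s0 dl : R) (phi z z1 : schwartz R).
Hypotheses (B0 : 0 <= B) (qB : Hm1norm q <= B) (a0 : 0 < a) (s00 : 0 < s0)
  (dl0 : 0 <= dl) (hq : forall s : R, 0 <= s <= s0 -> Hm1norm (translate s q - q) <= dl)
  (dz : z^`() = z1) (ez : forall x, phi x = z1 x + a * z x).

Let sz : sch z. Proof. exact: schS. Qed.
Let sz1 : sch z1. Proof. exact: schS. Qed.
Let sphi : sch phi. Proof. exact: schS. Qed.
Let dvz : dv z z1. Proof. by rewrite -dz; exact: sch_dv. Qed.

Let Iphi : I (fun x => phi x ^+ 2) = I (fun x => z1 x ^+ 2) + a ^+ 2 * I (fun x => z x ^+ 2).
Proof.
have h1 := sz; have h2 := sz1; have h3 := sphi; have h4 := dvz.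
rewrite -IZ; last by nice_tac.
rewrite -ID; [|by nice_tac|by nice_tac].
apply: (I_dv_eq (F := fun x => a * z x ^+ 2)); try nice_tac.
by dv_compute; rewrite ez; ring.
Qed.

Let Iphi1 : a ^+ 2 * I (fun x => z1 x ^+ 2) <= I (fun x => phi^`() x ^+ 2).
Proof.
have h1 := sz; have h2 := sz1; have h3 := sphi; have h4 := dvz; have s2 := sch_d h2; have d2 := sch_dv h2.
have E x : phi^`() x = z1^`() x + a * z1 x.
  have -> : (phi : R -> R) = fun x => z1 x + a * z x by apply/funext => y; rewrite ez.
  have dd : dv (fun x => z1 x + a * z x) (fun x => z1^`() x + a * z1 x) by dv_compute; ring.
  exact: (dv_derive1 x dd).
have s3 := sch_d h3.
have -> : I (fun x => phi^`() x ^+ 2) = I (fun x => z1^`() x ^+ 2) + a ^+ 2 * I (fun x => z1 x ^+ 2).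
  rewrite -IZ; last by nice_tac.
  rewrite -ID; [|by nice_tac|by nice_tac].
  apply: (I_dv_eq (F := fun x => a * z1 x ^+ 2)); try nice_tac.
  by dv_compute; rewrite E; ring.
by rewrite lerDr; apply: I_ge0 => x; exact: sqr_ge0.
Qed.

Lemma resolvent_H1 : a * H1norm z <= H1norm phi.
Proof.
have aH : 0 <= a * H1norm z by rewrite mulr_ge0 ?H1norm_ge0// ltW.
have e1 : H1norm z ^+ 2 = I (fun x => z x ^+ 2) + I (fun x => z1 x ^+ 2) by rewrite H1norm2 dz.
have e2 := H1norm2 phi.
have i1 : 0 <= I (fun x => z1 x ^+ 2) by apply: I_ge0 => x; exact: sqr_ge0.
have e3 := Iphi; have e4 := Iphi1.
exact: (le_of_sqr aH (H1norm_ge0 phi) (resolvent_arith e1 e2 e3 e4 i1)).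
Qed.

Lemma resolvent_H1_L2 : (a * H1norm z) ^+ 2 <= (1 + a ^+ 2) * I (fun x => phi x ^+ 2).
Proof.
have e1 : H1norm z ^+ 2 = I (fun x => z x ^+ 2) + I (fun x => z1 x ^+ 2) by rewrite H1norm2 dz.
have i1 : 0 <= I (fun x => z1 x ^+ 2) by apply: I_ge0 => x; exact: sqr_ge0.
have i0 : 0 <= I (fun x => z x ^+ 2) by apply: I_ge0 => x; exact: sqr_ge0.
exact: (resolvent_arith_L2 e1 Iphi i0 i1).
Qed.

(** As $\phi = z' + a z$, the function $a z$ is the average of the translates $\phi(\cdot - s)$, $s
    > 0$, with density $a e^{-as}$. For $s \le s_0$ equicontinuity compares [q] on them with
    [q phi]; the tail has mass $e^{-a s_0}$. No vector-valued integral is formed: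
    [f s = q (shS s z)] solves [f' = a f - F], and [V] comes from variation of constants. *)
Lemma resolvent_approx : `|a * q z - q phi| <= (dl + 2 * B * expR (- (a * s0))) * H1norm phi.
Proof.
have an : a != 0 by exact: lt0r_neq0.
have an' := a0.
pose f s := q (shS s z); pose F s := q (shS s phi).
have N0 := H1norm_ge0 phi; set N := H1norm phi in N0 *.
have df : dv f (fun s => a * f s - F s).
  apply: (dv_eq (Hm1_shift_dv q dz)) => s; rewrite /F /f.
  rewrite (@Hm1_lin3 q (shS s phi) (shS s z1) (shS s z) (shS s z) 1 a 0) ?mul1r ?mul0r ?addr0.
    by ring.
  by move=> x /=; rewrite ez; ring.
have sh0 psi : shS 0 psi = psi.
  by apply/val_inj/funext => x /=; rewrite oppr0 addr0.
have FF s : 0 <= s <= s0 -> `|F s - F 0| <= dl * N.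
  move=> hs; have := Hm1normP (translate s q - q) phi.
  have -> : (translate s q - q) phi = F s - F 0 by rewrite /F sh0.
  by move=> h; apply: (le_trans h); rewrite ler_wpM2r// hq.
pose V s := expR (- (a * s)) * (f s - F 0 / a).
have dV : dv V (fun s => expR (- (a * s)) * (F 0 - F s)).
  rewrite {1}/V; dv_compute; move: (expR _) (f _) (F _) (F _) => *; field; exact: an.
pose E s := expR (- (a * s)).
have dE : dv E (fun s => - a * E s) by rewrite {1}/E; dv_compute; rewrite /E; ring.
have E0 s : 0 <= E s by exact: expR_ge0.
have s0' : 0 <= s0 by exact: ltW.
have V0 : `|V 0| <= `|V s0| + dl * N / a.
  have dp : dv (fun s => - (V s + dl * N / a * E s)) (fun s => E s * (dl * N - (F 0 - F s))).
    by dv_compute; rewrite /E; move: (expR _) (F _) (F _) => *; field; exact: an.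
  have dm : dv (fun s => V s - dl * N / a * E s) (fun s => E s * (dl * N + (F 0 - F s))).
    by dv_compute; rewrite /E; move: (expR _) (F _) (F _) => *; field; exact: an.
  have hb s : 0 < s < s0 -> - (dl * N) <= F s - F 0 <= dl * N.
    by move=> /andP[h1 h2]; rewrite -ler_norml; apply: FF; rewrite !ltW.
  have h1 : - (V 0 + dl * N / a * E 0) <= - (V s0 + dl * N / a * E s0).
    by apply: (dv_le dp) => // s hs; rewrite mulr_ge0//; have /andP[] := hb s hs; lra.
  have h2 : V 0 - dl * N / a * E 0 <= V s0 - dl * N / a * E s0.
    by apply: (dv_le dm) => // s hs; rewrite mulr_ge0//; have /andP[] := hb s hs; lra.
  have Es : E 0 = 1 by rewrite /E mulr0 oppr0 expR0.
  have dNE : 0 <= dl * N / a * E s0.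
    by rewrite mulr_ge0// divr_ge0 ?mulr_ge0// ltW.
  have := ler_norm (V s0); have := ler_norm (- V s0); rewrite normrN.
  rewrite Es mulr1 in h1 h2.
  by move=> h3 h4; rewrite ler_norml; apply/andP; split; lra.
have Vs : a * `|V s0| <= 2 * B * E s0 * N.
  rewrite /V normrM (ger0_norm (expR_ge0 _)) -/(E s0).
  have -> : a * (E s0 * `|f s0 - F 0 / a|) = E s0 * (a * `|f s0 - F 0 / a|) by ring.
  have -> : 2 * B * E s0 * N = E s0 * (2 * B * N) by ring.
  rewrite ler_wpM2l//.
  have -> : a * `|f s0 - F 0 / a| = `|a * f s0 - F 0|.
    by rewrite -{1}(gtr0_norm a0) -normrM; congr (`|_|); field; exact: an.
  apply: (le_trans (ler_normB _ _)).
  have h1 : `|a * f s0| <= B * N.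
    rewrite normrM (gtr0_norm a0).
    apply: (@le_trans _ _ (a * (B * H1norm z))).
      apply: ler_wpM2l; first exact: ltW.
      apply: (le_trans (Hm1normP q _)); rewrite H1norm_shift ler_wpM2r ?H1norm_ge0//.
    by rewrite mulrCA ler_wpM2l//; exact: resolvent_H1.
  have h2 : `|F 0| <= B * N.
    apply: (le_trans (Hm1normP q _)); rewrite H1norm_shift ler_wpM2r//.
  by lra.
have -> : a * q z - q phi = a * V 0.
  rewrite /V mulr0 oppr0 expR0 /f /F !sh0; field; exact: an.
rewrite normrM (gtr0_norm a0).
apply: (@le_trans _ _ (a * (`|V s0| + dl * N / a))); first by rewrite ler_wpM2l// ltW.
have -> : a * (`|V s0| + dl * N / a) = a * `|V s0| + dl * N by field; exact: an.
by rewrite -/(E s0); lra.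
Qed.

End Resolvent.
End Equicontinuity.

Section Uniform.
Context {R : realType}.
Implicit Types (phi psi z : schwartz R) (q u : Hm1 R).

Lemma equicontinuous_arith (N Hz qz qp P D l a B eta c : R) : 0 < eta -> 0 <= B -> 0 < a ->
  0 <= P -> 0 <= D -> 0 <= Hz -> 0 <= N -> N ^+ 2 = P + D -> c <= eta / 8 ->
  `|a * qz - qp| <= (eta / 8 + c) * N -> (a * Hz) ^+ 2 <= (1 + a ^+ 2) * P -> `|qz| <= B * Hz ->
  1 + B * (1 + a) / eta <= l -> qp ^+ 2 <= eta ^+ 2 * (D + 4 * l ^+ 2 * P).
Proof.
move=> e0 B0 a0 P0 D0 H0 N0 hN hc hX hz hq hl.
have en : eta != 0 by exact: lt0r_neq0.
have Ba : 0 <= B * (1 + a) / eta by apply: divr_ge0 (ltW e0); apply: mulr_ge0 => //; lra.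
have l1 : 1 <= l by lra.
have hX' : `|a * qz - qp| <= eta / 4 * N.
  by apply: (le_trans hX); rewrite ler_wpM2r//; lra.
have X2 : (a * qz - qp) ^+ 2 <= eta ^+ 2 / 16 * (P + D).
  rewrite -hN -(real_normK (num_real (_ - _))).
  have -> : eta ^+ 2 / 16 * N ^+ 2 = (eta / 4 * N) ^+ 2 by field.
  by rewrite lerXn2r// ?nnegrE// mulr_ge0//; lra.
have Y2 : (a * qz) ^+ 2 <= B ^+ 2 * ((1 + a ^+ 2) * P).
  apply: le_trans (ler_wpM2l (sqr_ge0 B) hz).
  rewrite -exprMn -(real_normK (num_real (a * qz))) lerXn2r ?nnegrE//.
    by apply: mulr_ge0 => //; apply: mulr_ge0 => //; exact: ltW.
  by rewrite normrM (gtr0_norm a0) mulrCA ler_pM2l.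
have hB : B ^+ 2 * (1 + a ^+ 2) <= eta ^+ 2 * l ^+ 2.
  apply: (@le_trans _ _ ((B * (1 + a)) ^+ 2)).
    by rewrite exprMn ler_wpM2l ?sqr_ge0//; lra.
  have h : B * (1 + a) <= eta * l.
    have -> : B * (1 + a) = eta * (B * (1 + a) / eta) by field.
    by rewrite ler_pM2l//; lra.
  rewrite -exprMn lerXn2r// ?nnegrE; first by rewrite mulr_ge0//; lra.
  by apply: le_trans h; rewrite mulr_ge0//; lra.
have Y3 : (a * qz) ^+ 2 <= eta ^+ 2 * l ^+ 2 * P.
  by apply: (le_trans Y2); rewrite mulrA ler_wpM2r.
have l2 : 1 <= l ^+ 2 by rewrite exprn_ege1.
have e2 : 0 <= eta ^+ 2 by exact: sqr_ge0.
have eP : eta ^+ 2 * P <= eta ^+ 2 * (l ^+ 2 * P) by rewrite ler_wpM2l// ler_peMl.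
have eD : 0 <= eta ^+ 2 * D by rewrite mulr_ge0.
have eP0 : 0 <= eta ^+ 2 * P by rewrite mulr_ge0.
by have := sqr_ge0 (2 * (a * qz) - qp); lra.
Qed.

(** Splits [phi] into [a z] and a rest, on which [q] is small relative to the H^1 norm of [phi] by
    [resolvent_approx]. The H^1 norm of [a z] is at most a multiple of the L^2 norm of [phi], and
    the weight [4 lam^2] absorbs it for large [lam]. *)
Lemma equicontinuous_HsmF (Q : set (Hm1 R)) (e : R) : bounded_set Q ->
  translation_equicontinuous Q -> 0 < e ->
  exists2 L : R, 0 < L & forall lam q, L <= lam -> Q q -> HsmF lam e q.
Proof.
move=> Qb Qe e0; pose eta := Num.sqrt e.
have eta0 : 0 < eta by rewrite sqrtr_gt0.
have etaE : eta ^+ 2 = e by rewrite sqr_sqrtr// ltW.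
have [B B0 hB] : exists2 B : R, 0 < B & forall q, Q q -> Hm1norm q <= B.
  have [M [Mr hM]] := Qb; exists (`|M| + 1); first by rewrite ltr_wpDl.
  by move=> q Qq; apply: (hM (`|M| + 1)) Qq; rewrite (le_lt_trans (ler_norm _))// ltrDl.
have d0 : 0 < eta / 8 by lra.
have /nbhs_ballP[r /= r0 hr] := Qe _ d0.
pose s0 := r / 2.
have s00 : 0 < s0 by rewrite /s0; lra.
have ht q s : Q q -> 0 <= s <= s0 -> Hm1norm (translate s q - q) <= eta / 8.
  move=> Qq /andP[h1 h2]; apply: ltW; apply: (hr s) Qq.
  by rewrite /ball /= sub0r normrN ger0_norm//; rewrite /s0 in h2; lra.
(* Order of choices: [s0] from equicontinuity, then [a] so large that the exponential tail is small,
   and last the bound on [lam], which grows with [a]. *)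
have [a a0 ha] : exists2 a : R, 0 < a & 2 * B * expR (- (a * s0)) <= eta / 8.
  have [N _ hN] := expRN_vanish 1 (2 * B) s00 d0.
  exists (1 + N%:R); first by rewrite ltr_pwDl.
  by rewrite mulrC [_ * s0]mulrC; apply: hN => /=.
exists (1 + B * (1 + a) / eta); first by rewrite ltr_pwDl//; apply: divr_ge0 (ltW eta0); apply: mulr_ge0 (ltW B0) _; lra.
move=> lam q hl Qq phi; have sp := schS phi; have s1 := sch_d sp.
have a2 : 0 < a / 2 by lra.
have [z0 [sz0 dz0]] := linear_schwartz a2 sch0 sp.
have sz1 := sch_d sz0.
pose z := mkS sz0; pose z1 := mkS sz1.
have ez x : phi x = z1 x + a * z x.
  by rewrite /z1 /z /= (dv_derive1 x dz0); field.
have hX := resolvent_approx (ltW B0) (hB q Qq) a0 s00 (ltW d0) (fun s => @ht q s Qq)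
  (erefl : z^`() = z1) ez.
have hY := resolvent_H1_L2 (erefl : z^`() = z1) ez.
have s1' : sch (fun x => phi^`() x) by [].
rewrite ID; [|by nice_tac|by nice_tac]; rewrite IZ; last by nice_tac.
rewrite -etaE; apply: (equicontinuous_arith eta0 (ltW B0) a0 _ _ (H1norm_ge0 z)
  (H1norm_ge0 phi) (H1norm2 phi) ha hX hY _ hl).
- by apply: I_ge0 => x; exact: sqr_ge0.
- by apply: I_ge0 => x; exact: sqr_ge0.
- by apply: (le_trans (Hm1normP q z)); rewrite ler_wpM2r ?H1norm_ge0//; exact: hB.
Qed.
End Uniform.

(** * Duality *)

Section Duality.
Context {R : realType}.
Implicit Types (f phi psi z : schwartz R) (q u : Hm1 R).

Definition ipH1 psi phi : R := I (fun x => psi x * phi x) + I (fun x => psi^`() x * phi^`() x).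

Lemma H1norm2F phi (f' : R -> R) : dv phi f' ->
  H1norm phi ^+ 2 = I (fun x => phi x ^+ 2) + I (fun x => f' x ^+ 2).
Proof. by move=> d; rewrite H1norm2 (dv_derive1E d). Qed.

Lemma quadratic_arith (X F P A B C D A' B' a b t : R) : X = A' + B' -> F = A + B -> P = C + D ->
  A' = A + 2 * t * a + t ^+ 2 * C -> B' = B + 2 * t * b + t ^+ 2 * D ->
  X = F + 2 * t * (a + b) + t ^+ 2 * P.
Proof. by move=> -> -> -> -> ->; ring. Qed.

Lemma ipH1_lin f phi (t : R) : H1norm (f + t *: phi) ^+ 2 =
  H1norm f ^+ 2 + 2 * t * ipH1 f phi + t ^+ 2 * H1norm phi ^+ 2.
Proof.
have sf := schS f; have sp := schS phi; have s1 := sch_d sf; have s2 := sch_d sp.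
have d1 := sch_dv sf; have d2 := sch_dv sp.
have d : dv (fun x => f x + t * phi x) (fun x => f^`() x + t * phi^`() x) by dv_compute; ring.
have h (a b : R -> R) : sch a -> sch b -> I (fun x => (a x + t * b x) ^+ 2) =
   I (fun x => a x ^+ 2) + 2 * t * I (fun x => a x * b x) + t ^+ 2 * I (fun x => b x ^+ 2).
  move=> sa sb; rewrite -!IZ; [|by nice_tac|by nice_tac]; rewrite -!ID; [|by nice_tac|by nice_tac|by nice_tac|by nice_tac].
  by apply: eq_I => x; ring.
exact: (quadratic_arith (@H1norm2F (f + t *: phi) _ d) (H1norm2 f) (H1norm2 phi) (h _ _ sf sp) (h _ _ s1 s2)).
Qed.

Lemma H1norm_L2 phi : I (fun x => phi x ^+ 2) <= H1norm phi ^+ 2 /\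
  I (fun x => phi^`() x ^+ 2) <= H1norm phi ^+ 2.
Proof. by rewrite H1norm2; split; rewrite ?lerDl ?lerDr; apply: I_ge0 => x; exact: sqr_ge0. Qed.

Lemma cauchy_schwarz_le (a b : R -> R) (A B : R) : nice a -> nice b -> 0 <= A -> 0 <= B ->
  I (fun x => a x ^+ 2) <= A ^+ 2 -> I (fun x => b x ^+ 2) <= B ^+ 2 ->
  `|I (fun x => a x * b x)| <= A * B.
Proof.
move=> na nb A0 B0 hA hB; apply: le_of_sqr => //; first exact: mulr_ge0.
rewrite (real_normK (num_real _)) exprMn; apply: (le_trans (cauchy_schwarz na nb)).
by apply: ler_pM; [apply: I_ge0 => x; exact: sqr_ge0|apply: I_ge0 => x; exact: sqr_ge0|exact: hA|exact: hB].
Qed.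

Lemma ipH1_le psi phi : `|ipH1 psi phi| <= 2 * H1norm psi * H1norm phi.
Proof.
have [a1 a2] := H1norm_L2 psi; have [b1 b2] := H1norm_L2 phi.
have N0 := H1norm_ge0 psi; have N0' := H1norm_ge0 phi.
have s1 := sch_nice (schS psi); have s2 := sch_nice (schS phi).
have s3 := sch_nice (sch_d (schS psi)); have s4 := sch_nice (sch_d (schS phi)).
apply: (le_trans (ler_normD _ _)).
apply: (le_trans (lerD (cauchy_schwarz_le s1 s2 N0 N0' a1 b1) (cauchy_schwarz_le s3 s4 N0 N0' a2 b2))).
by rewrite -mulrA mulr_natl mulr2n.
Qed.

Lemma ipH1Z (c : R) f phi : ipH1 (c *: f) phi = c * ipH1 f phi.
Proof.
have sf := schS f; have sp := schS phi; have s1 := sch_d sf; have s2 := sch_d sp.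
have d1 := sch_dv sf.
have dd : dv (c *: f : schwartz R) (fun x => c * f^`() x).
  have d : dv (fun x => c * f x) (fun x => c * f^`() x) by dv_compute; ring.
  exact: d.
rewrite /ipH1 (dv_derive1E dd) mulrDr -!IZ; [|by nice_tac|by nice_tac].
by congr (_ + _); apply: eq_I => x; rewrite mulrA.
Qed.

(** The square root in the norm is removed by $X \le (1 + X^2)/2$, which is sharp on the unit
    sphere; the result is the first order condition at a near maximiser, with defect [eta]. *)
Lemma maximizer_arith (HX F N p uX uf uphi M eta t : R) : 0 < M -> 0 <= F -> F <= 1 ->
  M - eta <= uf -> uX = uf + t * uphi -> uX <= M * HX ->
  HX ^+ 2 = F ^+ 2 + 2 * t * p + t ^+ 2 * N ^+ 2 ->
  t * (uphi - M * p) <= eta + M * t ^+ 2 * N ^+ 2 / 2.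
Proof.
move=> M0 F0 F1 huf -> h2 h3.
have h4 : F ^+ 2 <= 1 by rewrite exprn_ile1.
have h5 : M * HX <= M * ((1 + HX ^+ 2) / 2).
  by rewrite ler_pM2l//; have := sqr_ge0 (HX - 1); lra.
rewrite h3 in h5.
have h6 : M * ((1 + (F ^+ 2 + 2 * t * p + t ^+ 2 * N ^+ 2)) / 2) <=
  M * ((1 + (1 + 2 * t * p + t ^+ 2 * N ^+ 2)) / 2) by rewrite ler_pM2l//; lra.
by lra.
Qed.

Lemma maximizer_scale (u p N d M eta : R) : 0 <= N -> 0 < d -> 0 < M -> eta = d ^+ 2 / (2 * M) ->
  (forall t, t * (u - M * p) <= eta + M * t ^+ 2 * N ^+ 2 / 2) -> `|u - M * p| <= d * N.
Proof.
move=> N0 d0 Mp etaE key; have Mn : M != 0 by exact: lt0r_neq0.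
apply/ler_addgt0Pl => e e0.
(* [N] may vanish, so the optimal [t] is formed with [N + k] in its place; this costs the extra [e],
   which is arbitrary. *)
pose k := e / d; have k0 : 0 < k by exact: divr_gt0.
pose t := d / (M * (N + k)).
have Nk : 0 < N + k by rewrite ltr_wpDl.
have t0 : 0 < t by rewrite divr_gt0// mulr_gt0.
have dn : d != 0 by exact: lt0r_neq0.
have Nkn : N + k != 0 by exact: lt0r_neq0.
have b (X : R) : t * X <= eta + M * t ^+ 2 * N ^+ 2 / 2 -> X <= e + d * N.
  move=> hX; rewrite -(ler_pM2l t0); apply: (le_trans hX).
  have N2 : N ^+ 2 <= (N + k) ^+ 2 by rewrite lerXn2r ?nnegrE//; lra.
  have c0 : 0 <= M * t ^+ 2 / 2 by nonneg_tac.
  have := ler_wpM2l c0 N2.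
  have -> : M * t ^+ 2 / 2 * (N + k) ^+ 2 = eta by rewrite /t etaE; field; rewrite Mn.
  have -> : t * (e + d * N) = 2 * eta.
    have -> : e = d * k by rewrite /k; field.
    by rewrite /t etaE; field; rewrite Mn.
  by lra.
rewrite ler_norml; apply/andP; split.
- rewrite lerNl; apply: b; have := key (- t); rewrite sqrrN mulNr -mulrN; exact.
- exact: b (key t).
Qed.

(** Approximate Riesz representation. Schwartz functions are not complete for the H^1 norm, so [u]
    need not attain its norm on them; but if [f] is a near maximiser on the unit ball, [M *: f]
    represents [u] up to [d] by the first order condition at [f]. *)
Lemma near_maximizer u (d : R) : 0 < d -> exists psi, forall phi,
  `|u phi - ipH1 psi phi| <= d * H1norm phi.
Proof.
move=> d0; have M0 := Hm1norm_ge0 u; set M := Hm1norm u in M0.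
have [Mz|Mn] := eqVneq M 0.
  exists (0 *: 0) => phi; rewrite ipH1Z mul0r subr0.
  by apply: (le_trans (Hm1normP u phi)); rewrite -/M Mz mul0r mulr_ge0 ?H1norm_ge0// ltW.
have Mp : 0 < M by rewrite lt_def Mn.
(* The first order condition with defect $\eta$ leaves an error $N\sqrt{2M\eta}$, which is $dN$ for
   this value. *)
pose eta := d ^+ 2 / (2 * M).
have eta0 : 0 < eta by rewrite divr_gt0// ?exprn_gt0// mulr_gt0.
have [f [f1 uf]] : exists f, H1norm f <= 1 /\ M - eta <= u f.
  have [f f1 uf] : exists2 f, H1norm f <= 1 & M - eta <= `|u f|.
    apply: contrapT => h.
    have : Hm1norm u <= M - eta.
      apply: Hm1norm_le => phi hp; rewrite leNgt; apply/negP => h2.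
      by apply: h; exists phi => //; exact: ltW.
    by rewrite -/M; lra.
  have [u0|u0] := leP 0 (u f); first by exists f; move: uf; rewrite ger0_norm.
  exists (-1 *: f); rewrite H1normZ normrN normr1 mul1r Hm1Z mulN1r; split => //.
  by move: uf; rewrite ltr0_norm.
exists (M *: f) => phi; rewrite ipH1Z.
have N0 := H1norm_ge0 phi; set N := H1norm phi in N0 *.
set p := ipH1 f phi.
have key (t : R) : t * (u phi - M * p) <= eta + M * t ^+ 2 * N ^+ 2 / 2.
  have h1 : u (f + t *: phi) = u f + t * u phi.
    by rewrite [f + _]addrC (Hm1_linear u t phi f) [RHS]addrC.
  have h2 : u (f + t *: phi) <= M * H1norm (f + t *: phi).
    exact: le_trans (ler_norm _) (Hm1normP u _).
  have h3 := ipH1_lin f phi t.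
  exact: (maximizer_arith Mp (H1norm_ge0 f) f1 uf h1 h2 h3).
exact: (maximizer_scale N0 d0 Mp (erefl eta) key).
Qed.

(* [f - f''], the Riesz isomorphism from H^1 to H^{-1}. *)
Definition helm f : schwartz R := f - mkS (sch_d (sch_d (schS f))).

Lemma helm_pair f phi : Hm1_of_schwartz (helm f) phi = ipH1 f phi.
Proof.
have sf := schS f; have sp := schS phi; have s1 := sch_d sf; have s2 := sch_d sp; have s3 := sch_d s1.
rewrite /= /ipH1 -ID; [|by nice_tac|by nice_tac].
have d1 := sch_dv s1; have d2 := sch_dv sp.
rewrite -/(I _).
have -> : I (fun x => helm f x * phi x) = I (fun x => (f x - f^`()^`() x) * phi x) by [].
apply/esym; apply: (I_dv_eq (F := fun x => f^`() x * phi x)); try nice_tac.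
by dv_compute; ring.
Qed.

Lemma schwartz_dense u (d : R) : 0 < d -> exists f, Hm1norm (Hm1_of_schwartz f - u) <= d.
Proof.
move=> d0; have [psi hpsi] := near_maximizer u d0.
exists (helm psi); apply: Hm1norm_le => phi h1.
have -> : (Hm1_of_schwartz (helm psi) - u) phi = ipH1 psi phi - u phi.
  by rewrite -helm_pair.
rewrite distrC; apply: (le_trans (hpsi phi)); rewrite ler_piMr//; exact: ltW.
Qed.

(** $1 - \partial^2$ is the product of $\partial + 1$ and $-\partial + 1$, hence two first order
    equations with parameter [2^-1], the damping being [2 k]. The norm bound comes from pairing [f]
    with the solution itself. *)
Lemma helm_surj f : exists psi, helm psi = f /\ H1norm psi <= Hm1norm (Hm1_of_schwartz f).
Proof.
have h2 : 0 < 2^-1 :> R by [].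
have sf := schS f.
have [y [sy dy]] := linear_schwartz h2 sch0 sf.
have [z [sz dz]] := linear_schwartz_back h2 sch0 sy.
have ez : z^`() = fun x => z x - y x.
  by apply: dv_derive1E; apply: (dv_eq dz) => x; field.
have ez2 : z^`()^`() = fun x => z x - f x.
  rewrite ez; apply: dv_derive1E.
  have dz' : dv z (fun x => z x - y x) by apply: (dv_eq dz) => x; field.
  by dv_compute; field.
exists (mkS sz).
have hf : helm (mkS sz) = f.
  apply/val_inj/funext => x /=.
  rewrite -[LHS]/(z x - z^`()^`() x) ez2; ring.
split => //.
have := Hm1normP (Hm1_of_schwartz f) (mkS sz).
rewrite -{1}hf helm_pair.
have -> : ipH1 (mkS sz) (mkS sz) = H1norm (mkS sz) ^+ 2 by rewrite H1norm2.
rewrite ger0_norm ?sqr_ge0// expr2 => h.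
have [->|n0] := eqVneq (H1norm (mkS sz)) 0; first exact: Hm1norm_ge0.
by rewrite -(ler_pM2r (x := H1norm (mkS sz)))// lt_def n0 H1norm_ge0.
Qed.

End Duality.

(** * Functionals on Schwartz data *)

Section Evaluation.
Context {R : realType}.
Variable phi : schwartz R.

Definition evaluation (u : Hm1 R) : R^o := u phi.

Lemma evaluation_linear : linear evaluation.
Proof. by move=> a u v. Qed.

HB.instance Definition _ :=
  GRing.isLinear.Build R (Hm1 R) R^o *:%R evaluation evaluation_linear.

Lemma evaluation_continuous : continuous evaluation.
Proof.
have N0 := H1norm_ge0 phi.
apply/linear_bounded_continuous/linear_boundedP.
exists (H1norm phi); split; first exact: num_real.
move=> r hr u; apply: (le_trans (Hm1normP u phi)).
by rewrite mulrC; apply: (ler_wpM2r (normr_ge0 u)); exact: ltW.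
Qed.

End Evaluation.

Section Links.
Context {R : realType}.
Implicit Types (f phi psi : schwartz R) (u : Hm1 R).

Lemma Hm1_schwartz_sym f phi : Hm1_of_schwartz f phi = Hm1_of_schwartz phi f.
Proof. by apply: eq_I => x; rewrite mulrC. Qed.

Lemma Hm1_of_schwartz_linear : linear (@Hm1_of_schwartz R).
Proof.
move=> a f g; apply/val_inj/funext => phi.
transitivity (Hm1_of_schwartz phi (a *: f + g)); first exact: Hm1_schwartz_sym.
rewrite (Hm1_linear (Hm1_of_schwartz phi) a f g).
exact: (congr2 (fun x y : R => a * x + y) (Hm1_schwartz_sym phi f) (Hm1_schwartz_sym phi g)).
Qed.

Lemma weak_cvg_test (u : nat -> Hm1 R) v phi : weak_cvg u v -> u n phi @[n --> \oo] --> v phi.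
Proof. by move=> h; exact: (h (evaluation phi) (@evaluation_continuous R phi)). Qed.

Lemma kdvsolP (q : R -> schwartz R) : kdv_schwartz_solution q -> kdvsol (fun t => q t : R -> R).
Proof.
move=> hq; split=> [t|t e e0]; first exact: schS.
have e2 : 0 < e / 2 by lra.
(* The seminorms with factors 1 and [x ^+ 2], each at most [e / 2], add up to a bound relative to
   the weight [wt]. *)
have hb k : \forall h \near 0^', forall x, `|x ^+ k *
   (h^-1 * (q (t + h) x - q t x) - kdv_rhs (q t) x)| <= e / 2.
  have hh : \forall h \near (0 : R)^', (schwartz_seminorm k 0
     (fun x => (h^-1 * (q (t + h)%R x - q t x) - kdv_rhs (q t) x)%R) < (e / 2)%:E)%E.
    exact: (hq t k 0%N _ (@nbhs_open_ereal_lt R 0 (fun=> e / 2) e2)).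
  move: hh; apply: filterS => h hh x.
  rewrite -lee_fin; apply: le_trans (ltW hh).
  by apply: ereal_sup_ubound; exists x.
have hb2 : nbhs (0 : R) (fun h => h != 0 -> (forall x, `|x ^+ 0 *
     (h^-1 * (q (t + h) x - q t x) - kdv_rhs (q t) x)| <= e / 2) /\
   forall x, `|x ^+ 2 * (h^-1 * (q (t + h) x - q t x) - kdv_rhs (q t) x)| <= e / 2).
  exact: filterI (hb 0%N) (hb 2%N).
have /nbhs_ballP[r /= r0 hr] := hb2; exists r => // h /andP[h0 hr'] x.
have hn : h != 0 by rewrite -normr_gt0.
have [|| h1 h2] := hr h; [by rewrite /ball /= sub0r normrN|exact: hn|].
have := h1 x; have := h2 x; rewrite expr0 mul1r [h^-1 * _]mulrC.
move: (_ / h - _) => D hD2 hD0.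
rewrite /wt ler_pdivlMr ?oneDsq_gt0// mulrDr mulr1 mulrC.
by move: hD2; rewrite normrM [`|x ^+ 2|]ger0_norm ?sqr_ge0//; lra.
Qed.

Lemma rsm_bound_arith (k d P D N z : R) : 1 <= k -> 0 <= d -> d <= 1 -> 0 <= P -> 0 <= D -> 0 <= N ->
  N <= 1 -> P <= N ^+ 2 -> D <= N ^+ 2 -> z ^+ 2 <= 4 * d * (D + 4 * k ^+ 2 * P) -> `|z| <= 5 * k.
Proof.
move=> k1 d0 d1 P0 D0 N0 N1 hP hD hz.
have N2 : N ^+ 2 <= 1 by rewrite exprn_ile1.
have k2 : 1 <= k ^+ 2 by rewrite exprn_ege1.
apply: le_of_sqr; [by []|by lra|].
rewrite (real_normK (num_real _)); apply: (le_trans hz).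
have kP : k ^+ 2 * P <= k ^+ 2 * 1 by rewrite ler_wpM2l//; lra.
have X0 : 0 <= D + 4 * k ^+ 2 * P by apply: addr_ge0 => //; nonneg_tac.
have := ler_wpM2r X0 d1; lra.
Qed.

Lemma norm_of_rsm k d f : 1 <= k -> d <= 1 -> rsm k d f -> Hm1norm (Hm1_of_schwartz f) <= 5 * k.
Proof.
move=> k1 d1 [v [rv Iv]]; have sf := schS f.
have hH := Ric_Hsm k1 sf rv Iv d1.
have d0 : 0 <= d by apply: le_trans Iv; apply: I_ge0 => x; exact: sqr_ge0.
apply: Hm1norm_le => phi p1; have sp := schS phi; have s1 := sch_d sp.
have := hH phi sp; rewrite ID; [|by nice_tac|by nice_tac]; rewrite IZ; last by nice_tac.
have [a1 a2] := H1norm_L2 phi; have N0 := H1norm_ge0 phi.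
have P0 : 0 <= I (fun x => phi x ^+ 2) by apply: I_ge0 => x; exact: sqr_ge0.
have D0 : 0 <= I (fun x => phi^`() x ^+ 2) by apply: I_ge0 => x; exact: sqr_ge0.
exact: (rsm_bound_arith k1 d0 d1 P0 D0 N0 p1 a1 a2).
Qed.

Lemma helm_linear : linear (@helm R).
Proof.
move=> a f g; apply/val_inj/funext => x.
have e : (a *: (f : R -> R) + (g : R -> R))^`()^`() x = a * f^`()^`() x + g^`()^`() x.
  exact: (congr1 (fun h => h x) (derive1n_lin a 2 (@schwartz_smooth R f) (@schwartz_smooth R g))).
transitivity (a * f x + g x - (a *: (f : R -> R) + (g : R -> R))^`()^`() x); first by [].
rewrite e; transitivity (a * (f x - f^`()^`() x) + (g x - g^`()^`() x)); last by [].
by rewrite mulrBr opprD addrACA.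
Qed.

Lemma ipH1C f g : ipH1 f g = ipH1 g f.
Proof.
by apply: (congr2 (fun x y : R => x + y)); apply: eq_I => x; exact: mulrC.
Qed.

(** Reflexivity in approximate form: composed with [helm], the functional is bounded for the H^1
    norm, hence is itself an element of [Hm1] to which [near_maximizer] applies. On norm bounded
    families of Schwartz functions a continuous functional thus reduces to a test function. *)
Lemma functional_approx (L : {linear Hm1 R -> R^o}) (d : R) : continuous L -> 0 < d ->
  exists phi, forall f, `|L (Hm1_of_schwartz f) - Hm1_of_schwartz f phi| <= d * Hm1norm (Hm1_of_schwartz f).
Proof.
move=> cL d0.
have [C C0 hC] : exists2 C : R, 0 <= C & forall u, `|L u| <= C * Hm1norm u.
  have /linear_bounded_continuous/linear_boundedP[M [_ hM]] := cL.
  exists (`|M| + 1) => [|u]; first by rewrite addr_ge0.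
  by apply: hM; rewrite (le_lt_trans (ler_norm M))// ltrDl.
have hl : (fun psi => L (Hm1_of_schwartz (helm psi)) : R^o) \in Hm1_pred.
  apply/Hm1_predP; split=> [a f g|]; last first.
    exists (C * 2) => psi; apply: (le_trans (hC _)).
    rewrite -mulrA ler_wpM2l//; apply: Hm1norm_le => phi p1.
    rewrite helm_pair; apply: (le_trans (ipH1_le psi phi)).
    by rewrite ler_piMr// mulr_ge0// H1norm_ge0.
  by rewrite helm_linear Hm1_of_schwartz_linear linearP.
have [phi hphi] := near_maximizer (MkHm1 hl) d0.
exists phi => f; have [psi [hpsi Npsi]] := helm_surj f.
have e1 : L (Hm1_of_schwartz f) = (MkHm1 hl) psi by rewrite /= hpsi.
have e2 : Hm1_of_schwartz f phi = ipH1 phi psi.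
  by rewrite -hpsi helm_pair; exact: ipH1C.
rewrite e1 e2; apply: (le_trans (hphi psi)).
by rewrite ler_wpM2l// ltW.
Qed.

End Links.

(** * Comparison of two sequences of solutions *)

Section WeakContinuity.
Context {R : realType}.

Lemma perturb_arith (lam e M N P D a b : R) : 1 <= lam -> 0 <= P -> 0 <= D -> 0 <= M -> 0 <= N ->
  M ^+ 2 <= e -> N ^+ 2 = P + D -> `|b - a| <= M * N -> a ^+ 2 <= e * (D + 4 * lam ^+ 2 * P) ->
  b ^+ 2 <= 4 * e * (D + 4 * lam ^+ 2 * P).
Proof.
move=> l1 P0 D0 M0 N0 hM hN hz ha.
have e0 : 0 <= e by apply: le_trans hM; exact: sqr_ge0.
have h1 : (b - a) ^+ 2 <= e * (P + D).
  rewrite -hN -(real_normK (num_real (b - a))).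
  apply: (@le_trans _ _ ((M * N) ^+ 2)); first by rewrite lerXn2r ?nnegrE// mulr_ge0.
  by rewrite exprMn ler_wpM2r ?sqr_ge0.
have l2 : 1 <= lam ^+ 2 by rewrite exprn_ege1.
have h2 : e * P <= e * (lam ^+ 2 * P) by rewrite ler_wpM2l// ler_peMl.
have h3 : 0 <= e * P by rewrite mulr_ge0.
have h4 : 0 <= e * D by rewrite mulr_ge0.
by have := sqr_ge0 (b - 2 * a); lra.
Qed.

Lemma HsmF_perturb (lam e : R) (u v : Hm1 R) : 1 <= lam -> HsmF lam e u ->
  Hm1norm (v - u) ^+ 2 <= e -> HsmF lam (4 * e) v.
Proof.
move=> l1 hu hv phi; have sp := schS phi; have s1 := sch_d sp.
have := hu phi; rewrite ID; [|by nice_tac|by nice_tac]; rewrite IZ; last by nice_tac.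
have P0 : 0 <= I (fun x => phi x ^+ 2) by apply: I_ge0 => x; exact: sqr_ge0.
have D0 : 0 <= I (fun x => phi^`() x ^+ 2) by apply: I_ge0 => x; exact: sqr_ge0.
exact: (perturb_arith l1 P0 D0 (Hm1norm_ge0 (v - u)) (H1norm_ge0 phi) hv (H1norm2 phi)
  (Hm1normP (v - u) phi)).
Qed.

(** The weak limit need not belong to the equicontinuous family; it inherits the bound because the
    inequality is tested on one [phi] at a time. *)
Lemma HsmF_weak (lam e : R) (u : nat -> Hm1 R) (v : Hm1 R) : weak_cvg u v ->
  (forall n, HsmF lam e (u n)) -> HsmF lam e v.
Proof.
move=> huv hu phi; have h := @weak_cvg_test R u v phi huv.
have h2 : u n phi ^+ 2 @[n --> \oo] --> v phi ^+ 2.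
  by rewrite expr2; under eq_fun do rewrite expr2; exact: cvgM.
by apply: (cvgr_to_le h2); apply: nearW => n; exact: hu.
Qed.

Lemma Hsm_rsm (k e : R) (q : R -> R) : 16 <= k -> 0 <= e -> e <= 64^-1 -> sch q -> Hsm k e q ->
  rsm k (4 * e) q.
Proof. by move=> h1 h2 h3 h4 h5; have [u] := riccati_exists h1 h2 h3 h4 h5; exists u. Qed.

(** [K] is the real cube root for which [N] time steps add up to exactly [T]; a large [N] makes it
    large. *)
Lemma cube_root_seq (T Kmin : R) : 0 < T -> 0 < Kmin -> exists N : nat, exists K : R,
  Kmin <= K /\ N%:R * (12 * K ^+ 3)^-1 = T.
Proof.
move=> T0 K0; pose N := (Num.truncn (12 * T * Kmin ^+ 3)).+1.
have hN : 12 * T * Kmin ^+ 3 <= N%:R by apply: ltW; rewrite /N truncnS_gt.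
have c0 : 0 < 12 * T by rewrite mulr_gt0.
have x0 : 0 < N%:R / (12 * T) by rewrite divr_gt0.
pose K := (N%:R / (12 * T)) `^ (3^-1).
have K3 : K ^+ 3 = N%:R / (12 * T).
  by rewrite -powR_mulrn ?powR_ge0// -powRrM mulVf// powRr1// ltW.
have Kp : 0 <= K by exact: powR_ge0.
exists N, K; split.
  rewrite -(ler_pXn2r (n := 3))// ?nnegrE//; last exact: ltW.
  by rewrite K3 ler_pdivlMr// mulrC.
rewrite K3; field; rewrite lt0r_neq0//=; exact: lt0r_neq0.
Qed.

Lemma chain_arith (X Y a b a' b' e : R) : `|X - a| <= e / 8 -> `|Y - b| <= e / 8 ->
  `|a' - a| <= e / 8 -> `|b' - b| <= e / 8 -> `|a' - b'| <= e / 8 -> 0 < e -> `|X - Y| <= e.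
Proof.
rewrite !ler_norml => /andP[? ?] /andP[? ?] /andP[? ?] /andP[? ?] /andP[? ?] ?.
by apply/andP; split; lra.
Qed.

Lemma triangle_arith (a b c d e : R) : `|a - c| <= e / 4 -> `|b - d| <= e / 4 ->
  `|c - d| <= e / 2 -> `|a - b| <= e.
Proof.
by rewrite !ler_norml => /andP[? ?] /andP[? ?] /andP[? ?]; apply/andP; split; lra.
Qed.

(* The four error terms of [flow_approx] are made small by choosing [s], then
   [d], and finally [K]. *)
Lemma parameters (T C1 C2 Kmin e : R) : 0 < T -> 0 <= C1 -> 0 <= C2 -> 0 < Kmin -> 0 < e ->
  exists s d : R, [/\ 0 < s, 0 < d, d <= 1 & forall K1 : R, exists N : nat, exists K : R,
  [/\ Kmin <= K, K1 <= K, N%:R * (12 * K ^+ 3)^-1 = T &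
  T * (C1 * (K^-1 + d) + 2 * C2 * (12 * K ^+ 3)^-1 / s) + 2 * C2 * s <= e]].
Proof.
move=> T0 C10 C20 Km e0.
have C2p : 0 < C2 + 1 by lra.
have C1p : 0 < C1 + 1 by lra.
pose s := e / (8 * (C2 + 1)).
have s0 : 0 < s by rewrite divr_gt0// mulr_gt0.
pose d0 := e / (4 * T * (C1 + 1)).
have d00 : 0 < d0 by rewrite divr_gt0// !mulr_gt0.
exists s, (Num.min 1 d0); split => //; [by rewrite lt_min ltr01|by rewrite ge_min lexx|move=> K1].
pose A := T * (C1 + 2 * C2 / s).
have A0 : 0 <= A by rewrite mulr_ge0 ?(ltW T0)// addr_ge0// divr_ge0 ?(ltW s0)// mulr_ge0.
pose M := Kmin + `|K1| + 1 + 4 * A / e.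
have Ae : 0 <= 4 * A / e by rewrite divr_ge0 ?(ltW e0)// mulr_ge0.
have K1n := ler_norm K1; have K1p := normr_ge0 K1.
have M0 : 0 < M by rewrite /M; lra.
have [N [K [MK NK]]] := cube_root_seq T0 M0.
have K0 : 0 < K by lra.
exists N, K; split => //; [by rewrite /M in MK; lra|by rewrite /M in MK; lra|].
have hs : 2 * C2 * s <= e / 4.
  rewrite /s mulrA ler_pdivrMr; last by rewrite mulr_gt0.
  by have := mulr_ge0 (ltW e0) C20; lra.
have hd : T * C1 * Num.min 1 d0 <= e / 4.
  apply: (@le_trans _ _ (T * C1 * d0)).
    by rewrite ler_wpM2l ?ge_min ?lexx ?orbT// mulr_ge0// ltW.
  rewrite /d0 mulrA ler_pdivrMr; last by rewrite !mulr_gt0.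
  by have := mulr_ge0 (ltW e0) (ltW T0); have := mulr_ge0 (mulr_ge0 (ltW e0) (ltW T0)) C10; lra.
have K1' : 1 <= K by rewrite /M in MK; lra.
have hK : A * K^-1 <= e / 4.
  have : 4 * A / e <= K by rewrite /M in MK; lra.
  by rewrite !ler_pdivrMr// => h; lra.
have tK : (12 * K ^+ 3)^-1 <= K^-1.
  rewrite lef_pV2 ?posrE ?mulr_gt0 ?exprn_gt0//.
  have : 1 <= K ^+ 2 by rewrite exprn_ege1.
  move=> K2; have := ler_wpM2l (ltW K0) K2; have := ltW K0.
  by rewrite -exprS; lra.
have c0 : 0 <= T * (2 * C2 / s).
  by rewrite mulr_ge0 ?(ltW T0)// divr_ge0 ?(ltW s0)// mulr_ge0.
have := ler_wpM2l c0 tK => ht.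
have -> : T * (C1 * (K^-1 + Num.min 1 d0) + 2 * C2 * (12 * K ^+ 3)^-1 / s) =
  T * C1 * K^-1 + T * C1 * Num.min 1 d0 + T * (2 * C2 / s) * (12 * K ^+ 3)^-1.
  by move: (Num.min _ _) (K^-1) (s^-1) => *; ring.
have e1 : A * K^-1 = T * C1 * K^-1 + T * (2 * C2 / s) * K^-1 by rewrite /A; ring.
by lra.
Qed.

Lemma obs_test (k d S : R) (q : R -> R) (phi : R -> R) : 16 <= k -> d <= 1 -> sch q -> sch phi ->
  rsm k d q -> 0 <= S -> (forall x, `|phi x| <= S) -> (forall x, `|phi^`() x| <= S) ->
  `|I (fun x => q x * phi x) - obs k q (fun x => k * (phi^`()^`() x - 4 * k ^+ 2 * phi x))| <= 100 * S * d.
Proof.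
move=> k16 d1 sq sp hr S0 h0 h1; have k0 : 0 < k by lra.
have [ru Iu] := rsm_ricsol k0 hr.
apply: (le_trans (test_approx k16 sq ru (le_trans Iu d1) (hsolP k0 hr) sp h0 h1)).
by rewrite ler_wpM2l// mulr_ge0.
Qed.

Lemma schwartz_bounds (chi : R -> R) : sch chi -> exists S : R, [/\ 0 <= S,
  forall x, `|chi^`() x| <= S * wt x, forall x, `|chi^`()^`() x| <= S * wt x,
  forall x, `|chi^`()^`()^`() x| <= S * wt x & forall x, `|chi^`()^`()^`()^`() x| <= S * wt x].
Proof.
move=> s0; have s1 := sch_d s0; have s2 := sch_d s1; have s3 := sch_d s2; have s4 := sch_d s3.
have [_ [A hA]] := sch_nice s1; have [_ [B hB]] := sch_nice s2.
have [_ [C hC]] := sch_nice s3; have [_ [D hD]] := sch_nice s4.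
exists (`|A| + `|B| + `|C| + `|D|).
have nA := normr_ge0 A; have nB := normr_ge0 B; have nC := normr_ge0 C; have nD := normr_ge0 D.
have lA := ler_norm A; have lB := ler_norm B; have lC := ler_norm C; have lD := ler_norm D.
split; first by rewrite !addr_ge0.
- by move=> x; apply: (le_trans (hA x)); apply: ler_wpM2r; [exact: wt_ge0|clear hA hB hC hD; lra].
- by move=> x; apply: (le_trans (hB x)); apply: ler_wpM2r; [exact: wt_ge0|clear hA hB hC hD; lra].
- by move=> x; apply: (le_trans (hC x)); apply: ler_wpM2r; [exact: wt_ge0|clear hA hB hC hD; lra].
- by move=> x; apply: (le_trans (hD x)); apply: ler_wpM2r; [exact: wt_ge0|clear hA hB hC hD; lra].
Qed.

Section Pair.
Variables (f g : nat -> schwartz R) (u0 : Hm1 R).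
Hypotheses (fw : weak_cvg (fun n => Hm1_of_schwartz (f n)) u0)
  (gs : Hm1norm (Hm1_of_schwartz (g n) - u0) @[n --> \oo] --> 0)
  (fH : forall e : R, 0 < e -> exists2 L : R, 0 < L &
     forall lam n, L <= lam -> HsmF lam e (Hm1_of_schwartz (f n))).

(** The limit [u0] inherits the bound of the [f n], and the [g n] approach it in norm. Starting from
    [e / 4] pays for the factor 4 of [HsmF_perturb]. *)
Lemma uniform_Hsm (e : R) : 0 < e -> exists2 L : R, 16 <= L & \forall n \near \oo,
  forall lam, L <= lam -> Hsm lam e (f n) /\ Hsm lam e (g n).
Proof.
move=> e0; have e4 : 0 < e / 4 by lra.
have [L L0 hL] := fH e4.
pose d := Num.sqrt (e / 4); have d0 : 0 < d by rewrite sqrtr_gt0.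
have d2 : d ^+ 2 = e / 4 by rewrite sqr_sqrtr// ltW.
have /cvgr0Pnorm_le/(_ _ d0) hn := gs.
exists (L + 16); first by lra.
move: hn; apply: filterS => n hn lam hlam.
have hu m : HsmF lam (e / 4) (Hm1_of_schwartz (f m)) by apply: hL; lra.
split.
  by apply: (@HsmW _ _ (e / 4)); [lra|exact/HsmF_schwartz].
apply/HsmF_schwartz; have -> : e = 4 * (e / 4) by field.
apply: (HsmF_perturb _ (HsmF_weak fw hu)); first by lra.
rewrite -d2 lerXn2r ?nnegrE ?Hm1norm_ge0 ?(ltW d0)//.
by move: hn; rewrite ger0_norm// Hm1norm_ge0.
Qed.

Lemma pair_wclose (K eta : R) : 1 <= K -> 0 < eta ->
  \forall n \near \oo, wclose K eta (f n) (g n).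
Proof.
move=> K1 eta0; apply: weak_wclose => //.
- by move=> n; exact: schS.
- by move=> n; exact: schS.
- move=> e e0; have e4 : 0 < e / 4 by lra.
  have [L L16 hL] := uniform_Hsm e4; exists L; first by lra.
  move: hL; apply: filterS => n hn phi sp; have [h1 h2] := hn _ (lexx L).
  have sf := schS (f n); have sg := schS (g n).
  have -> : I (fun x => (f n x - g n x) * phi x) = I (fun x => f n x * phi x) - I (fun x => g n x * phi x).
    by rewrite -IB; [|by nice_tac|by nice_tac]; apply: eq_I => x; ring.
  have := h1 _ sp; have := h2 _ sp.
  move: (I _) (I _) (I _) => a D b; clear; move=> hb ha.
  by have := sqr_ge0 (a + b); lra.
- move=> phi sp.
  have h1 : Hm1_of_schwartz (f n) (mkS sp) @[n --> \oo] --> u0 (mkS sp).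
    exact: weak_cvg_test fw.
  have h2 : Hm1_of_schwartz (g n) (mkS sp) @[n --> \oo] --> u0 (mkS sp).
    apply/cvgrPdist_le => e e0.
    have d0 : 0 < e / (1 + H1norm (mkS sp)).
      by rewrite divr_gt0// ltr_pwDl// H1norm_ge0.
    have /cvgr0Pnorm_le/(_ _ d0) := gs; apply: filterS => n.
    rewrite (ger0_norm (Hm1norm_ge0 _)) ler_pdivlMr; last by rewrite ltr_pwDl// H1norm_ge0.
    move=> hn; rewrite distrC.
    apply: (le_trans (Hm1normP (Hm1_of_schwartz (g n) - u0) (mkS sp))).
    apply: le_trans hn; rewrite ler_wpM2l ?Hm1norm_ge0// lerDr//.
  suff E n : I (fun x => (f n x - g n x) * phi x) =
      Hm1_of_schwartz (f n) (mkS sp) - Hm1_of_schwartz (g n) (mkS sp).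
    rewrite (funext E) [X in _ --> X](_ : 0 = u0 (mkS sp) - u0 (mkS sp)); last by rewrite subrr.
    exact: cvgB.
  have sf := schS (f n); have sg := schS (g n).
  transitivity (I (fun x => f n x * phi x) - I (fun x => g n x * phi x)); last by [].
  by rewrite -IB; [|by nice_tac|by nice_tac]; apply: eq_I => x; ring.
Qed.

Variables (sf sg : nat -> R -> schwartz R) (T : R).
Hypotheses (T0 : 0 < T) (sfP : forall n, kdvsol (fun t => sf n t : R -> R)) (sf0 : forall n, sf n 0 = f n)
  (sgP : forall n, kdvsol (fun t => sg n t : R -> R)) (sg0 : forall n, sg n 0 = g n).

Lemma uniform_rsm (d : R) : 0 < d -> d <= 1024^-1 -> exists2 L : R, 16 <= L & \forall n \near \oo,
  forall lam, L <= lam -> rsm lam d (f n) /\ rsm lam d (g n).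
Proof.
move=> d0 d1; have d4 : 0 < d / 4 by lra.
have [L L16 hL] := uniform_Hsm d4; exists L => //.
move: hL; apply: filterS => n hn lam hl; have [h1 h2] := hn _ hl.
have E : 4 * (d / 4) = d by field.
have l16 : 16 <= lam by lra.
have d64 : d / 4 <= 64^-1 by lra.
by rewrite -E; split; apply: (Hsm_rsm l16 (ltW d4) d64) => //; exact: schS.
Qed.

(** Conservation of the integral at the fixed parameter [L] bounds the solutions at time [T]. This
    bound is what allows passing from test functions to all continuous functionals. *)
Lemma uniform_norm : exists B : R, \forall n \near \oo,
  Hm1norm (Hm1_of_schwartz (sf n T)) <= B /\ Hm1norm (Hm1_of_schwartz (sg n T)) <= B.
Proof.
have d0 : 0 < 1024^-1 :> R by rewrite invr_gt0 ltr0n.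
have [L L16 hL] := uniform_rsm d0 (lexx _); exists (5 * L).
have L1 : 1 <= L by lra.
have d1 : 1024^-1 <= 1 :> R by lra.
move: hL; apply: filterS => n hn; have [h1 h2] := hn _ (lexx L).
split; apply: (norm_of_rsm L1 d1).
- by apply: (rsm_flow L16 (lexx _) (sfP n)); rewrite sf0.
- by apply: (rsm_flow L16 (lexx _) (sgP n)); rewrite sg0.
Qed.

(** The parameters are chosen in the order [d0], [k], [chi], then [s] and [d], then [d1], [L], then
    [N] and [K], then [eta], and last [n]; the number of steps is thus fixed before [n] tends to
    infinity. There are five errors of [e / 8]: two from [obs_test], two from [flow_approx] and one
    from [obs_iter_close]. *)
Lemma test_cvg (phi : schwartz R) (e : R) : 0 < e -> \forall n \near \oo,
  `|Hm1_of_schwartz (sf n T) phi - Hm1_of_schwartz (sg n T) phi| <= e.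
Proof.
move=> e0; have e8 : 0 < e / 8 by lra.
have sp := schS phi; have s1 := sch_d sp; have s2 := sch_d s1.
have [S [S0 hS0 hS1]] : exists S : R, [/\ 0 <= S, forall x, `|phi x| <= S & forall x, `|phi^`() x| <= S].
  have [A hA] := rapid_bounded (sch_rapid sp); have [B hB] := rapid_bounded (sch_rapid s1).
  exists (`|A| + `|B|); split; first by rewrite addr_ge0.
  - by move=> x; apply: (le_trans (hA x)); apply: (le_trans (ler_norm A)); rewrite lerDl.
  - by move=> x; apply: (le_trans (hB x)); apply: (le_trans (ler_norm B)); rewrite lerDr.
have S1 : 0 < S + 1 by lra.
have x0 : 0 < 1024^-1 :> R by rewrite invr_gt0 ltr0n.
have y0 : 0 < e / (800 * (S + 1)) by apply: divr_gt0 e0 _; apply: mulr_gt0 S1; rewrite ltr0n.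
have [d0 [d00 d01 hd0]] : exists d0 : R, [/\ 0 < d0, d0 <= 1024^-1 & 100 * S * d0 <= e / 8].
  exists (Num.min 1024^-1 (e / (800 * (S + 1)))); split.
  - by rewrite lt_min x0.
  - by rewrite ge_min lexx.
  apply: (@le_trans _ _ (100 * S * (e / (800 * (S + 1))))).
    by apply: ler_wpM2l; [exact: (mulr_ge0 (ler0n _ 100) S0)|rewrite ge_min lexx orbT].
  rewrite mulrA ler_pdivrMr; last by apply: mulr_gt0 S1; rewrite ltr0n.
  by have := mulr_ge0 (ltW e0) S0; lra.
have d0le1 : d0 <= 1 by apply: (le_trans d01); rewrite invf_le1 ?ltr0n// ler1n.
have [k k16 hk] := uniform_rsm d00 d01.
(* Observing the Green function with [chi] recovers the pairing with [phi], up to the error of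
   [test_approx]. *)
have [chi chiE schi] : exists2 chi : R -> R,
    chi = (fun x => k * (phi^`()^`() x - 4 * k ^+ 2 * phi x)) & sch chi.
  by exists (fun x => k * (phi^`()^`() x - 4 * k ^+ 2 * phi x)) => //; sch_tac.
have [S' [S'0 b1 b2 b3 b4]] := schwartz_bounds schi.
have C10 : 0 <= 2000 * S' * (1 + k ^+ 2 + k ^+ 4).
  apply: (mulr_ge0 (mulr_ge0 (ler0n _ 2000) S'0)).
  have k0 : 0 <= k by lra.
  by rewrite !addr_ge0 ?exprn_ge0 ?ler01.
have C20 : 0 <= 200 * S' * (1 + k ^+ 2).
  by apply: (mulr_ge0 (mulr_ge0 (ler0n _ 200) S'0)); rewrite addr_ge0 ?sqr_ge0 ?ler01.
have k2 : 0 < 2 * k by lra.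
have [s [d [s0 dp dle1 hpar]]] := parameters T0 C10 C20 k2 e8.
have [d1 [d10 d11 hd1]] : exists d1 : R, [/\ 0 < d1, d1 <= 1024^-1 & 16 * d1 <= d ^+ 2].
  have d2 : 0 < d ^+ 2 / 16 by apply: divr_gt0 => //; exact: exprn_gt0.
  exists (Num.min 1024^-1 (d ^+ 2 / 16)); split.
  - by rewrite lt_min x0.
  - by rewrite ge_min lexx.
  have h : Num.min 1024^-1 (d ^+ 2 / 16) <= d ^+ 2 / 16 by rewrite ge_min lexx orbT.
  by lra.
have [L L16 hL] := uniform_rsm d10 d11.
have [N [K [kK LK NT hE]]] := hpar (2 * L).
have K1 : 1 <= K by lra.
have L2 : L <= K / 2 by lra.
have [eta eta0 heta] := obs_iter_close N k16 kK d0le1 (ltW d10) d11 (sch_shiftf (N%:R / K) schi) e8.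
have hw := pair_wclose K1 eta0.
apply: filterS3 hk hL hw => n h1 h2 h3.
have [h1f h1g] := h1 _ (lexx k); have [h2f h2g] := h2 _ L2.
have gf : bgood k K d0 d1 (sf n 0) by rewrite sf0; split => //; exact: schS.
have gg : bgood k K d0 d1 (sg n 0) by rewrite sg0; split => //; exact: schS.
have fl q (hq : kdvsol q) (h0 : bgood k K d0 d1 (q 0)) :
    `|obs k (iter N (backlund_op K) (q 0)) (shiftf (N%:R / K) chi) - obs k (q T) chi| <= e / 8.
  have := flow_approx k16 kK d01 (ltW d10) d11 N hq h0 schi (sch_dv schi) (sch_dv (sch_d schi))
   (sch_dv (sch_d (sch_d schi))) (sch_dv (sch_d (sch_d (sch_d schi)))) S'0 b1 b2 b3 b4 dp dle1 hd1 s0.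
  by rewrite NT => h; exact: le_trans h hE.
have ot (q : R -> schwartz R) (hq : kdvsol (fun t => q t : R -> R)) (h0 : rsm k d0 (q 0)) :
    `|Hm1_of_schwartz (q T) phi - obs k (q T) chi| <= e / 8.
  have hr := rsm_flow k16 d01 hq h0 T.
  by rewrite chiE; exact: (le_trans (obs_test k16 d0le1 (schS (q T)) sp hr S0 hS0 hS1) hd0).
have rf : rsm k d0 (sf n 0) by rewrite sf0.
have rg : rsm k d0 (sg n 0) by rewrite sg0.
have hfg : wclose K eta (sf n 0) (sg n 0) by rewrite sf0 sg0.
exact: (chain_arith (ot _ (sfP n) rf) (ot _ (sgP n) rg) (fl _ (sfP n) gf) (fl _ (sgP n) gg)
  (heta _ _ gf gg hfg) e0).
Qed.

Lemma functional_cvg (L : {linear Hm1 R -> R^o}) (e : R) : continuous L -> 0 < e ->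
  \forall n \near \oo, `|L (Hm1_of_schwartz (sf n T)) - L (Hm1_of_schwartz (sg n T))| <= e.
Proof.
move=> cL e0; have [B hB] := uniform_norm.
have B1 : 0 < `|B| + 1 by rewrite ltr_wpDl.
have d0 : 0 < e / (4 * (`|B| + 1)) by apply: divr_gt0 => //; exact: mulr_gt0.
have [phi hphi] := functional_approx cL d0.
have e2 : 0 < e / 2 by lra.
have ht := test_cvg phi e2.
apply: filterS2 hB ht => n [h1 h2] h3.
have a1 := hphi (sf n T); have a2 := hphi (sg n T).
have hb (m : R) : m <= B -> e / (4 * (`|B| + 1)) * m <= e / 4.
  move=> hm; rewrite mulrAC ler_pdivrMr; last exact: mulr_gt0.
  have -> : e / 4 * (4 * (`|B| + 1)) = e * (`|B| + 1) by field.
  rewrite ler_pM2l//; have := ler_norm B; lra.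
have c1 := le_trans a1 (hb _ h1); have c2 := le_trans a2 (hb _ h2).
exact: (triangle_arith c1 c2 h3).
Qed.

End Pair.

End WeakContinuity.

Theorem theorem8p5 (R : realType)
  (Phi : R -> Hm1 R -> Hm1 R) (Phi_kdv : kdv_flow Phi)
  (T : R) (T_gt0 : 0 < T)
  (Q : set (Hm1 R)) (Q_bounded : bounded_set Q)
  (Q_equicontinuous : translation_equicontinuous Q)
  (qn0 : nat -> schwartz R)
  (qn0_in_Q : forall n, Q (Hm1_of_schwartz (qn0 n)))
  (q0 : Hm1 R)
  (qn0_cvg : weak_cvg (fun n => Hm1_of_schwartz (qn0 n)) q0) :
  exists2 s : nat -> nat, increasing_seq s &
    weak_cvg (fun n => Phi T (Hm1_of_schwartz (qn0 (s n)))) (Phi T q0).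
Proof.
have [cPhi flow] := Phi_kdv.
(* Schwartz data approaching [q0] in norm: the comparison sequence, along which continuity of [Phi]
   gives the limit. *)
have [g hg] : exists g : nat -> schwartz R,
    forall n, Hm1norm (Hm1_of_schwartz (g n) - q0) <= n.+1%:R^-1.
  have h (n : nat) : exists f, Hm1norm (Hm1_of_schwartz f - q0) <= n.+1%:R^-1.
    by apply: schwartz_dense; rewrite invr_gt0 ltr0n.
  by have [g hg] := choice h; exists g.
have gs : Hm1norm (Hm1_of_schwartz (g n) - q0) @[n --> \oo] --> 0.
  apply/cvgr0Pnorm_le => e e0.
  have /cvgr0Pnorm_le/(_ _ e0) := @cvg_harmonic R; apply: filterS => n hn.
  rewrite ger0_norm ?Hm1norm_ge0//; apply: (le_trans (hg n)).
  exact: (le_trans (ler_norm _) hn).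
have fH e : 0 < e -> exists2 L : R, 0 < L &
    forall lam n, L <= lam -> HsmF lam e (Hm1_of_schwartz (qn0 n)).
  move=> e0; have [L L0 hL] := equicontinuous_HsmF Q_bounded Q_equicontinuous e0.
  by exists L => // lam n hl; exact: hL.
have sol f : exists q : R -> schwartz R, [/\ kdvsol (fun t => q t : R -> R), q 0 = f &
    Phi T (Hm1_of_schwartz f) = Hm1_of_schwartz (q T)].
  by have [q [h1 h2 h3]] := flow f; exists q; split => //; exact: kdvsolP.
have [S hS] := choice sol.
(* The argument applies to the whole sequence, so the identity serves as the extraction. *)
exists id => [//|L cL].
apply/cvgrPdist_le => e e0; have e2 : 0 < e / 2 by lra.
have h1 : \forall n \near \oo, `|L (Hm1_of_schwartz (S (qn0 n) T)) - L (Hm1_of_schwartz (S (g n) T))| <= e / 2.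
  have p1 n : kdvsol (fun t => S (qn0 n) t : R -> R) by have [] := hS (qn0 n).
  have p2 n : S (qn0 n) 0 = qn0 n by have [] := hS (qn0 n).
  have p3 n : kdvsol (fun t => S (g n) t : R -> R) by have [] := hS (g n).
  have p4 n : S (g n) 0 = g n by have [] := hS (g n).
  exact: (@functional_cvg R qn0 g q0 qn0_cvg gs fH (fun n => S (qn0 n)) (fun n => S (g n)) T
    T_gt0 p1 p2 p3 p4 L _ cL e2).
have gq : Hm1_of_schwartz (g n) @[n --> \oo] --> q0.
  apply/cvgrPdist_le => d d0.
  have /cvgr0Pnorm_le/(_ _ d0) := gs; apply: filterS => n.
  by rewrite ger0_norm ?Hm1norm_ge0// distrC.
have gT : (T, Hm1_of_schwartz (g n)) @[n --> \oo] --> (nbhs T, nbhs q0).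
  by apply: (@cvg_pair _ _ _ _ _ _ _ _ _ (fun=> T)); [exact: cvg_cst|exact: gq].
have h2 : L (Phi T (Hm1_of_schwartz (g n))) @[n --> \oo] --> L (Phi T q0).
  have h := cvg_comp _ _ gT (cPhi (T, q0)).
  exact: cvg_comp _ _ h (cL (Phi T q0)).
have /cvgrPdist_le/(_ _ e2) h3 := h2.
apply: filterS2 h1 h3 => n.
have [_ _ ->] := hS (g n); have [_ _ ->] := hS (qn0 n).
rewrite distrC !ler_norml => /andP[? ?] /andP[? ?].
by apply/andP; split; lra.
Qed.
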